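(* Let $B\subset W$ be a good lattice, $l=l(B)$, and $A$ a self-dual lattice with $B\subset A\subset B^*$; let $(e_1,\dots,e_r,f_1,\dots,f_r)$ be a self-dual basis of $W$ such that $B=\bigoplus_{i\le l}\varpi\mathcal{O}e_i\oplus\bigoplus_{i>l}\mathcal{O}e_i\oplus\bigoplus_{i}\mathcal{O}f_i$ and $A=\bigoplus_i\mathcal{O}e_i\oplus\bigoplus_i\mathcal{O}f_i$. The representation $S^A_\psi$ of $K_B$ satisfies the following relations, which determine it entirely: $$S^A_\psi(p)=\zeta(p)M_A(p),\quad p\in P_B,$$ $$S^A_\psi(\varsigma_B)=\left(\frac{-1}{q}\right)^{l}\omega(1)^{-l}q^{\frac l2}M_A(\varsigma_B).$$
   Context: $k$ is a non-archimedean local field of characteristic $0$ with ring of integers $\mathcal{O}$, uniformizer $\varpi$, residue field $\mathbb{F}_q$ of characteristic $p\neq2$; $\psi$ is a non-trivial unitary character of $(k,+)$ with conductor $\lambda_\psi$ (trivial on $\varpi^{\lambda_\psi}\mathcal{O}$, not on $\varpi^{\lambda_\psi-1}\mathcal{O}$); $\overline\psi$ is the character of $\mathbb{F}_q$ with $\overline\psi(x\bmod\varpi)=\psi(\varpi^{\lambda_\psi-1}x)$. $(W,\beta)$ is a symplectic $k$-space of dimension $2r>0$. A self-dual basis is one with $\beta(e_i,e_j)=\beta(f_i,f_j)=0$, $\beta(e_i,f_j)=\varpi^{\lambda_\psi}\delta_{ij}$. A lattice is a compact open $\mathcal{O}$-submodule; $B^*=\{v\in W:\beta(v,b)\in\varpi^{\lambda_\psi}\mathcal{O}\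 \forall b\in B\}$; $B$ is good if $\varpi B^*\subset B\subset B^*$, self-dual if $B=B^*$. $K_B$ is the stabilizer of $B$ in $Sp(W)$. $\mathrm{b}^*=B^*/B$ is an $\mathbb{F}_q$-space with symplectic form $\beta_{\mathrm{b}^*}(\bar v,\bar w)=\varpi^{1-\lambda_\psi}\beta(v,w)\bmod\varpi$, of dimension $2l$, $l=l(B)$; $p_{Sp(\mathrm{b}^* )}:K_B\to Sp(\mathrm{b}^* )$ is the induced morphism. $\mathrm{x}=A/B$ is a Lagrangian of $\mathrm{b}^*$. $P_B=K_A\cap K_B$ is the preimage in $K_B$ of the stabilizer of $\mathrm{x}$; $\zeta(p)=\left(\frac{\det(p_{Sp(\mathrm{b}^* )}(p)_{|\mathrm{x}})}{q}\right)$ for $p\in P_B$, where $\left(\frac{\cdot}{q}\right)$ is the quadratic (Legendre) character of $\mathbb{F}_q^\times$. $\varsigma_B\in K_B$ is defined by $\varsigma_B(e_i)=-\varpi^{-1}f_i$, $\varsigma_B(f_i)=\varpi e_i$ for $i\le l$, and $\varsigma_B$ fixes $e_i,f_i$ for $i>l$. Put $j(g)=l-\dim(\mathrm{x}\cap g\mathrm{x})$ for $g\in Sp(\mathrm b^* )$, $\omega(a)=q^{-1/2}\sum_{t\in\mathbb{F}_q}\overline\psi(\frac12at^2)$ for $a\in\mathbb F_q^\times$ (depends only on $a$ mod squares), and let $\theta:Sp(\mathrm{b}^* )\to\mathbb{F}_q^\times/(\mathbb{F}_q^\times)^2$ be the function with $\theta(p_1gp_2)=\theta(p_1)\theta(g)\theta(p_2)$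 for $p_1,p_2$ in the stabilizer $P$ of $\mathrm{x}$, $\theta(p)=\det(p_{|\mathrm{x}})$ for $p\in P$, and $\theta(\tau_S)=1$ for $S\subset\{1,\dots,l\}$, where, for a symplectic basis $(\epsilon_i,\phi_i)$ of $\mathrm b^*$ with the $\epsilon_i$ spanning $\mathrm{x}$, $\tau_S \epsilon_i=\phi_i,\ \tau_S\phi_i=-\epsilon_i$ for $i\in S$ and $\tau_S$ fixes $\epsilon_i,\phi_i$ for $i\notin S$. Put $m(g)=\omega(\theta(g))^{-1}\omega(1)^{1-j(g)}$. $\mathcal{H}^A_\psi$ is the Hilbert space of functions $\varphi:W\to\mathbb{C}$ with $\varphi(a+w)=\psi(\frac12\beta(w,a))\varphi(w)$ ($a\in A$) and $\int_{W/A}|\varphi|^2<\infty$. For $g\in Sp(W)$, $$M_A(g)\varphi(w)=[A:A\cap gA]^{-1}\sum_{a\in A/(A\cap gA)}\psi(\tfrac12\beta(a,w))\varphi(g^{-1}(a+w)).$$ The representation $S^A_\psi$ of $K_B$ on $\mathcal{H}_\psi^A$ is defined by $S^A_\psi(g)=m(p_{Sp(\mathrm{b}^* )}(g))\,q^{\frac12j(p_{Sp(\mathrm{b}^* )}(g))}M_A(g)$, $g\in K_B$. *)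

(* Defs.v *)
From HB Require Import structures.
From mathcomp Require Import all_boot all_order all_algebra sesquilinear.
From mathcomp Require Import finmap.
From mathcomp Require Import all_classical all_reals.
From mathcomp Require Import topology normedtype esum.
From mathcomp Require Import complex.

Set Implicit Arguments.
Unset Strict Implicit.
Unset Printing Implicit Defensive.

Import Order.TTheory GRing.Theory Num.Theory.
Import numFieldNormedType.Exports.

Local Open Scope classical_set_scope.
Local Open Scope ring_scope.

#[short(type="topFieldType")]
HB.structure Definition TopField := {k of GRing.Field k & Topological k}.

Section LocalField.
Variables (k : topFieldType) (v : k -> int).

(* The value v 0 is irrelevant: the valuation of 0 is +oo. *)
Definition val_ge (n : int) : set k := [set x | x = 0 \/ n <= v x].

Definition integers : set k := val_ge 0.

Record nonarchimedean_local_field : Prop := {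
  val_mul : forall x y, x != 0 -> y != 0 -> v (x * y) = v x + v y;
  val_add : forall n x y, val_ge n x -> val_ge n y -> val_ge n (x + y);
  val_normalized : exists2 x, x != 0 & v x = 1;
  val_topology : forall (x : k) (U : set k),
    nbhs x U <-> exists n : int, forall y, val_ge n (y - x) -> U y;
  val_locally_compact : locally_compact [set: k] }.

Definition uniformizer (varpi : k) : Prop := varpi != 0 /\ v varpi = 1.

(* [red] identifies F with the residue field: it restricts to a surjective
   ring morphism from the integers onto F whose kernel is the maximal ideal;
   its values outside the integers are irrelevant. *)
Record residue_map (F : finFieldType) (red : k -> F) : Prop := {
  red_add : forall x y, integers x -> integers y -> red (x + y) = red x + red y;
  red_mul : forall x y, integers x -> integers y -> red (x * y) = red x * red y;
  red_one : red 1 = 1;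
  red_surj : forall t : F, exists2 x, integers x & red x = t;
  red_ker : forall x, integers x -> (red x = 0 <-> val_ge 1 x) }.

Section Character.
Variables (R : realType) (psi : k -> R[i]).

Record unitary_character : Prop := {
  char_add : forall x y, psi (x + y) = psi x * psi y;
  char_unit : forall x, `|psi x| = 1;
  char_continuous : continuous (psi : k -> R[i]^o) }.

Definition conductor (varpi : k) (lam : int) : Prop :=
  (forall x, integers x -> psi (varpi ^ lam * x) = 1) /\
  (exists2 x, integers x & psi (varpi ^ (lam - 1) * x) <> 1).

Definition residue_character (F : finFieldType) (red : k -> F) (varpi : k)
    (lam : int) (t : F) : R[i] :=
  psi (varpi ^ (lam - 1) * xget 0 [set x | integers x /\ red x = t]).

End Character.
End LocalField.

Section LinearAlgebra.
Variables (K : fieldType) (V : vectType K).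

(* Isometries of a nondegenerate form on a finite-dimensional space are
   automatically bijective. *)
Definition isometry_group (b : V -> V -> K) : set 'End(V) :=
  [set g | forall u w, b (g u) (g w) = b u w].

Definition symplectic_form (b : {biscalar V}) : Prop :=
  (forall w, b w w = 0) /\ (forall u, (forall w, b u w = 0) -> u = 0).

Record darboux_basis (b : V -> V -> K) (c : K) (n : nat) (e f : 'I_n -> V)
  : Prop := {
  darboux_basis_of :
    basis_of fullv ([seq e i | i : 'I_n] ++ [seq f i | i : 'I_n]);
  darboux_ee : forall i j, b (e i) (e j) = 0;
  darboux_ff : forall i j, b (f i) (f j) = 0;
  darboux_ef : forall i j, b (e i) (f j) = c *+ (i == j) }.

(* Determinant of the endomorphism of U induced by g, when g maps U to U. *)
Definition det_on (U : {vspace V}) (g : 'End(V)) : K :=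
  \det (\matrix_(i < \dim U, j < \dim U)
          coord (vbasis U) j (g (vbasis U)`_i)).

Definition stabilizer_space (b : V -> V -> K) (U : {vspace V}) : set 'End(V) :=
  [set g | isometry_group b g /\ (g @: U)%VS = U].

Definition is_tau (n : nat) (eps phi : 'I_n -> V) (I : {set 'I_n})
    (t : 'End(V)) : Prop :=
  forall i, if i \in I then t (eps i) = phi i /\ t (phi i) = - eps i
            else t (eps i) = eps i /\ t (phi i) = phi i.

Definition eq_mod_squares (a b : K) : Prop :=
  exists2 c, c != 0 & a = b * c ^+ 2.

(* A function with values in the square classes of K^* is represented by a
   choice of nonzero representatives; equalities hold modulo squares. *)
Record theta_function (b : V -> V -> K) (U : {vspace V}) (n : nat)
    (eps phi : 'I_n -> V) (theta : 'End(V) -> K) : Prop := {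
  theta_neq0 : forall g, isometry_group b g -> theta g != 0;
  theta_mul : forall p1 g p2, stabilizer_space b U p1 -> isometry_group b g ->
    stabilizer_space b U p2 ->
    eq_mod_squares (theta (p1 \o g \o p2)%VF) (theta p1 * theta g * theta p2);
  theta_stab : forall p, stabilizer_space b U p ->
    eq_mod_squares (theta p) (det_on U p);
  theta_tau : forall (I : {set 'I_n}) t, is_tau eps phi I t ->
    eq_mod_squares (theta t) 1 }.

End LinearAlgebra.

Section Legendre.
Variables (R : realType) (F : finFieldType).

Definition legendre (a : F) : R[i] :=
  if a == 0 then 0 else if [exists c : F, a == c ^+ 2] then 1 else -1.

Definition sqrt_card : R[i] := sqrtC (#|F|%:R).

Definition omega (chi : F -> R[i]) (a : F) : R[i] :=
  sqrt_card^-1 * \sum_(t : F) chi (2^-1 * a * t ^+ 2).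

End Legendre.

Section Lattices.
Variables (k : topFieldType) (v : k -> int) (varpi : k) (lam : int).
Variables (W : vectType k) (beta : W -> W -> k).

Definition coordinates (w : W) : 'rV[k]_(\dim {:W}) :=
  \row_i coord (vbasis {:W}) i w.

(* W carries the topology transported from k^(dim W) by a linear isomorphism;
   it does not depend on the isomorphism. *)
Record lattice (L : set W) : Prop := {
  lattice0 : L 0;
  lattice_add : forall x y, L x -> L y -> L (x + y);
  lattice_scale : forall a x, integers v a -> L x -> L (a *: x);
  lattice_compact : compact (coordinates @` L);
  lattice_open : open (coordinates @` L) }.

Definition dual_lattice (L : set W) : set W :=
  [set w | forall b, L b ->
     exists2 a, integers v a & beta w b = varpi ^ lam * a].

Definition good_lattice (L : set W) : Prop :=
  [/\ lattice L, [set varpi *: w | w in dual_lattice L] `<=` L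
    & L `<=` dual_lattice L].

Definition selfdual_lattice (L : set W) : Prop :=
  lattice L /\ L = dual_lattice L.

Definition stabilizer_lattice (L : set W) : set 'End(W) :=
  [set g | isometry_group beta g /\ [set g w | w in L] = L].

(* Indices start at 0, so that i < l stands for i <= l. *)
Definition good_span (l r : nat) (e f : 'I_r -> W) : set W :=
  [set w | exists x y : 'I_r -> k,
     [/\ forall i : 'I_r, if (i < l)%N
                   then exists2 a, integers v a & x i = varpi * a
                   else integers v (x i),
         forall i, integers v (y i)
       & w = \sum_i (x i *: e i + y i *: f i)]].

Definition is_varsigma (l r : nat) (e f : 'I_r -> W) (s : 'End(W)) : Prop :=
  forall i : 'I_r, if (i < l)%N
            then s (e i) = - (varpi^-1 *: f i) /\ s (f i) = varpi *: e i
            else s (e i) = e i /\ s (f i) = f i.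

Section Reduction.
Variables (F : finFieldType) (red : k -> F) (B A : set W).
Variables (bs : vectType F) (pr : W -> bs).

(* [pr] identifies bs with the F-space B^*/B: it restricts to a surjective
   morphism, semilinear along [red], from B^* onto bs, with kernel B; its
   values outside B^* are irrelevant. *)
Record quotient_map : Prop := {
  pr_add : forall x y, dual_lattice B x -> dual_lattice B y ->
    pr (x + y) = pr x + pr y;
  pr_scale : forall a x, integers v a -> dual_lattice B x ->
    pr (a *: x) = red a *: pr x;
  pr_surj : forall u : bs, exists2 x, dual_lattice B x & pr x = u;
  pr_ker : forall x, dual_lattice B x -> (pr x = 0 <-> B x) }.

Definition pr_lift (u : bs) : W := xget 0 [set x | dual_lattice B x /\ pr x = u].

Definition beta_bs (u w : bs) : F :=
  red (varpi ^ (1 - lam) * beta (pr_lift u) (pr_lift w)).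

Definition p_Sp (g : 'End(W)) : 'End(bs) := linfun (fun u => pr (g (pr_lift u))).

(* The subspace A/B of B^*/B. *)
Definition lagrangian : {vspace bs} :=
  xget 0%VS [set U : {vspace bs} | [set u | u \in U] = [set pr a | a in A]].

End Reduction.

Section LatticeModel.
Variables (R : realType) (psi : k -> R[i]).

Definition add_coset (L : set W) (w : W) : set W := [set w + a | a in L].

(* The quotient L/L', as a set of cosets. *)
Definition cosets (L L' : set W) : set (set W) :=
  [set add_coset L' a | a in L].

(* |phi|^2 is A-invariant and W/A is discrete, so that its integral over W/A
   is the sum of its values over representatives of the cosets. *)
Record hilbert_space (A : set W) (phi : W -> R[i]) : Prop := {
  hilbert_equivariant : forall a w, A a ->
    phi (a + w) = psi (2^-1 * beta w a) * phi w;
  hilbert_square_integrable :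
    (\esum_(c in cosets setT A) ((Normc.normc (phi (xget 0 c))) ^+ 2)%:E
       < +oo)%E }.

(* For an isometry g, a selfdual A and phi in hilbert_space A, the summand does
   not depend on the representative of the coset. *)
Definition M_op (A : set W) (g : 'End(W)) (phi : W -> R[i]) (w : W) : R[i] :=
  let Q := cosets A (A `&` [set g a | a in A]) in
  (#|` fset_set Q|%:R)^-1 *
  \sum_(c \in Q) (let a := xget 0 c in
                  psi (2^-1 * beta a w) * phi ((g^-1)%VF (a + w))).

Record representation (G : set 'End(W)) (H : set (W -> R[i]))
    (T : 'End(W) -> (W -> R[i]) -> (W -> R[i])) : Prop := {
  rep_stable : forall g phi, G g -> H phi -> H (T g phi);
  rep_linear : forall g c phi phi', G g -> H phi -> H phi' ->
    T g (fun w => c * phi w + phi' w) = (fun w => c * T g phi w + T g phi' w);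
  rep_one : forall phi, H phi -> T \1%VF phi = phi;
  rep_mul : forall g h phi, G g -> G h -> H phi ->
    T (g \o h)%VF phi = T g (T h phi) }.

End LatticeModel.

Section WeilRepresentation.
Variables (R : realType) (psi : k -> R[i]).
Variables (F : finFieldType) (red : k -> F) (B A : set W).
Variables (bs : vectType F) (pr : W -> bs) (l : nat) (theta : 'End(bs) -> F).

Local Notation x := (lagrangian A pr).
Local Notation psibar := (residue_character v psi red varpi lam).
Local Notation pSp := (p_Sp B pr).

Definition j_index (g : 'End(bs)) : nat := (l - \dim (x :&: (g @: x))%VS)%N.

Definition m_factor (g : 'End(bs)) : R[i] :=
  (omega psibar (theta g))^-1 * omega psibar 1 ^ (1 - (j_index g)%:Z).

Definition S_op (g : 'End(W)) (phi : W -> R[i]) (w : W) : R[i] :=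
  m_factor (pSp g) * sqrt_card R F ^+ j_index (pSp g) * M_op psi A g phi w.

Definition P_group : set 'End(W) :=
  stabilizer_lattice A `&` stabilizer_lattice B.

Definition zeta (p : 'End(W)) : R[i] := legendre R (det_on x (pSp p)).

Record weil_relations (s : 'End(W))
    (T : 'End(W) -> (W -> R[i]) -> (W -> R[i])) : Prop := {
  rel_parabolic : forall p phi, P_group p -> hilbert_space psi A phi ->
    T p phi = (fun w => zeta p * M_op psi A p phi w);
  rel_varsigma : forall phi, hilbert_space psi A phi ->
    T s phi = (fun w => legendre R (-1 : F) ^+ l * omega psibar 1 ^- l *
                        sqrt_card R F ^+ l * M_op psi A s phi w) }.

End WeilRepresentation.
End Lattices.

(* Main.v *)
(** Since [B] is contained in [A] and in [g A] for [g] in [K_B], the operator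
    [M_A(g)] is the average over [x = A/B] of
    [psi(1/2 beta(a, w)) phi(g^-1 (a + w))].  For fixed [w], this summand is, as a
    function of [a] in [B^*/B], equivariant under [g x], so that the
    multiplicativity of [S] is a statement about triple sums over Lagrangians of
    the finite symplectic space [B^*/B].  The elements [h] such that
    [S (g h) = S g S h] for every [g] form a monoid containing the stabilizer of
    [x], so it is enough to treat [h = tau_{i}].  A symplectic basis adapted
    simultaneously to [x], [g^-1 x] and the hyperplane [x :&: h x] then reduces the
    computation to [SL_2], where it is a quadratic Gauss sum.

    Uniqueness holds because [K_B] is generated by [P_B] and [varsigma]: a common
    transversal Lagrangian of [x] and [g x] writes [g] as
    [n varsigma n' varsigma p], where [n] and [n'] lift unipotent elements. *)

Require Import Defs.
From HB Require Import structures.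
From mathcomp Require Import all_boot all_order all_algebra sesquilinear.
From mathcomp Require Import finmap finfield.
From mathcomp Require Import all_classical all_reals.
From mathcomp Require Import topology normedtype esum.
From mathcomp Require Import complex.
From mathcomp Require Import ring.

Set Implicit Arguments.
Unset Strict Implicit.
Unset Printing Implicit Defensive.

Import Order.TTheory GRing.Theory Num.Theory.

Local Open Scope ring_scope.

(** * Legendre symbol and Gauss sums *)

(** Since [omega chi a] is the Legendre symbol of a times [omega chi 1], the factor m(g) q^(j/2)
    equals chi(g) gamma^j, where chi is the Legendre symbol of theta and gamma = q^(1/2) / omega(1),
    with gamma^2 = (-1/q) q. The obstacle is that j is not additive. For a product tau_I n(c)
    tau_{i0}, with n(c) a shear in the plane of index i0, three things can happen. If i0 is outside
    I, the lengths add and the sum contributes no constant. If i0 is in I and c = 0, the length of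
    the product is two less than the total, the square of the Weyl element brings the dilation by
    -1, and gamma^2 = (-1/q) q pays for the sign and for the summation variable that is killed. If
    i0 is in I and c != 0, the length is one less, and the Gauss sum omega(1/c) matches one gamma
    and the sign of the dilation by 1/c. The identity to be proved is quantified over all
    equivariant functions, so that it is equivalent to a composition law of operators; this is what
    makes the set of admissible h closed under products. *)

Section GaussSums.
Variables (R : realType) (F : finFieldType).
Hypothesis two_neq0 : (2 : F) != 0.
Local Notation leg := (legendre R (F := F)).
Implicit Types a b c s t : F.

Lemma legendre_sqr c : c != 0 -> leg (c ^+ 2) = 1.
Proof.
move=> c0; rewrite /legendre expf_eq0 /= (negPf c0).
by case: ifP => // /existsP; case; exists c.
Qed.

Lemma legendre1 : leg 1 = 1.
Proof. by rewrite -(expr1n F 2) legendre_sqr ?oner_eq0. Qed.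

Lemma opp_neq c : c != 0 -> c != - c.
Proof. by move=> c0; rewrite -subr_eq0 opprK -mulr2n -mulr_natl mulf_neq0. Qed.

(** Zero has one square root, a nonzero square has the roots c and -c, distinct because 2 != 0, and
    a nonsquare has none. *)
Lemma card_sqr_fiber s : (#|[set t : F | t ^+ 2 == s]|%:R = 1 + leg s)%R.
Proof.
rewrite /legendre; have [->|s0] := eqVneq s 0.
  rewrite addr0 (_ : [set _ | _] = [set 0]) ?cards1 //.
  by apply/setP => t; rewrite !inE sqrf_eq0.
case: ifP => [/existsP[c /eqP sc]|/existsP nsq]; last first.
  rewrite subrr (_ : [set _ | _] = finset.set0) ?cards0 //.
  apply/setP => t; rewrite !inE; apply/negP => /eqP ts.
  by apply: nsq; exists t; rewrite ts.
have c0 : c != 0 by apply: contraNneq s0 => c0; rewrite sc c0 expr0n.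
rewrite (_ : [set _ | _] = [set c; - c]); last first.
  by apply/setP => t; rewrite !inE sc eqf_sqr.
by rewrite cards2 opp_neq.
Qed.

(** Counting: the squares fill at least half of the nonzero elements, and the translate by a
    nonsquare a is disjoint from them and of the same size. So it is the whole complement, and
    contains b. *)
Lemma mul_nonsquare a b : a != 0 -> b != 0 ->
  ~~ [exists c : F, a == c ^+ 2] -> ~~ [exists c : F, b == c ^+ 2] ->
  [exists c : F, a * b == c ^+ 2].
Proof.
move=> a0 b0 na nb.
pose U := [set x : F | x != 0].
pose Sq := [set x ^+ 2 | x in U].
pose N := [set a * y | y in Sq].
have SqU : Sq \subset U.
  by apply/fintype.subsetP=> z /imsetP[x]; rewrite !inE => x0 ->; rewrite expf_neq0.
have NU : N \subset U.
  apply/fintype.subsetP=> z /imsetP[y ySq ->]; rewrite inE mulf_neq0 //.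
  by have := fintype.subsetP SqU _ ySq; rewrite inE.
have cN : #|N| = #|Sq| by rewrite card_imset //; apply: mulfI.
have dis : [disjoint Sq & N].
  apply/pred0P => z /=; apply/negP => /andP[/imsetP[x]]; rewrite inE => x0 ->.
  case/imsetP => z' /imsetP[y]; rewrite inE => y0 -> e.
  case/negP: na; apply/existsP; exists (x / y); rewrite expr_div_n e mulfK //.
  by rewrite expf_neq0.
(* Each fiber of squaring lies in some {y, -y}, hence has at most two elements. *)
have cU : (#|U| <= 2 * #|Sq|)%N.
  rewrite -sum1_card (partition_big (fun x => x ^+ 2) (fun y => y \in Sq)) /=.
    rewrite mulnC -sum_nat_const leq_sum // => z /imsetP[y]; rewrite inE => y0 ->.
    rewrite sum1_card; apply: (@leq_trans #|[set y; - y]|); last first.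
      by rewrite cards2; case: (_ != _).
    by apply/subset_leq_card/fintype.subsetP => x; rewrite !inE unfold_in /= -eqf_sqr => /andP[].
  by move=> x xU; apply/imsetP; exists x.
have eU : (Sq :|: N) = U.
  apply/eqP; rewrite eqEcard finset.subUset SqU NU /= cardsU.
  by move: dis; rewrite -finset.setI_eq0 => /eqP ->; rewrite cards0 subn0 cN addnn -mul2n.
have : b \in (Sq :|: N) by rewrite eU inE.
case/finset.setUP => [/imsetP[x _ e]|/imsetP[_ /imsetP[y _ ->] ->]].
  by case/negP: nb; apply/existsP; exists x; rewrite e.
by apply/existsP; exists (a * y); rewrite exprMn mulrA.
Qed.

Lemma legendreM a b : leg (a * b) = leg a * leg b.
Proof.
rewrite /legendre mulf_eq0; have [->|a0] := eqVneq a 0; first by rewrite /= !mul0r.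
have [->|b0] := eqVneq b 0; first by rewrite orbT !mulr0.
rewrite /=.
have sqM c (c0 : c != 0) x : [exists d : F, x * c ^+ 2 == d ^+ 2] = [exists d : F, x == d ^+ 2].
  apply/existsP/existsP => [] [d /eqP e]; last by exists (d * c); rewrite e exprMn.
  by exists (d / c); rewrite expr_div_n -e mulfK // expf_neq0.
case: (boolP [exists c : F, a == c ^+ 2]) => [/existsP[c /eqP ac]|na].
  have c0 : c != 0 by apply: contraNneq a0 => c0; rewrite ac c0 expr0n.
  by rewrite mulrC ac sqM // mul1r.
case: (boolP [exists c : F, b == c ^+ 2]) => [/existsP[c /eqP bc]|nb].
  have c0 : c != 0 by apply: contraNneq b0 => c0; rewrite bc c0 expr0n.
  by rewrite bc sqM // (negPf na) mulr1.
by rewrite mul_nonsquare // mulrNN mulr1.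
Qed.

Lemma legendre_sign a : a != 0 -> leg a ^+ 2 = 1.
Proof. by move=> a0; rewrite expr2 -legendreM -expr2 legendre_sqr. Qed.

Lemma legendre_neq0 a : a != 0 -> leg a != 0.
Proof.
by move=> a0; apply: contra_eqN (legendre_sign a0) => /eqP ->; rewrite expr0n eq_sym oner_eq0.
Qed.

Lemma legendreV a : leg a^-1 = leg a.
Proof.
have [->|a0] := eqVneq a 0; first by rewrite invr0.
apply: (mulfI (legendre_neq0 a0)).
by rewrite -legendreM divff // legendre1 -expr2 legendre_sign.
Qed.

Lemma legendreX a n : leg (a ^+ n) = leg a ^+ n.
Proof. by elim: n => [|n IH]; rewrite ?expr0 ?legendre1 // !exprS legendreM IH. Qed.

Lemma eq_mod_squares_legendre a b : eq_mod_squares a b -> leg a = leg b.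
Proof. by case=> c c0 ->; rewrite legendreM legendre_sqr ?mulr1. Qed.

Variable chi : F -> R[i].
Hypothesis chi0 : chi 0 = 1.
Hypothesis chiD : forall s t, chi (s + t) = chi s * chi t.
Hypothesis chi_nontriv : exists t, chi t != 1.

(** A translation of the variable multiplies the sum by a value of [chi] other than 1. *)
Lemma add_char_sum c : c != 0 -> \sum_t chi (c * t) = 0.
Proof.
move=> c0; case: chi_nontriv => t0 t01.
set S := \sum_t _.
have e : S = chi t0 * S.
  rewrite {1}/S (reindex_inj (addIr (t0 / c))) mulr_sumr; apply: eq_bigr => t _ /=.
  by rewrite mulrDr mulrCA divff // mulr1 chiD mulrC.
apply/eqP; move/eqP: e; rewrite -subr_eq0 -{1}[S]mul1r -mulrBl mulf_eq0 subr_eq0 eq_sym.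
by rewrite (negPf t01).
Qed.

(** Grouping t by its square s weights s by 1 + leg s; the constant weight sums to zero, and
    rescaling s in the rest extracts the symbol of a. *)
Lemma gauss_sumE a : a != 0 ->
  \sum_t chi (2^-1 * a * t ^+ 2) = leg a * \sum_t chi (2^-1 * t) * leg t.
Proof.
move=> a0; rewrite (partition_big (fun t => t ^+ 2) xpredT) //=.
transitivity (\sum_s (chi (2^-1 * a * s) + chi (2^-1 * a * s) * leg s)).
  apply: eq_bigr => s _; rewrite -[X in X + _]mulr1 -mulrDr -card_sqr_fiber mulr_natr -sumr_const.
  by apply: eq_big => [t|t /eqP ->//]; rewrite inE.
rewrite big_split /= add_char_sum ?mulf_neq0 ?invr_neq0 // add0r mulr_sumr.
rewrite (reindex_inj (mulfI (invr_neq0 a0))) /=; apply: eq_bigr => t _.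
by rewrite -mulrA mulVKf // legendreM legendreV mulrCA.
Qed.

Lemma omegaE a : a != 0 -> omega chi a = leg a * omega chi 1.
Proof.
move=> a0; rewrite /omega gauss_sumE // gauss_sumE ?oner_eq0 // legendre1.
by rewrite mul1r mulrCA.
Qed.

Lemma sqrt_card_sqr : sqrt_card R F ^+ 2 = #|F|%:R.
Proof. by rewrite /sqrt_card sqrtCK. Qed.

Lemma card_field_neq0 : #|F|%:R != 0 :> R[i].
Proof. by rewrite pnatr_eq0 -lt0n; apply/card_gt0P; exists 0. Qed.

Lemma sqrt_card_neq0 : sqrt_card R F != 0.
Proof.
by apply: contraNneq card_field_neq0 => z; rewrite -sqrt_card_sqr z expr0n.
Qed.

(** This is the absolute value of the Gauss sum, with -1 in place of complex conjugation. Replacing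
    the second variable by s + t makes the exponent linear in s, so only t = 0 survives. *)
Lemma omega1N1 : omega chi 1 * omega chi (-1) = 1.
Proof.
have q0 := sqrt_card_neq0.
rewrite /omega mulrACA -invfM -expr2 sqrt_card_sqr.
suff -> : (\sum_(t : F) chi (2^-1 * 1 * t ^+ 2)) *
  (\sum_(t : F) chi (2^-1 * -1 * t ^+ 2)) = #|F|%:R.
  by rewrite mulVf ?card_field_neq0.
rewrite mulr_suml.
under eq_bigr => s _.
  rewrite mulr_sumr (reindex_inj (addrI s)) /=.
  over.
rewrite exchange_big /=.
transitivity (\sum_(t : F) chi (- (2^-1 * t ^+ 2)) * \sum_(s : F) chi (- t * s)).
  apply: eq_bigr => t _; rewrite mulr_sumr; apply: eq_bigr => s _.
  by rewrite -!chiD; congr chi; field.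
rewrite (bigD1 0) //= [X in _ + X]big1 ?addr0 => [|t t0]; last first.
  by rewrite add_char_sum ?mulr0 // oppr_eq0.
under eq_bigr do rewrite oppr0 mul0r chi0.
by rewrite expr0n mulr0 oppr0 chi0 mul1r sumr_const.
Qed.

Lemma omega1_neq0 : omega chi 1 != 0.
Proof. by apply: contra_eqN omega1N1 => /eqP ->; rewrite mul0r eq_sym oner_eq0. Qed.

Lemma omega1_sqr : omega chi 1 ^+ 2 = leg (-1).
Proof.
have n1 : (-1 : F) != 0 by rewrite oppr_eq0 oner_eq0.
apply: (mulIf (legendre_neq0 n1)); rewrite -[RHS]expr2 legendre_sign //.
by rewrite expr2 -mulrA [_ * leg _]mulrC -omegaE // omega1N1.
Qed.

End GaussSums.

Lemma linfun_linearE (K : fieldType) (U V : vectType K) (h : U -> V) :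
  (forall a u v, h (a *: u + v) = a *: h u + h v) -> linfun h =1 h.
Proof.
move=> lh.
pose m := GRing.isLinear.Build K U V *:%R h lh.
pose L : {linear U -> V} := HB.pack h m.
exact: (lfunE L).
Qed.

(** * Families of vectors and determinants on a subspace *)

Section FamilySpan.
Variables (K : fieldType) (V : vectType K) (n : nat).
Implicit Types (e : 'I_n -> V) (c : 'I_n -> K).

Lemma mem_span_famP e v :
  v \in <<[seq e i | i : 'I_n]>>%VS <-> exists c, v = \sum_i c i *: e i.
Proof.
split=> [|[c ->]]; last first.
  by apply: memv_suml => i _; apply/memvZ/memv_span/codom_f.
move=> vin; pose X := [tuple e i | i < n].
exists (fun i => coord X i v).
rewrite {1}(@coord_span _ _ n X v vin).
by apply: eq_bigr => i _; rewrite nth_mktuple.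
Qed.

Lemma free_fam e :
  (forall c, \sum_i c i *: e i = 0 -> forall i, c i = 0) ->
  free [seq e i | i : 'I_n].
Proof.
move=> h; apply/(@freeP _ _ n [tuple e i | i < n]) => c e0; apply: h.
by rewrite -[RHS]e0; apply: eq_bigr => i _; rewrite nth_mktuple.
Qed.

(** [det_on] is computed in the basis [vbasis U]. The transition matrix [C] from that basis to [e]
    conjugates it to a diagonal matrix, and the determinant of [C] cancels. *)
Lemma det_on_diag (U : {vspace V}) e c (g : 'End(V)) :
  basis_of U [seq e i | i : 'I_n] -> (forall i, g (e i) = c i *: e i) ->
  det_on U g = \prod_i c i.
Proof.
move=> bU ge.
have dU : \dim U = n by apply: (@size_basis _ _ _ _ [tuple e i | i < n]).
subst n; rewrite /det_on; set M := \matrix_(i, j) _.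
have eU i : e i \in U by rewrite -(span_basis bU) memv_span ?codom_f.
pose C := \matrix_(i, j) coord (vbasis U) j (e i).
have eE i : e i = \sum_j C i j *: (vbasis U)`_j.
  by rewrite {1}(coord_vbasis (eU i)); apply: eq_bigr => j _; rewrite mxE.
have CM : C *m M = diag_mx (\row_i c i) *m C.
  apply/matrixP => i k; rewrite mul_diag_mx !mxE -linearZ /= -ge eE.
  rewrite linear_sum linear_sum; apply: eq_bigr => j _.
  by rewrite !mxE !linearZ.
have uC : C \in unitmx.
  pose X := [tuple e i | i < \dim U].
  pose D := \matrix_(i < \dim U, j < \dim U) coord X j (vbasis U)`_i.
  suff /mulmx1_unit[] : C *m D = 1%:M by [].
  apply/matrixP => i k; rewrite !mxE.
  transitivity (coord X k (e i)); last first.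
    have -> : e i = X`_i by rewrite nth_mktuple.
    by rewrite coord_free ?(basis_free bU).
  by rewrite [in RHS]eE linear_sum; apply: eq_bigr => j _; rewrite linearZ !mxE.
have /(congr1 determinant) := CM.
rewrite !det_mulmx mulrC => /mulIf -> ; last by rewrite -unitfE -unitmxE.
by rewrite det_diag; apply: eq_bigr => i _; rewrite mxE.
Qed.
End FamilySpan.

(** * Symplectic linear algebra *)

Section Symplectic.
Variables (K : fieldType) (V : vectType K) (b : V -> V -> K) (l : nat).
Hypothesis bP : forall a u v w, b (a *: u + v) w = a * b u w + b v w.
Hypothesis bPr : forall a u v w, b w (a *: u + v) = a * b w u + b w v.
Hypothesis balt : forall v, b v v = 0.

Lemma b_Dl u v w : b (u + v) w = b u w + b v w.
Proof. by rewrite -[u]scale1r bP mul1r scale1r. Qed.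

Lemma b_Dr u v w : b w (u + v) = b w u + b w v.
Proof. by rewrite -[u]scale1r bPr mul1r scale1r. Qed.

Lemma b_0l w : b 0 w = 0.
Proof. by apply: (addrI (b 0 w)); rewrite -b_Dl !addr0. Qed.

Lemma b_0r w : b w 0 = 0.
Proof. by apply: (addrI (b w 0)); rewrite -b_Dr !addr0. Qed.

Lemma b_Zl a u w : b (a *: u) w = a * b u w.
Proof. by rewrite -[a *: u]addr0 bP b_0l addr0. Qed.

Lemma b_Zr a u w : b w (a *: u) = a * b w u.
Proof. by rewrite -[a *: u]addr0 bPr b_0r addr0. Qed.

Lemma b_Nl u w : b (- u) w = - b u w.
Proof. by rewrite -scaleN1r b_Zl mulN1r. Qed.

Lemma b_Nr u w : b w (- u) = - b w u.
Proof. by rewrite -scaleN1r b_Zr mulN1r. Qed.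

Lemma b_suml (I : finType) (P : pred I) (h : I -> V) w :
  b (\sum_(i | P i) h i) w = \sum_(i | P i) b (h i) w.
Proof.
apply: (big_morph (fun u => b u w)) => [u v|]; first exact: b_Dl.
exact: b_0l.
Qed.

Lemma b_sumr (I : finType) (P : pred I) (h : I -> V) w :
  b w (\sum_(i | P i) h i) = \sum_(i | P i) b w (h i).
Proof.
apply: (big_morph (fun u => b w u)) => [u v|]; first exact: b_Dr.
exact: b_0r.
Qed.

Lemma b_anti u v : b u v = - b v u.
Proof.
have := balt (u + v); rewrite b_Dl !b_Dr !balt add0r addr0.
by move/eqP; rewrite addr_eq0 => /eqP.
Qed.

(** There is no basis clause: freeness follows by pairing, and a basis is then obtained from the
    dimension. The form is a bare function with bilinearity hypotheses, so that the same lemmas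
    serve the rescaled form on W and the form on the quotient, which is defined through chosen
    lifts. *)
Record frame (e f : 'I_l -> V) : Prop := {
  frame_ee : forall i j, b (e i) (e j) = 0;
  frame_ff : forall i j, b (f i) (f j) = 0;
  frame_ef : forall i j, b (e i) (f j) = (i == j)%:R }.

Definition isotropic (U : {vspace V}) := forall u v, u \in U -> v \in U -> b u v = 0.

Section Frame.
Variables e f : 'I_l -> V.
Hypothesis fr : frame e f.

Lemma frame_fe i j : b (f i) (e j) = - (i == j)%:R.
Proof. by rewrite b_anti (frame_ef fr) eq_sym. Qed.

Lemma b_sum_ef c i : b (\sum_j c j *: e j) (f i) = c i.
Proof.
rewrite b_suml (bigD1 i) //= b_Zl (frame_ef fr) eqxx mulr1 big1 ?addr0 // => j ji.
by rewrite b_Zl (frame_ef fr) (negPf ji) mulr0.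
Qed.

Lemma b_sum_ee c i : b (e i) (\sum_j c j *: e j) = 0.
Proof. by rewrite b_sumr big1 // => j _; rewrite b_Zr (frame_ee fr) ?mulr0. Qed.

Lemma b_sum_fe c i : b (e i) (\sum_j c j *: f j) = c i.
Proof.
rewrite b_sumr (bigD1 i) //= b_Zr (frame_ef fr) eqxx mulr1 big1 ?addr0 // => j ji.
by rewrite b_Zr (frame_ef fr) eq_sym (negPf ji) mulr0.
Qed.

Lemma b_sum_ff c i : b (\sum_j c j *: f j) (f i) = 0.
Proof. by rewrite b_suml big1 // => j _; rewrite b_Zl (frame_ff fr) ?mulr0. Qed.

Lemma free_frame_e : free [seq e i | i : 'I_l].
Proof. by apply: free_fam => c e0 i; rewrite -(b_sum_ef c i) e0 b_0l. Qed.

Lemma free_frame_f : free [seq f i | i : 'I_l].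
Proof. by apply: free_fam => c e0 i; rewrite -(b_sum_fe c i) e0 b_0r. Qed.

Hypothesis dimV : \dim {:V} = (2 * l)%N.

Lemma frame_basis :
  basis_of fullv ([seq e i | i : 'I_l] ++ [seq f i | i : 'I_l]).
Proof.
rewrite basisEfree subvf size_cat !size_image card_ord addnn -mul2n -dimV.
rewrite dimvf leqnn !andbT cat_free free_frame_e free_frame_f /=.
apply/directv_addP/eqP; rewrite -subv0; apply/subvP => v.
case/memv_capP => /mem_span_famP[c ->] /mem_span_famP[d cd].
rewrite memv0; apply/eqP; rewrite big1 // => i _.
by rewrite -(b_sum_ef c i) cd b_sum_ff scale0r.
Qed.

Lemma frame_expand v : v = \sum_i (b v (f i) *: e i + b (e i) v *: f i).
Proof.
have: v \in <<[seq e i | i : 'I_l] ++ [seq f i | i : 'I_l]>>%VS.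
  by rewrite (span_basis frame_basis) memvf.
rewrite span_cat => /memv_addP[u /mem_span_famP[c ->]] [w /mem_span_famP[d ->] ->].
rewrite -[LHS]big_split; apply: eq_bigr => i _ /=.
by rewrite b_Dl b_Dr b_sum_ef b_sum_ff b_sum_ee b_sum_fe addr0 add0r.
Qed.

Lemma frame_form u v :
  b u v = \sum_i (b u (f i) * b (e i) v + b (e i) u * b (f i) v).
Proof.
rewrite {1}(frame_expand u) b_suml; apply: eq_bigr => i _.
by rewrite b_Dl !b_Zl.
Qed.

Lemma frame_eq u v : (forall i, b (e i) u = b (e i) v) ->
  (forall i, b u (f i) = b v (f i)) -> u = v.
Proof.
move=> h h'; rewrite (frame_expand u) (frame_expand v).
by apply: eq_bigr => i _; rewrite h h'.
Qed.

Lemma frame_lfun_eq (W : vectType K) (g h : 'Hom(V, W)) :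
  (forall i, g (e i) = h (e i)) -> (forall i, g (f i) = h (f i)) -> g = h.
Proof.
move=> ge gf; apply/lfunP => v; rewrite (frame_expand v) !linear_sum.
by apply: eq_bigr => i _; rewrite !linearD !linearZ /= ge gf.
Qed.

Lemma frame_isometry (g : 'End(V)) :
  frame (fun i => g (e i)) (fun i => g (f i)) -> isometry_group b g.
Proof.
move=> fg.
have fee i j : b (g (e i)) (g (e j)) = 0 := frame_ee fg i j.
have fff i j : b (g (f i)) (g (f j)) = 0 := frame_ff fg i j.
have fef i j : b (g (e i)) (g (f j)) = (i == j)%:R := frame_ef fg i j.
have gE v : g v = \sum_i (b v (f i) *: g (e i) + b (e i) v *: g (f i)).
  rewrite {1}(frame_expand v) linear_sum; apply: eq_bigr => i _.
  by rewrite linearD !linearZ.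
have ge i w : b (g (e i)) (g w) = b (e i) w.
  rewrite (gE w) b_sumr (bigD1 i) //= b_Dr !b_Zr fee fef.
  rewrite eqxx mulr0 mulr1 add0r big1 ?addr0 // => j ji.
  rewrite b_Dr !b_Zr fee fef eq_sym (negPf ji).
  by rewrite !mulr0 addr0.
have gf i w : b (g (f i)) (g w) = b (f i) w.
  rewrite (gE w) b_sumr (bigD1 i) //= b_Dr !b_Zr fff.
  rewrite (b_anti (g (f i)) (g (e i))) fef [RHS]b_anti.
  rewrite eqxx mulr0 mulrN1 addr0 big1 ?addr0 // => j ji.
  rewrite b_Dr !b_Zr fff (b_anti (g (f i)) (g (e j))) fef (negPf ji).
  by rewrite oppr0 !mulr0 addr0.
move=> u w; rewrite (gE u) b_suml [RHS]frame_form; apply: eq_bigr => i _.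
by rewrite b_Dl !b_Zl ge gf.
Qed.

Definition frame_map (E G : 'I_l -> V) : 'End(V) :=
  linfun (fun v => \sum_i (b v (f i) *: E i + b (e i) v *: G i)).

Lemma frame_mapE E G v :
  frame_map E G v = \sum_i (b v (f i) *: E i + b (e i) v *: G i).
Proof.
rewrite linfun_linearE // => a u w; rewrite scaler_sumr -big_split.
by apply: eq_bigr => i _ /=; rewrite bP bPr !scalerDl scalerDr !scalerA addrACA.
Qed.

Lemma frame_map_e E G i : frame_map E G (e i) = E i.
Proof.
rewrite frame_mapE (bigD1 i) //= (frame_ef fr) (frame_ee fr) eqxx scale1r scale0r addr0.
rewrite big1 ?addr0 // => j ji.
by rewrite (frame_ef fr) (frame_ee fr) eq_sym (negPf ji) !scale0r addr0.
Qed.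

Lemma frame_map_f E G i : frame_map E G (f i) = G i.
Proof.
rewrite frame_mapE (bigD1 i) //= (frame_ef fr) (frame_ff fr) eqxx scale1r scale0r add0r.
rewrite big1 ?addr0 // => j ji.
by rewrite (frame_ef fr) (frame_ff fr) (negPf ji) !scale0r addr0.
Qed.

Lemma frame_map_isometry E G : frame E G -> isometry_group b (frame_map E G).
Proof.
move=> [h1 h2 h3]; apply: frame_isometry.
by split=> i j; rewrite ?frame_map_e ?frame_map_f.
Qed.

Lemma isometry_lker0 g : isometry_group b g -> lker g == 0%VS.
Proof.
move=> ig; apply/lker0P => u v uv.
by apply: frame_eq => i; rewrite -ig uv ig.
Qed.

Lemma isometryK g : isometry_group b g -> cancel g (g^-1)%VF.
Proof. by move/isometry_lker0; apply: lker0_lfunK. Qed.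

Lemma isometryVK g : isometry_group b g -> cancel (g^-1)%VF g.
Proof. by move/isometry_lker0; apply: lker0_lfunVK. Qed.

Lemma isometry_inv g : isometry_group b g -> isometry_group b (g^-1)%VF.
Proof. by move=> ig u v; rewrite -ig !isometryVK. Qed.

Section Lagrangian.
Variable x : {vspace V}.
Hypothesis isox : isotropic x.
Hypothesis ex : forall i, e i \in x.

Lemma mem_lagrangian v : (forall i, b (e i) v = 0) -> v = \sum_i b v (f i) *: e i.
Proof.
move=> ev; rewrite {1}(frame_expand v).
by apply: eq_bigr => i _; rewrite ev scale0r addr0.
Qed.

(** An isotropic space containing half a frame is its own orthogonal; the dimension of [x] is
    derived from this. *)
Lemma lagrangianP v : v \in x <-> forall i, b (e i) v = 0.
Proof.
split=> [vx i|/mem_lagrangian ->]; first exact: isox.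
by apply: memv_suml => i _; apply: memvZ.
Qed.

Lemma lagrangian_expand v : v \in x -> v = \sum_i b v (f i) *: e i.
Proof. by move/lagrangianP/mem_lagrangian. Qed.

Lemma lagrangian_basis : basis_of x [seq e i | i : 'I_l].
Proof.
rewrite /basis_of free_frame_e andbT; apply/eqP/vspaceP => v.
apply/idP/idP => [/mem_span_famP[c ->]|/lagrangian_expand vE].
  by apply: memv_suml => i _; apply: memvZ.
by apply/mem_span_famP; exists (fun i => b v (f i)).
Qed.

Lemma lagrangian_dim : \dim x = l.
Proof.
rewrite -(span_basis lagrangian_basis).
by have /eqnP -> := free_frame_e; rewrite size_image card_ord.
Qed.

End Lagrangian.
End Frame.
Definition bE := (b_Dl, b_Dr, b_Nl, b_Nr, b_Zl, b_Zr).

(** Exchange step for a vector in the span of [e]: it takes the slot of [e j], and the [f i] are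
    corrected by multiples of [f j] to remain dual. *)
Lemma pivot_e e f v j : frame e f -> (forall i, b (e i) v = 0) ->
  b v (f j) != 0 ->
  frame (fun i => if i == j then v else e i)
    (fun i => if i == j then (b v (f j))^-1 *: f j
              else f i - (b v (f i) / b v (f j)) *: f j).
Proof.
move=> fr ev aj; have ve i : b v (e i) = 0 by rewrite b_anti ev oppr0.
split=> i k; case: (eqVneq i j) => [ij|ij]; case: (eqVneq k j) => [kj|kj]; rewrite ?ij ?kj;
  rewrite ?bE ?balt ?ev ?ve ?(frame_ee fr) ?(frame_ff fr) ?(frame_ef fr)
          ?eqxx ?(negPf ij) ?(negPf kj) //= ?mulr0 ?subr0 ?addr0 //; try by field.

- by rewrite mulrVK ?unitfE // subrr eq_sym (negPf kj).
Qed.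

(** Exchange step for a vector outside the span of [e]: it takes the slot of [f j]. The new [e] are
    combinations of the old ones, hence stay in the same Lagrangian. *)
Lemma pivot_f e f v j : frame e f -> b (e j) v != 0 ->
  frame (fun i => if i == j then (b (e j) v)^-1 *: e j
                  else e i - (b (e i) v / b (e j) v) *: e j)
    (fun i => if i == j then v else f i + (b v (f i) / b (e j) v) *: e j).
Proof.
move=> fr aj; have fv i : b (f i) v = - b v (f i) by rewrite b_anti.
have ve i : b v (e i) = - b (e i) v by rewrite b_anti.
split=> i k; case: (eqVneq i j) => [ij|ij]; case: (eqVneq k j) => [kj|kj]; rewrite ?ij ?kj;
  rewrite ?bE ?balt ?fv ?ve ?(frame_ee fr) ?(frame_ff fr) ?(frame_ef fr) ?(frame_fe fr)
          ?eqxx ?(negPf ij) ?(negPf kj) //= ?mulr0 ?subr0 ?addr0 //; try by field.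
- by rewrite [j == k]eq_sym (negPf kj) oppr0 !mulr0 !addr0.
- by rewrite [j == k]eq_sym (negPf kj) mulr0.
- by rewrite [j == k]eq_sym (negPf kj) mulr0 subr0.
Qed.

(** * Symplectic frames adapted to two Lagrangians *)

Section Adapted.
Hypothesis dimV : \dim {:V} = (2 * l)%N.
Variables x z : {vspace V}.
Hypothesis isox : isotropic x.
Hypothesis isoz : isotropic z.
Hypothesis dimz : \dim z = l.

(** The progress measure of the pivoting: a frame is adapted to [z] when all indices belong to this
    set. *)
Definition meets (e f : 'I_l -> V) : {set 'I_l} :=
  [set i | (e i \in z) || (f i \in z)].

(** Fewer than l vectors of the frame already lie in [z], which has dimension l, so some vector of
    [z] is outside their span. Removing its components along them makes it orthogonal to the settled
    planes, so a pivot on it does not disturb these. *)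
Lemma reduced_vector e f : frame e f -> (#|meets e f| < l)%N ->
  exists v, [/\ v \in z, v != 0 &
    forall i, i \in meets e f -> b (e i) v = 0 /\ b v (f i) = 0].
Proof.
move=> fr ltl; set Kz := meets e f.
pose s i := if e i \in z then e i else f i.
have sz i : i \in Kz -> s i \in z.
  by rewrite inE /s; case: ifP.
pose U := <<[seq s i | i in Kz]>>%VS.
have [w wz wU] : exists2 w, w \in z & w \notin U.
  apply/subvPn; apply: contraL ltl => /dimvS; rewrite dimz -leqNgt => le.
  by apply: leq_trans le (leq_trans (dim_span _) _); rewrite size_image.
(* The component along [s i] is read by pairing with the other vector of the plane; the second
   orthogonality comes for free from the isotropy of [z]. *)
pose t i := if e i \in z then b w (f i) else b (e i) w.
pose v := w - \sum_(i in Kz) t i *: s i.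
have vz : v \in z.
  by rewrite memvB // memv_suml // => i /sz siz; rewrite memvZ.
exists v; split=> // [|i iK].
  apply: contraNneq wU => v0; have -> : w = \sum_(i in Kz) t i *: s i.
    by apply/eqP; rewrite -subr_eq0 -/v v0.
  apply: memv_suml => i iK; apply/memvZ/memv_span; exact: fintype.image_f.
have := iK; rewrite inE; have [eiz _|neiz /= fiz] := boolP (e i \in z).
  split; first exact: isoz.
  rewrite b_Dl b_Nl b_suml (bigD1 i) //= {1 2}/t {1 2}/s eiz b_Zl (frame_ef fr).
  rewrite eqxx mulr1 big1 ?addr0 ?subrr // => k /andP[_ ki].
  rewrite b_Zl /s; case: ifP => _; rewrite ?(frame_ef fr) ?(frame_ff fr) ?mulr0 //.
  by rewrite (negPf ki) mulr0.
split; last exact: isoz.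
rewrite b_Dr b_Nr b_sumr (bigD1 i) //= {1 2}/t {1 2}/s (negPf neiz) b_Zr (frame_ef fr).
rewrite eqxx mulr1 big1 ?addr0 ?subrr // => k /andP[_ ki].
rewrite b_Zr /s; case: ifP => _; rewrite ?(frame_ee fr) ?(frame_ef fr) ?mulr0 //.
by rewrite eq_sym (negPf ki) mulr0.
Qed.

(* The vector [y0] only records the hyperplane of [x] orthogonal to it, which the
   pivots have to preserve. *)
Lemma adapted_frame (y0 : V) (i0 : 'I_l) e f : frame e f ->
  (forall i, e i \in x) -> (forall i, i != i0 -> b (e i) y0 = 0) ->
  exists e' f', [/\ frame e' f', forall i, e' i \in x,
    forall i, i != i0 -> b (e' i) y0 = 0 & forall i, e' i \in z \/ f' i \in z].
Proof.
have [n] := ubnP (l - #|meets e f|); elim: n e f => // n IH e f len fr ex ey.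
have [lel|ltl] := leqP l #|meets e f|.
  exists e, f; split=> // i.
  have : i \in meets e f.
    suff -> : meets e f = finset.setT by rewrite inE.
    by apply/eqP; rewrite finset.eqEcard finset.subsetT cardsT card_ord.
  by rewrite inE => /orP.
have [v [vz v0 vK]] := reduced_vector fr ltl.
have step e' f' j : frame e' f' -> (forall i, e' i \in x) ->
    (forall i, i != i0 -> b (e' i) y0 = 0) -> j \notin meets e f ->
    (e' j \in z) || (f' j \in z) ->
    (forall i, i \in meets e f -> e' i = e i /\ f' i = f i) ->
    exists e' f', [/\ frame e' f', forall i, e' i \in x,
      forall i, i != i0 -> b (e' i) y0 = 0 & forall i, e' i \in z \/ f' i \in z].
  move=> fr' ex' ey' jK jz eq'; apply: (IH e' f') => //.
  have sub : j |: meets e f \subset meets e' f'.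
    apply/fintype.subsetP => i; rewrite in_setU1 => /orP[/eqP ->|iK].
      by rewrite inE.
    by have [ei fi] := eq' i iK; move: iK; rewrite !inE ei fi.
  have := subset_leq_card sub; rewrite cardsU1 jK add1n => le.
  rewrite ltnS in len; apply: leq_trans len; apply: leq_ltn_trans (leq_sub2l l le) _.
  by rewrite subnS prednK // subn_gt0.
(* A vector orthogonal to every [e i] is in their span and is put in an [e] slot; any other one is
   put in an [f] slot. *)
have [/forallP ev|/forallPn[j1 ej1]] := boolP [forall i, b (e i) v == 0].
  have {}ev i : b (e i) v = 0 by apply/eqP.
  have vE := mem_lagrangian fr dimV ev.
  have [j vj jP] : exists2 j, b v (f j) != 0 & j = i0 \/ b v (f i0) = 0.
    have [v0i0|] := eqVneq (b v (f i0)) 0; last by exists i0 => //; left.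
    have [j vj] : exists j, b v (f j) != 0.
      apply/existsP; apply: contraNT v0; rewrite negb_exists => /forallP h.
      by rewrite vE big1 // => i _; have := h i; rewrite negbK => /eqP ->; rewrite scale0r.
    by exists j => //; right.
  have jK : j \notin meets e f.
    by apply: contra vj => /vK[_ ->].
  apply: (step _ _ j (pivot_e fr ev vj)) => //.
  - move=> i; case: ifP => // _; rewrite vE.
    by apply: memv_suml => k _; apply: memvZ.
  - move=> i ii0; case: eqP => [ij|_]; last exact: ey.
    rewrite vE b_suml big1 // => k _; rewrite b_Zl.
    have [->|ki0] := eqVneq k i0; last by rewrite ey ?mulr0.
    by case: jP => [ji0|->]; [rewrite ij ji0 eqxx in ii0 | rewrite mul0r].
  - by rewrite eqxx vz.
  - move=> i iK; have ij : i == j = false.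
      by apply: contraNF jK => /eqP <-.
    by rewrite ij; have [_ ->] := vK i iK; rewrite mul0r scale0r subr0.
(* With j different from i0, the [e i] are corrected by a multiple of [e j], which is orthogonal to
   [y0]. The slot i0 is used only when all the corrections vanish. *)
have [j vj jP] : exists2 j, b (e j) v != 0 &
    j != i0 \/ forall i, i != i0 -> b (e i) v = 0.
  have [/existsP[j /andP[ji0 ej]]|/existsPn h] :=
    boolP [exists j, (j != i0) && (b (e j) v != 0)].
    by exists j => //; left.
  have h' i : i != i0 -> b (e i) v = 0.
    by move=> ii0; have := h i; rewrite ii0 /= negbK => /eqP.
  exists j1 => //; right => //.
have jK : j \notin meets e f by apply: contra vj => /vK[->].
apply: (step _ _ j (pivot_f fr vj)) => //.
- by move=> i; case: ifP => _; rewrite ?memvB ?memvZ.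
- move=> i ii0; case: eqP => [ij|_].
    by rewrite b_Zl ey ?mulr0 // -ij.
  rewrite b_Dl b_Nl b_Zl ey // add0r.
  by case: jP => [ji0|h]; [rewrite ey ?mulr0 ?oppr0 | rewrite h // !mul0r oppr0].
- by rewrite eqxx vz orbT.
- move=> i iK; have ij : i == j = false by apply: contraNF jK => /eqP <-.
  by rewrite ij; have [-> ->] := vK i iK; rewrite !mul0r !scale0r subr0 addr0.
Qed.

Lemma adapted_frame_pair e f : frame e f -> (forall i, e i \in x) ->
  exists e' f', [/\ frame e' f', forall i, e' i \in x &
    forall i, e' i \in z \/ f' i \in z].
Proof.
(* With [y0] = 0 the hyperplane condition is empty. An index i0 exists only if l > 0; for l = 0 any
   frame will do. *)
move=> fr ex; have [i0 _|noi] := pickP 'I_l.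
  have [|e' [f' [fr' ex' _ ez']]] := adapted_frame (y0 := 0) (i0 := i0) fr ex.
    by move=> i _; rewrite b_0r.
  by exists e', f'.
by exists e, f; split=> // i; have := noi i.
Qed.

End Adapted.

(** * The stabilizer of a Lagrangian, and Bruhat cells *)

Section Parabolic.
Hypothesis dimV : \dim {:V} = (2 * l)%N.
Variables (e f : 'I_l -> V) (x : {vspace V}).
Hypothesis fr : frame e f.
Hypothesis isox : isotropic x.
Hypothesis ex : forall i, e i \in x.

Lemma isometry_comp g h : isometry_group b g -> isometry_group b h ->
  isometry_group b (g \o h)%VF.
Proof. by move=> ig ih u v; rewrite !comp_lfunE ig ih. Qed.

Lemma isometry_id : isometry_group b \1%VF.
Proof. by move=> u v; rewrite !id_lfunE. Qed.

Lemma isotropic_img g : isometry_group b g -> isotropic (g @: x)%VS.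
Proof.
by move=> ig u v /memv_imgP[u' ux ->] /memv_imgP[v' vx ->]; rewrite ig isox.
Qed.

Lemma isometry_dim g (U : {vspace V}) : isometry_group b g ->
  \dim (g @: U) = \dim U.
Proof.
move=> ig; apply: limg_dim_eq.
by have /eqP -> := isometry_lker0 fr dimV ig; rewrite capv0.
Qed.

Lemma stabilizerP p : isometry_group b p -> (forall u, u \in x -> p u \in x) ->
  stabilizer_space b x p.
Proof.
move=> ip px; split=> //; apply/eqP; rewrite eqEdim isometry_dim // leqnn andbT.
by apply/subvP => _ /memv_imgP[u ux ->]; apply: px.
Qed.

Lemma stabilizer_frame p : isometry_group b p -> (forall i, p (e i) \in x) ->
  stabilizer_space b x p.
Proof.
move=> ip px; apply: stabilizerP => // u /(lagrangian_expand fr dimV isox ex) ->.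
by rewrite linear_sum memv_suml // => i _; rewrite linearZ /= memvZ.
Qed.

Lemma stabilizer_mem p u : stabilizer_space b x p -> u \in x -> p u \in x.
Proof. by case=> _ px ux; rewrite -px memv_img. Qed.

Lemma stabilizer_inv p : stabilizer_space b x p -> stabilizer_space b x (p^-1)%VF.
Proof.
case=> ip px; apply: stabilizerP; first exact: (isometry_inv fr dimV ip).
by move=> u; rewrite -{1}px => /memv_imgP[v vx ->]; rewrite (isometryK fr dimV ip).
Qed.

Lemma stabilizer_id : stabilizer_space b x \1%VF.
Proof. by apply: stabilizerP => [|u ux]; [apply: isometry_id | rewrite id_lfunE]. Qed.

Implicit Types (I : {set 'I_l}) (i : 'I_l) (c s : K).

(** In the plane of [e i0] and [f i0], [tau], [shear] and [dilation] are the Weyl element, the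
    unipotents and the torus of SL_2. *)
Definition tau (I : {set 'I_l}) := frame_map e f
  (fun i => if i \in I then f i else e i) (fun i => if i \in I then - e i else f i).

Definition shear i0 (c : K) := frame_map e f e (fun i => f i + (c *+ (i == i0)) *: e i).

Definition dilation i0 (s : K) := frame_map e f
  (fun i => (if i == i0 then s else 1) *: e i)
  (fun i => (if i == i0 then s^-1 else 1) *: f i).

Lemma tau_e I i : tau I (e i) = if i \in I then f i else e i.
Proof. exact: frame_map_e fr _ _ _. Qed.

Lemma tau_f I i : tau I (f i) = if i \in I then - e i else f i.
Proof. exact: frame_map_f fr _ _ _. Qed.

Lemma shear_e i0 c i : shear i0 c (e i) = e i.
Proof. exact: frame_map_e fr _ _ _. Qed.

Lemma shear_f i0 c i : shear i0 c (f i) = f i + (c *+ (i == i0)) *: e i.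
Proof. exact: frame_map_f fr _ _ _. Qed.

Lemma dilation_e i0 s i : dilation i0 s (e i) = (if i == i0 then s else 1) *: e i.
Proof. exact: frame_map_e fr _ _ _. Qed.

Lemma dilation_f i0 s i : dilation i0 s (f i) = (if i == i0 then s^-1 else 1) *: f i.
Proof. exact: frame_map_f fr _ _ _. Qed.

Lemma tau_isometry I : isometry_group b (tau I).
Proof.
apply: (frame_map_isometry fr dimV); split=> i j;
  case: ifP => iI; case: ifP => jI;
  rewrite ?bE ?(frame_ee fr) ?(frame_ff fr) ?(frame_ef fr) ?(frame_fe fr) ?oppr0 ?opprK //;
  have [ij|] := eqVneq i j; rewrite ?oppr0 //; by rewrite -ij iI in jI.
Qed.

Lemma shear_isometry i0 c : isometry_group b (shear i0 c).
Proof.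
apply: (frame_map_isometry fr dimV); split=> i j;
  rewrite ?bE ?(frame_ee fr) ?(frame_ff fr) ?(frame_ef fr) ?(frame_fe fr) ?mulr0 ?addr0 //.
rewrite add0r; have [->|ij] := eqVneq i j; first by rewrite mulr1 mulrN1 addNr.
by rewrite oppr0 !mulr0 addr0.
Qed.

Lemma dilation_isometry i0 s : s != 0 -> isometry_group b (dilation i0 s).
Proof.
move=> s0; apply: (frame_map_isometry fr dimV); split=> i j;
  rewrite ?bE ?(frame_ee fr) ?(frame_ff fr) ?(frame_ef fr) ?mulr0 //.
have [->|ij] := eqVneq i j; last by rewrite !mulr0.
by case: ifP => _; rewrite mulr1 ?mulr1 // divff.
Qed.

Lemma shear_stabilizer i0 c : stabilizer_space b x (shear i0 c).
Proof.
apply: stabilizer_frame => [|i]; first exact: shear_isometry.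
by rewrite shear_e.
Qed.

Lemma dilation_stabilizer i0 s : s != 0 -> stabilizer_space b x (dilation i0 s).
Proof.
move=> s0; apply: stabilizer_frame => [|i]; first exact: dilation_isometry.
by rewrite dilation_e memvZ.
Qed.

Lemma shear0 i0 : shear i0 0 = \1%VF.
Proof.
apply: (frame_lfun_eq fr dimV) => i; rewrite id_lfunE ?shear_e // shear_f.
by rewrite mul0rn scale0r addr0.
Qed.

Lemma tau_set0 : tau finset.set0 = \1%VF.
Proof.
by apply: (frame_lfun_eq fr dimV) => i; rewrite id_lfunE ?tau_e ?tau_f inE.
Qed.

Lemma tau_setD1 I i0 : i0 \in I ->
  tau I = (tau (I :\ i0) \o tau [set i0])%VF.
Proof.
move=> iI; apply: (frame_lfun_eq fr dimV) => i; rewrite comp_lfunE ?tau_e ?tau_f inE;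
  have [->|ii0] := eqVneq i i0;
  by rewrite ?iI ?linearN /= ?tau_e ?tau_f !inE ?eqxx ?ii0 //= ?(negPf ii0).
Qed.

Lemma tau_shear_out I i0 c : i0 \notin I ->
  (tau I \o (shear i0 c \o tau [set i0]))%VF = (shear i0 c \o tau (i0 |: I))%VF.
Proof.
move=> iI; apply: (frame_lfun_eq fr dimV) => i; rewrite !comp_lfunE ?tau_e ?tau_f !inE;
  have [->|ii0] := eqVneq i i0;
  rewrite ?(linearN, linearD, linearZ, shear_e, shear_f, tau_e, tau_f) /= ?eqxx ?(negPf iI)
          ?(negPf ii0) ?mulr1n ?mulr0n ?scale0r ?addr0
          ?(linearN, linearD, linearZ, shear_e, shear_f, tau_e, tau_f) /= ?(negPf iI) //;
  by case: ifP => _; rewrite ?linearN /= ?shear_e ?shear_f ?(negPf ii0) ?mulr0n ?scale0r ?addr0.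
Qed.

Lemma tau_shear0_in I i0 : i0 \in I ->
  (tau I \o (shear i0 0 \o tau [set i0]))%VF =
  (dilation i0 (-1) \o tau (I :\ i0))%VF.
Proof.
move=> iI; rewrite shear0 comp_lfun1l.
apply: (frame_lfun_eq fr dimV) => i; rewrite !comp_lfunE ?tau_e ?tau_f !inE;
  have [->|ii0] := eqVneq i i0;
  rewrite ?(linearN, dilation_e, dilation_f, tau_e, tau_f) /= ?iI ?eqxx
          ?invrN1 ?scaleN1r ?tau_e ?iI //;
  by case: ifP => _; rewrite ?linearN /= ?dilation_e ?dilation_f ?(negPf ii0) ?scale1r.
Qed.

(** This is the big-cell factorization in SL_2 of the element w n(c) w, applied in the plane of
    index i0; the other planes only see [tau I]. *)
Lemma tau_shear_in I i0 c : i0 \in I -> c != 0 ->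
  (tau I \o (shear i0 c \o tau [set i0]))%VF =
  (shear i0 (- c^-1) \o dilation i0 c^-1 \o tau I \o shear i0 (- c^-1))%VF.
Proof.
move=> iI c0; apply: (frame_lfun_eq fr dimV) => i; rewrite !comp_lfunE ?tau_e ?tau_f !inE;
  have [->|ii0] := eqVneq i i0;
  rewrite ?(linearN, linearD, linearZ, shear_e, shear_f, tau_e, tau_f) /= ?iI ?eqxx
          ?(negPf ii0) ?mulr1n ?mulr0n ?scale0r ?addr0
          ?(linearN, linearD, linearZ, shear_e, shear_f, tau_e, tau_f, dilation_e, dilation_f)
          /= ?iI ?eqxx //.
- by rewrite invrK shear_f eqxx mulr1n scalerDr scalerA mulrN divff // scaleN1r addrC.
- by case: ifP => _; rewrite ?dilation_e ?dilation_f (negPf ii0) scale1r ?shear_e ?shear_f ?(negPf ii0)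
    ?mulr0n ?scale0r ?addr0.
- rewrite !linearN /= dilation_e dilation_f !eqxx !linearZ /= shear_e shear_f eqxx mulr1n invrK.
  by rewrite scalerA mulrN divff // scaleN1r opprD scaleNr opprK scalerN addrCA addNr addr0.
- by case: ifP => _; rewrite ?linearN /= ?dilation_e ?dilation_f (negPf ii0) scale1r ?linearN /=
    ?shear_e ?shear_f ?(negPf ii0) ?mulr0n ?scale0r ?addr0.
Qed.

(** When each plane of the frame has a basis vector in g^-1 x, that Lagrangian is the inverse image
    of [x] under a [tau I], namely for the indices whose [e i] is missing. Hence g and [tau I]
    differ by an element of the stabilizer on the left. *)
Lemma bruhat_left g (z := ((g^-1)%VF @: x)%VS) : isometry_group b g ->
  (forall i, e i \in z \/ f i \in z) ->
  exists I p, stabilizer_space b x p /\ g = (p \o tau I)%VF.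
Proof.
move=> ig ez; pose I := [set i | e i \notin z].
have iT := tau_isometry I; exists I, (g \o (tau I)^-1)%VF.
split; last by rewrite -comp_lfunA lker0_compVf ?comp_lfun1r // (isometry_lker0 fr).
apply: stabilizer_frame.
  by apply: isometry_comp => //; apply: (isometry_inv fr dimV iT).
move=> i; rewrite comp_lfunE.
have gz u : u \in z -> g u \in x.
  by case/memv_imgP => v vx ->; rewrite (isometryVK fr dimV ig).
apply: gz; have [iz|iz] := boolP (e i \in z).
  suff -> : (tau I)^-1%VF (e i) = e i by [].
  by apply: (canLR (isometryK fr dimV iT)); rewrite tau_e inE iz.
have -> : (tau I)^-1%VF (e i) = - f i.
  by apply: (canLR (isometryK fr dimV iT)); rewrite linearN /= tau_f inE iz opprK.
by rewrite memvN; case: (ez i) => // /(negP iz).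
Qed.

(** The hypothesis forces g x = h x: for u in [x], the vector g^-1 h u is orthogonal to all [e i]
    because h x is isotropic, hence belongs to [x]. *)
Lemma lagrangian_coset g h : isometry_group b g -> isometry_group b h ->
  (forall i, g (e i) \in (h @: x)%VS) -> exists2 p, stabilizer_space b x p & h = (g \o p)%VF.
Proof.
move=> ig ih gh; exists (g^-1 \o h)%VF; last first.
  by rewrite comp_lfunA lker0_compfV ?comp_lfun1l // (isometry_lker0 fr).
apply: stabilizerP => [|u ux].
  by apply: isometry_comp => //; apply: (isometry_inv fr dimV ig).
apply/(lagrangianP fr dimV isox ex) => i; rewrite -ig comp_lfunE (isometryVK fr dimV ig).
by apply: (isotropic_img ih) => //; apply: memv_img.
Qed.

Lemma bruhat_right h : isometry_group b h ->
  (forall i, e i \in (h @: x)%VS \/ f i \in (h @: x)%VS) ->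
  exists I, exists2 p, stabilizer_space b x p & h = (tau I \o p)%VF.
Proof.
move=> ih ez; pose I := [set i | e i \notin (h @: x)%VS]; exists I.
apply: lagrangian_coset => // [|i]; first exact: tau_isometry.
by rewrite tau_e inE; case: ifPn => [/negP iz|]; [case: (ez i) | rewrite negbK].
Qed.

End Parabolic.

(** * Pairs of Lagrangians meeting in a hyperplane *)

Section RankOne.
Hypothesis dimV : \dim {:V} = (2 * l)%N.
Variables (e f e' f' : 'I_l -> V) (x : {vspace V}).
Hypotheses (fr : frame e f) (fr' : frame e' f').
Hypothesis isox : isotropic x.
Hypotheses (ex : forall i, e i \in x) (ex' : forall i, e' i \in x).

(** The hypothesis says that the [e' i] with i != i0 lie in the hyperplane common to [x] and its
    image under [tau]. The image is this hyperplane plus one line, and in the new frame that line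
    has the direction f'_{i0} + c e'_{i0}, which a shear produces. *)
Lemma rank_one_coset i0 : (forall i, i != i0 -> b (e' i) (f i0) = 0) ->
  exists c, exists2 p, stabilizer_space b x p &
    tau e f [set i0] = (shear e' f' i0 c \o tau e' f' [set i0] \o p)%VF.
Proof.
move=> ey; set h := tau e f [set i0].
have ih : isometry_group b h by apply: tau_isometry.
set y := (h @: x)%VS.
have fy : f i0 \in y.
  by apply/memv_imgP; exists (e i0); rewrite ?ex // tau_e // inE eqxx.
have ey' i : i != i0 -> e' i \in y.
  move=> ii0; apply/memv_imgP; exists (e' i) => //.
  rewrite {2}(lagrangian_expand fr dimV isox ex (ex' i)).
  rewrite {1}(lagrangian_expand fr dimV isox ex (ex' i)) linear_sum.
  apply: eq_bigr => k _; rewrite linearZ /= tau_e // inE.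
  by have [->|//] := eqVneq k i0; rewrite ey // !scale0r.
set d := b (e' i0) (f i0).
(* Otherwise [f i0] would be orthogonal to all of [x], hence in [x], against its pairing with
   [e i0]. *)
have d0 : d != 0.
  apply/eqP => d0; have fx : f i0 \in x.
    apply/(lagrangianP fr' dimV isox ex') => i.
    by have [->|/ey] := eqVneq i i0.
  have := frame_ef fr i0 i0; rewrite isox // eqxx => /eqP.
  by rewrite eq_sym oner_eq0.
(* The quotient of the coordinates of [f i0] on [e' i0] and on [f' i0]. *)
exists (b (f i0) (f' i0) / d).
apply: (lagrangian_coset dimV fr' isox ex') => // [|i].
  by apply: isometry_comp; [apply: shear_isometry | apply: tau_isometry].
rewrite comp_lfunE tau_e // inE; have [->|ii0] := eqVneq i i0; last first.
  by rewrite shear_e // ey'.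
rewrite shear_f // eqxx mulr1n.
suff -> : f' i0 + (b (f i0) (f' i0) / d) *: e' i0 =
  d^-1 *: (f i0 - \sum_(i | i != i0) b (f i0) (f' i) *: e' i).
  by rewrite memvZ // memvB // memv_suml // => k /ey' ky; rewrite memvZ.
rewrite {2}(frame_expand fr' dimV (f i0)) (bigD1 i0) //=.
under [X in _ + X - _]eq_bigr => k ki do rewrite ey // scale0r addr0.
by rewrite addrK -/d scalerDr !scalerA mulVf // scale1r addrC mulrC.
Qed.

End RankOne.

(** * Common transversals of two Lagrangians *)

Section Transversal.
Hypothesis dimV : \dim {:V} = (2 * l)%N.
Variables (e f : 'I_l -> V) (x : {vspace V}).
Hypothesis fr : frame e f.
Hypothesis isox : isotropic x.
Hypothesis ex : forall i, e i \in x.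

(** A Lagrangian dual to [x] is the graph of a map from the span of [f] to [x]. [D] is its basis
    dual to [e], and isotropy amounts to the symmetry of the matrix [S]. *)
Lemma transversal_graph (e' f' d : 'I_l -> V) : frame e' f' ->
  (forall i, e' i \in x) -> (forall i k, b (d i) (d k) = 0) ->
  (forall i k, b (e' i) (d k) = (i == k)%:R) ->
  exists2 S : 'I_l -> 'I_l -> K, forall i k, S i k = S k i &
    forall i, f i + \sum_k S i k *: e k \in <<[seq d k | k : 'I_l]>>%VS.
Proof.
move=> fr' ex' dd ed; pose D i := \sum_k b (e' k) (f i) *: d k.
have eD i k : b (e i) (D k) = (i == k)%:R.
  rewrite -(frame_ef fr) b_sumr.
  rewrite [in RHS](lagrangian_expand fr' dimV isox ex' (ex i)) b_suml.
  apply: eq_bigr => s _; rewrite b_Zr b_Zl mulrC; congr (_ * _).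
  rewrite {1}(lagrangian_expand fr' dimV isox ex' (ex i)) b_suml (bigD1 s) //=.
  rewrite b_Zl ed eqxx mulr1 big1 ?addr0 // => t ts.
  by rewrite b_Zl ed (negPf ts) mulr0.
have DD i k : b (D i) (D k) = 0.
  rewrite b_suml big1 // => s _; rewrite b_Zl b_sumr big1 ?mulr0 // => t _.
  by rewrite b_Zr dd mulr0.
pose S i k := b (D i) (f k).
have DE i : D i = f i + \sum_k S i k *: e k.
  apply: (frame_eq fr dimV) => k.
    by rewrite b_Dr eD (frame_ef fr) (b_sum_ee fr) addr0.
  by rewrite b_Dl (frame_ff fr) (b_sum_ef fr) add0r.
exists S => [i k|i]; last first.
  by rewrite -DE; apply: memv_suml => k _; apply/memvZ/memv_span/codom_f.
have := DD i k; rewrite {1}DE b_Dl b_suml.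
rewrite (bigD1 k) //= b_Zl eD eqxx mulr1 big1 ?addr0; last first.
  by move=> s sk; rewrite b_Zl eD (negPf sk) mulr0.
rewrite b_anti addrC => /eqP; rewrite subr_eq0 => /eqP ->.
by rewrite /S b_anti.
Qed.

(* A common transversal of [x] and [g x] splits [g] into two elements of the big cell. *)
Lemma two_transversals g : isometry_group b g ->
  exists2 S : 'I_l -> 'I_l -> K, forall i k, S i k = S k i &
  forall w, isometry_group b w ->
    (forall i, w (e i) = - (f i + \sum_k S i k *: e k)) ->
  exists2 S' : 'I_l -> 'I_l -> K, forall i k, S' i k = S' k i &
    forall i, f i + \sum_k S' i k *: e k \in ((w^-1 \o g)%VF @: x)%VS.
Proof.
move=> ig; set z := (g @: x)%VS.
have isoz : isotropic z by apply: isotropic_img.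
have dimz : \dim z = l.
  by rewrite (isometry_dim dimV fr) // (lagrangian_dim fr dimV isox ex).
have [e' [f' [fr' ex' ez']]] := adapted_frame_pair dimV isoz dimz fr ex.
(* In the plane k, [z] has the direction [e' k] or [f' k]; [d k] is a vector of that plane with
   neither the direction of [z] nor that of [x]. *)
pose d k := if e' k \in z then f' k else f' k + e' k.
have ed i k : b (e' i) (d k) = (i == k)%:R.
  by rewrite /d; case: ifP => _; rewrite ?b_Dr (frame_ef fr') ?(frame_ee fr') ?addr0.
have df i k : b (d k) (f' i) = ((i == k) && (e' k \notin z))%:R.
  rewrite /d; case: ifP => _; rewrite ?b_Dl (frame_ff fr') ?andbF //.
  by rewrite (frame_ef fr') andbT add0r eq_sym.
have dd i k : b (d i) (d k) = 0.
  rewrite [d k]/d; case: ifP => kz; rewrite ?b_Dr df.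
    by have [<-|//] := eqVneq k i; rewrite kz.
  by rewrite [b (d i) (e' k)]b_anti ed; have [<-|_] := eqVneq k i; rewrite ?kz subrr.
have [S Ssym Sd] := transversal_graph fr' ex' dd ed.
exists S => // w iw we.
set h := (w^-1 \o g)%VF; have ih : isometry_group b h.
  by apply: isometry_comp => //; apply: (isometry_inv fr dimV iw).
have isoh : isotropic (h @: x)%VS by apply: isotropic_img.
have dimh : \dim (h @: x) = l.
  by rewrite (isometry_dim dimV fr) // (lagrangian_dim fr dimV isox ex).
have [e2 [f2 [fr2 ex2 ez2]]] := adapted_frame_pair dimV isoh dimh fr ex.
have transversal v : v \in x -> v \in (h @: x)%VS -> v = 0.
  move=> vx /memv_imgP[u ux vE].
  have wvz : w v \in z.
    by rewrite vE comp_lfunE (isometryVK fr dimV iw) memv_img.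
  have /mem_span_famP[a wvd] : w v \in <<[seq d k | k : 'I_l]>>%VS.
    rewrite (lagrangian_expand fr dimV isox ex vx) linear_sum.
    by apply: memv_suml => i _; rewrite linearZ /= we memvZ // memvN.
  suff wv0 : w v = 0 by rewrite -(isometryK fr dimV iw v) wv0 linear0.
  rewrite wvd big1 // => i _.
  suff -> : a i = 0 by rewrite scale0r.
  have [eiz|neiz] := boolP (e' i \in z).
    have := isoz _ _ eiz wvz; rewrite wvd b_sumr (bigD1 i) //= b_Zr ed eqxx mulr1.
    rewrite big1 ?addr0 // => k ki; by rewrite b_Zr ed eq_sym (negPf ki) mulr0.
  have fiz : f' i \in z by case: (ez' i) => // /(negP neiz).
  have := isoz _ _ wvz fiz; rewrite wvd b_suml (bigD1 i) //= b_Zl df eqxx neiz mulr1.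
  rewrite big1 ?addr0 // => k ki; by rewrite b_Zl df eq_sym (negPf ki) mulr0.
have fz2 i : f2 i \in (h @: x)%VS.
  case: (ez2 i) => // eiz; have := frame_ef fr2 i i.
  by rewrite (transversal _ (ex2 i) eiz) b_0l eqxx => /eqP; rewrite eq_sym oner_eq0.
have [S' S'sym S'd] :=
  transversal_graph fr2 ex2 (frame_ff fr2) (frame_ef fr2).
exists S' => // i; have /mem_span_famP[a ->] := S'd i.
by apply: memv_suml => k _; apply: memvZ.
Qed.

End Transversal.

End Symplectic.

(** * The Weil representation of the finite symplectic group *)

Section FiniteWeil.
Variables (R : realType) (F : finFieldType) (V : vectType F).
Variables (b : V -> V -> F) (l : nat).
Hypothesis two_neq0 : (2 : F) != 0.
Hypothesis bP : forall a u v w, b (a *: u + v) w = a * b u w + b v w.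
Hypothesis bPr : forall a u v w, b w (a *: u + v) = a * b w u + b w v.
Hypothesis balt : forall v, b v v = 0.
Hypothesis dimV : \dim {:V} = (2 * l)%N.
Variables (e0 f0 : 'I_l -> V) (x : {vspace V}).
Hypothesis fr0 : frame b e0 f0.
Hypothesis isox : isotropic b x.
Hypothesis ex0 : forall i, e0 i \in x.
Variable psi : F -> R[i].
Hypothesis psi0 : psi 0 = 1.
Hypothesis psiD : forall s t, psi (s + t) = psi s * psi t.
Hypothesis psi_nontriv : exists t, psi t != 1.
Variable chi : 'End(V) -> R[i].
Hypothesis chi_l : forall p g, stabilizer_space b x p -> isometry_group b g ->
  chi (p \o g)%VF = chi p * chi g.
Hypothesis chi_r : forall p g, stabilizer_space b x p -> isometry_group b g ->
  chi (g \o p)%VF = chi g * chi p.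
Hypothesis chi_det : forall p, stabilizer_space b x p ->
  chi p = legendre R (det_on x p).
Hypothesis chi_tau0 : forall I, chi (tau b e0 f0 I) = 1.

Local Notation iso := (isometry_group b).
Local Notation stab := (stabilizer_space b x).
Local Notation leg := (legendre R (F := F)).
Local Notation fV := (finvect_type V).
Local Notation bEE := (bE bP bPr).
Local Notation b_anti := (b_anti bP bPr balt).

Definition codim_index (g : 'End(V)) : nat := (l - \dim (x :&: (g @: x))%VS)%N.
Local Notation j := codim_index.
(** The contribution of each dimension by which g moves [x] off itself. *)
Definition weil_unit : R[i] := (omega psi 1)^-1 * sqrt_card R F.
(** This is m(g) q^(j/2), once omega(theta(g)) is replaced by chi(g) omega(1); only the quadratic
    symbol of theta is seen. *)
Definition weil_factor (g : 'End(V)) : R[i] := chi g * weil_unit ^+ j g.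
Local Notation al := weil_factor.

Definition xsum (G : V -> R[i]) : R[i] := \sum_(u : fV | u \in x) G u.
Definition xcard : R[i] := xsum (fun=> 1).

Lemma eq_xsum G G' : (forall u, u \in x -> G u = G' u) -> xsum G = xsum G'.
Proof. by move=> GG; apply: eq_bigr => u; apply: GG. Qed.

Lemma xsum_shift a G : a \in x -> xsum (fun u => G (u + a)) = xsum G.
Proof.
move=> ax; have inj : injective (fun u : fV => (u : V) + a : fV) by move=> u v /addIr.
rewrite /xsum [RHS](reindex_inj inj); apply: eq_bigl => u /=.
apply/idP/idP => [ux|uax]; first exact: (@memvD _ V x u a).
by have := @memvB _ V x _ _ uax ax; rewrite addrK.
Qed.

Lemma xsum_stab p G : stab p -> xsum (fun u => G (p u)) = xsum G.
Proof.
move=> sp; have ip := sp.1.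
have inj : injective (fun u : fV => p u : fV).
  by move=> u v /(can_inj (isometryK bP bPr fr0 dimV ip)).
rewrite /xsum [RHS](reindex_inj inj); apply: eq_bigl => u /=.
apply/idP/idP => [|pu]; first exact: stabilizer_mem sp.
rewrite -(isometryK bP bPr fr0 dimV ip u).
exact: (stabilizer_mem (stabilizer_inv bP bPr dimV fr0 sp)).
Qed.

Lemma xsumZ c G : xsum (fun u => c * G u) = c * xsum G.
Proof. by rewrite /xsum mulr_sumr. Qed.

Lemma xsumZr c G : xsum (fun u => G u * c) = xsum G * c.
Proof. by rewrite /xsum mulr_suml. Qed.

Lemma xsum_const c : xsum (fun=> c) = xcard * c.
Proof. by rewrite /xcard -xsumZr; apply: eq_xsum => u _; rewrite mul1r. Qed.

Lemma xsum_exchange G : xsum (fun u => xsum (G u)) = xsum (fun v => xsum (G^~ v)).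
Proof. exact: exchange_big. Qed.

Lemma xcard_neq0 : xcard != 0.
Proof.
rewrite /xcard /xsum sumr_const pnatr_eq0 -lt0n; apply/card_gt0P.
by exists (0 : V); exact: (@mem0v _ V x).
Qed.

Lemma stab_id : stab \1%VF. Proof. exact: (stabilizer_id bP bPr dimV x fr0). Qed.

Lemma chi_id : chi \1%VF = 1.
Proof.
rewrite (chi_det stab_id) (det_on_diag (c := fun=> 1)
  (lagrangian_basis bP bPr fr0 dimV isox ex0)) ?prodr_const ?expr1n ?legendre1 //.
by move=> i; rewrite id_lfunE scale1r.
Qed.

Lemma chi_stab_neq0 p : stab p -> chi p != 0.
Proof.
move=> sp; have sp' := stabilizer_inv bP bPr dimV fr0 sp.
have := chi_id; rewrite -(lker0_compfV (isometry_lker0 bP bPr fr0 dimV sp.1)).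
by rewrite chi_l // => [/eqP|]; [apply: contraTneq => ->; rewrite mul0r eq_sym oner_eq0 | case: sp'].
Qed.

Lemma codim_index_l p g : stab p -> j (p \o g)%VF = j g.
Proof.
move=> sp; rewrite /codim_index limg_comp -{1}sp.2.
rewrite -lker0_img_cap ?(isometry_lker0 bP bPr fr0 dimV sp.1) //.
by rewrite (isometry_dim bP bPr dimV fr0 _ sp.1).
Qed.

Lemma codim_index_r p g : stab p -> j (g \o p)%VF = j g.
Proof. by move=> sp; rewrite /codim_index limg_comp sp.2. Qed.

Lemma codim_index_stab p : stab p -> j p = 0%N.
Proof.
move=> sp; rewrite /codim_index sp.2 capvv.
by rewrite (lagrangian_dim bP bPr fr0 dimV isox ex0) subnn.
Qed.

Lemma weil_factor_stab p : stab p -> al p = chi p.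
Proof. by move=> sp; rewrite /weil_factor codim_index_stab // expr0 mulr1. Qed.

Lemma weil_factor_l p g : stab p -> iso g -> al (p \o g)%VF = al p * al g.
Proof.
move=> sp ig.
by rewrite [al p]weil_factor_stab // /weil_factor codim_index_l // chi_l // mulrA.
Qed.

Lemma weil_factor_r p g : stab p -> iso g -> al (g \o p)%VF = al g * al p.
Proof.
move=> sp ig.
by rewrite [al p]weil_factor_stab // /weil_factor codim_index_r // chi_r // mulrAC.
Qed.

(** Up to scalars, the composite of the operators of g and h at a fixed point: u runs over the
    average for g, v over the one for h, and [Phi] is the summand for g h. The Lagrangians x, g x
    and g h x all enter. *)
Definition triple_sum (g : 'End(V)) (Phi : V -> R[i]) : R[i] :=
  xsum (fun u => xsum (fun v => psi (2^-1 * b (g v) u) * Phi (u + g v))).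

Definition equivariant (h : 'End(V)) (Phi : V -> R[i]) :=
  forall t c, c \in x -> Phi (t + h c) = psi (2^-1 * b t (h c)) * Phi t.

Definition multiplicative (g h : 'End(V)) := forall Phi,
  equivariant (g \o h)%VF Phi ->
  al g * al h * triple_sum g Phi = xcard * al (g \o h)%VF * xsum Phi.

(** If p preserves [x], then g v lies in g p x, and the equivariance phase of [Phi] cancels the
    phase of the kernel: every term equals Phi(u). *)
Lemma multiplicative_stab g p : iso g -> stab p -> multiplicative g p.
Proof.
move=> ig sp Phi eq; rewrite weil_factor_r // [X in _ * X]
  (_ : _ = xcard * xsum Phi) ?mulrA ?(mulrC (_ * _) xcard) ?mulrA //.
rewrite /triple_sum -xsumZ; apply: eq_xsum => u ux.
rewrite -xsum_const; apply: eq_xsum => v vx.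
have := eq u ((p^-1)%VF v); rewrite comp_lfunE (isometryVK bP bPr fr0 dimV sp.1).
move=> ->; last exact: (stabilizer_mem (stabilizer_inv bP bPr dimV fr0 sp)).
by rewrite mulrA -psiD -mulrDr b_anti addNr mulr0 psi0 mul1r.
Qed.

Lemma multiplicative_l p g h : stab p -> iso g -> iso h ->
  multiplicative g h -> multiplicative (p \o g)%VF h.
Proof.
move=> sp ig ih m Phi eq; have ip := sp.1.
have igh := isometry_comp ig ih.
have eq' : equivariant (g \o h)%VF (fun t => Phi (p t)).
  move=> t c cx; have := eq (p t) c cx.
  by rewrite -comp_lfunA comp_lfunE linearD /= => ->; rewrite ip.
have -> : triple_sum (p \o g)%VF Phi = triple_sum g (fun t => Phi (p t)).
  rewrite /triple_sum -(xsum_stab _ sp); apply: eq_xsum => u ux.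
  by apply: eq_xsum => v vx; rewrite comp_lfunE ip linearD.
rewrite -comp_lfunA (weil_factor_l sp ig) (weil_factor_l sp igh) -(xsum_stab _ sp).
by rewrite -!(mulrA (al p)) (m _ eq'); ring.
Qed.

Lemma multiplicative_r p g h : stab p -> iso g -> iso h ->
  multiplicative g h -> multiplicative g (h \o p)%VF.
Proof.
move=> sp ig ih m Phi eq; have ip := sp.1.
have igh := isometry_comp ig ih.
have eq' : equivariant (g \o h)%VF Phi.
  move=> t c cx; have := eq t ((p^-1)%VF c).
  rewrite comp_lfunA comp_lfunE (isometryVK bP bPr fr0 dimV ip); apply.
  exact: (stabilizer_mem (stabilizer_inv bP bPr dimV fr0 sp)).
rewrite comp_lfunA (weil_factor_r sp ih) (weil_factor_r sp igh).
by rewrite mulrA mulrAC (m _ eq'); ring.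
Qed.

(** The finite analogue of S, on functions on [V]. It turns [multiplicative] into a composition law,
    to which associativity applies. *)
Definition weil_op (g : 'End(V)) (Psi : V -> R[i]) (w : V) : R[i] :=
  al g / xcard * xsum (fun a => psi (2^-1 * b a w) * Psi ((g^-1)%VF (a + w))).

Lemma weil_op_equivariant g Psi : iso g -> equivariant \1%VF Psi ->
  equivariant \1%VF (weil_op g Psi).
Proof.
move=> ig eq t c; rewrite id_lfunE => cx; rewrite /weil_op mulrCA; congr (_ * _).
have ncx : - c \in x by rewrite memvN.
rewrite -xsumZ -(xsum_shift _ ncx).
apply: eq_xsum => u ux; rewrite mulrA -psiD.
have -> : u - c + (t + c) = u + t by rewrite addrACA addNr addr0.
congr (psi _ * _); rewrite !bEE (isox ux cx) balt (b_anti c t); ring.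
Qed.

Lemma multiplicative_weil_op g h Psi : iso g -> iso h -> multiplicative g h ->
  equivariant \1%VF Psi -> weil_op (g \o h)%VF Psi =1 weil_op g (weil_op h Psi).
Proof.
move=> ig ih m eq w; have igh := isometry_comp ig ih.
pose Phi t := psi (2^-1 * b t w) * Psi (((g \o h)^-1)%VF (t + w)).
have ghK := isometryK bP bPr fr0 dimV igh.
have ePhi : equivariant (g \o h)%VF Phi.
  move=> t c cx; rewrite /Phi addrAC linearD /= ghK.
  have := eq (((g \o h)^-1)%VF (t + w)) c cx; rewrite id_lfunE => ->.
  rewrite !mulrA -!psiD -[b _ c]igh (isometryVK bP bPr fr0 dimV igh).
  congr (psi _ * _); rewrite !bEE (b_anti w); ring.
have -> : weil_op (g \o h)%VF Psi w = al (g \o h)%VF / xcard * xsum Phi by [].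
have cx0 := xcard_neq0.
apply: (mulfI cx0); apply: (mulfI cx0).
have -> : xcard * (xcard * (al (g \o h)%VF / xcard * xsum Phi)) =
          xcard * al (g \o h)%VF * xsum Phi by field.
rewrite -m // /weil_op.
have -> : triple_sum g Phi = xsum (fun u => psi (2^-1 * b u w) *
   xsum (fun v => psi (2^-1 * b v ((g^-1)%VF (u + w))) *
      Psi ((h^-1)%VF (v + (g^-1)%VF (u + w))))).
  apply: eq_xsum => u ux; rewrite -xsumZ; apply: eq_xsum => v vx.
  rewrite /Phi !mulrA -!psiD; congr (psi _ * Psi _).
    rewrite -[b v _]ig (isometryVK bP bPr fr0 dimV ig) !bEE; ring.
  apply: (canLR ghK); rewrite comp_lfunE (isometryVK bP bPr fr0 dimV ih).
  by rewrite linearD /= (isometryVK bP bPr fr0 dimV ig) addrCA addrA.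
under [in RHS]eq_xsum => u ux do rewrite mulrCA.
by rewrite xsumZ; field.
Qed.

(** Every [Phi] equivariant under g h x arises from a vector of the finite model, by pulling back
    along g h and evaluating at 0. *)
Lemma weil_op_multiplicative g h : iso g -> iso h ->
  (forall Psi, equivariant \1%VF Psi ->
     weil_op (g \o h)%VF Psi =1 weil_op g (weil_op h Psi)) -> multiplicative g h.
Proof.
move=> ig ih m Phi eq; have igh := isometry_comp ig ih.
pose Psi t := Phi ((g \o h)%VF t).
have ePsi : equivariant \1%VF Psi.
  by move=> t c cx; rewrite /Psi id_lfunE linearD /= eq // igh.
have := m Psi ePsi 0; rewrite /weil_op.
have cx0 := xcard_neq0.
have -> : xsum (fun a => psi (2^-1 * b a 0) * Psi (((g \o h)^-1)%VF (a + 0))) = xsum Phi.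
  apply: eq_xsum => u ux; rewrite addr0 (b_0r bPr) mulr0 psi0 mul1r /Psi.
  by rewrite (isometryVK bP bPr fr0 dimV igh).
have -> : xsum (fun a => psi (2^-1 * b a 0) * (al h / xcard * xsum (fun a0 =>
      psi (2^-1 * b a0 ((g^-1)%VF (a + 0))) * Psi ((h^-1)%VF (a0 + (g^-1)%VF (a + 0)))))) =
    al h / xcard * triple_sum g Phi.
  rewrite -xsumZ; apply: eq_xsum => u ux; rewrite addr0 (b_0r bPr) mulr0 psi0 mul1r.
  congr (_ * _); apply: eq_xsum => v vx.
  rewrite -[b v _]ig (isometryVK bP bPr fr0 dimV ig) /Psi; congr (_ * Phi _).
  rewrite comp_lfunE (isometryVK bP bPr fr0 dimV ih) linearD /=.
  by rewrite (isometryVK bP bPr fr0 dimV ig) addrC.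
move=> E; have -> : xcard * al (g \o h)%VF * xsum Phi =
  xcard * xcard * (al (g \o h)%VF / xcard * xsum Phi) by field.
by rewrite E; field.
Qed.

Definition right_multiplicative h := iso h /\ forall g, iso g -> multiplicative g h.

(** S(g h h') = S(g h) S(h') = S(g) S(h) S(h') = S(g) S(h h'); the quantification over all g is what
    allows the first step. *)
Lemma right_multiplicative_comp h h' :
  right_multiplicative h -> right_multiplicative h' -> right_multiplicative (h \o h')%VF.
Proof.
move=> [ih mh] [ih' mh']; have ihh := isometry_comp ih ih'; split=> // g ig.
apply: weil_op_multiplicative => // Psi eq w.
have igh := isometry_comp ig ih.
rewrite comp_lfunA (multiplicative_weil_op igh ih' (mh' _ igh) eq).
rewrite (multiplicative_weil_op ig ih (mh _ ig)); last exact: weil_op_equivariant.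
congr (_ * _); apply: eq_xsum => u ux; congr (_ * _).
exact/esym/(multiplicative_weil_op ih ih' (mh' _ ih) eq).
Qed.

(** * Reduction of the sums to one plane *)

Section RankOneSums.
Variables e f : 'I_l -> V.
Hypothesis fr : frame b e f.
Hypothesis ex : forall i, e i \in x.
Implicit Types (I : {set 'I_l}) (i : 'I_l).

Local Notation T := (tau b e f).
Local Notation iT := (tau_isometry bP bPr balt dimV fr).

(** [chi_tau0] normalizes chi on one frame only. A stabilizer element p carries that frame to the
    present one and conjugates the [tau], and chi(p) cancels. *)
Lemma chi_tau I : chi (T I) = 1.
Proof.
pose p := frame_map b e0 f0 e f.
have pe i : p (e0 i) = e i by apply: (frame_map_e bP bPr fr0).
have pf i : p (f0 i) = f i by apply: (frame_map_f bP bPr fr0).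
have sp : stab p.
  apply: (stabilizer_frame bP bPr dimV fr0 isox ex0) => [|i]; last by rewrite pe.
  exact: (frame_map_isometry bP bPr balt fr0 dimV fr).
have E : (T I \o p)%VF = (p \o tau b e0 f0 I)%VF.
  apply: (frame_lfun_eq bP bPr fr0 dimV) => i; rewrite !comp_lfunE ?pe ?pf.
    by rewrite !(tau_e bP bPr) //; case: ifP; rewrite ?pe ?pf.
  by rewrite !(tau_f bP bPr) //; case: ifP; rewrite ?linearN /= ?pe ?pf.
apply: (mulIf (chi_stab_neq0 sp)); rewrite -(chi_r sp (iT I)) E chi_l ?chi_tau0 ?mul1r ?mulr1 //.
exact: (tau_isometry bP bPr balt dimV fr0).
Qed.

Lemma mem_tau_cap I v : v \in (x :&: (T I @: x))%VS ->
  forall i, i \in I -> b v (f i) = 0.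
Proof.
case/memv_capP => vx /memv_imgP[u ux uv] i iI.
have -> : f i = T I (e i) by rewrite (tau_e bP bPr) // iI.
by rewrite uv (iT I) isox.
Qed.

Lemma codim_index_tau I : j (T I) = #|I|.
Proof.
rewrite /codim_index; pose ee (k : 'I_#|~: I|) := e (enum_val k).
have -> : (x :&: (T I @: x))%VS = <<[seq ee k | k : 'I_#|~: I|]>>%VS.
  apply/vspaceP => v; apply/idP/idP => [vin|].
    have vx : v \in x by case/memv_capP: vin.
    apply/mem_span_famP; exists (fun k => b v (f (enum_val k))).
    rewrite {1}(lagrangian_expand bP bPr fr dimV isox ex vx).
    rewrite (bigID (mem (~: I))) /= [X in _ + X]big1 ?addr0 => [|i]; last first.
      by rewrite inE negbK => iI; rewrite (mem_tau_cap vin) ?scale0r.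
    by rewrite big_enum_val.
  case/mem_span_famP => c ->; apply: memv_suml => k _; apply: memvZ.
  rewrite memv_cap ex; apply/memv_imgP; exists (ee k); first exact: ex.
  rewrite (tau_e bP bPr) //; have := enum_valP k.
  by rewrite inE => /negPf ->.
have fee : free [seq ee k | k : 'I_#|~: I|].
  apply: free_fam => c c0 k.
  have : b (\sum_k c k *: ee k) (f (enum_val k)) = c k.
    rewrite (b_suml bP) (bigD1 k) //= (b_Zl bP) (frame_ef fr) eqxx mulr1.
    rewrite big1 ?addr0 // => k' kk'; rewrite (b_Zl bP) (frame_ef fr).
    by rewrite (inj_eq enum_val_inj) (negPf kk') mulr0.
  by rewrite c0 (b_0l bP).
have /eqnP -> := fee; rewrite size_image card_ord.
apply: (@addIn #|~: I|); rewrite cardsC card_ord subnK //.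
by apply: (leq_trans (max_card _)); rewrite card_ord.
Qed.

Lemma weil_factor_tau I : al (T I) = weil_unit ^+ #|I|.
Proof. by rewrite /weil_factor chi_tau codim_index_tau mul1r. Qed.

Lemma weil_factor_shear i0 c : al (shear b e f i0 c) = 1.
Proof.
have ss := shear_stabilizer bP bPr balt dimV fr isox ex i0 c.
rewrite weil_factor_stab // chi_det // (det_on_diag (c := fun=> 1)
  (lagrangian_basis bP bPr fr dimV isox ex)) ?prodr_const ?expr1n ?legendre1 //.
by move=> i; rewrite (shear_e bP bPr) // scale1r.
Qed.

Lemma weil_factor_dilation i0 s : s != 0 -> al (dilation b e f i0 s) = leg s.
Proof.
move=> s0; have ss := dilation_stabilizer bP bPr balt dimV fr isox ex i0 s0.
rewrite weil_factor_stab // chi_det // (det_on_diag (c := fun i => if i == i0 then s else 1)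
  (lagrangian_basis bP bPr fr dimV isox ex)).
  by rewrite -big_mkcond big_pred1_eq.
by move=> i; rewrite (dilation_e bP bPr).
Qed.

(** Pairing with [f i] is a surjective linear form on [x], with fibers of equal size; averaging over
    shifts along [e i] shows it without dividing. *)
Lemma xsum_fiber i (G : F -> R[i]) :
  #|F|%:R * xsum (fun v => G (b v (f i))) = xcard * \sum_s G s.
Proof.
rewrite mulr_natl -sumr_const.
transitivity (\sum_(s : F) xsum (fun v => G (b v (f i) + s))).
  apply: eq_bigr => s _; have sx : s *: e i \in x by rewrite memvZ.
  rewrite -(xsum_shift _ sx); apply: eq_xsum => v _.
  by rewrite !bEE (frame_ef fr) eqxx mulr1.
rewrite /xsum exchange_big /= -[RHS]xsum_const; apply: eq_bigr => v _.
by rewrite [RHS](reindex_inj (addrI (b v (f i)))).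
Qed.

(** A vector of x + h x only contributes a phase: its part in [x] is absorbed by shifting u, its
    part in h x by equivariance. *)
Lemma inner_sum h Phi b1 c : equivariant h Phi -> b1 \in x -> c \in x ->
  xsum (fun u => psi (2^-1 * b (b1 + h c) u) * Phi (u + (b1 + h c))) =
  psi (2^-1 * b b1 (h c)) * xsum Phi.
Proof.
move=> eq b1x cx; rewrite -xsumZ -[RHS](xsum_shift _ b1x).
apply: eq_xsum => u ux; rewrite addrA eq // mulrA -psiD; congr (psi _ * _).
rewrite !bEE (isox b1x ux) (b_anti (h c)); ring.
Qed.

Section Pair.
Variables (I : {set 'I_l}) (i0 : 'I_l) (c : F).
Let h := (shear b e f i0 c \o T [set i0])%VF.

(** [va] collects the coordinates outside I, where [T I] is trivial, and [vb] those in I, where [h]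
    is trivial. The image of each under [T I] thus lies in [x] or in the image of [x] under the
    product, and only the coordinate i0 remains to be studied. *)
Lemma rank_one_split v : v \in x -> exists va vb,
  [/\ va \in x, vb \in x, v = va + vb + b v (f i0) *: e i0 &
    [/\ T I va = va, h vb = vb, b va (f i0) = 0 & b vb (f i0) = 0]].
Proof.
move=> vx; exists (\sum_(i | (i != i0) && (i \notin I)) b v (f i) *: e i).
exists (\sum_(i | (i != i0) && (i \in I)) b v (f i) *: e i).
have orth (P : pred 'I_l) : b (\sum_(i | (i != i0) && P i) b v (f i) *: e i) (f i0) = 0.
  rewrite (b_suml bP) big1 // => i /andP[ii0 _].
  by rewrite (b_Zl bP) (frame_ef fr) (negPf ii0) mulr0.
split; [by apply: memv_suml => i _; apply: memvZ|by apply: memv_suml => i _; apply: memvZ| |split=> //].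
- rewrite {1}(lagrangian_expand bP bPr fr dimV isox ex vx) (bigD1 i0) //= addrC; congr (_ + _).
  by rewrite (bigID (fun i => i \notin I)) /=; congr (_ + _); apply: eq_bigl => i; rewrite negbK.
- rewrite linear_sum; apply: eq_bigr => i /andP[_ iI].
  by rewrite linearZ /= (tau_e bP bPr) // (negPf iI).
- rewrite linear_sum; apply: eq_bigr => i /andP[ii0 _].
  by rewrite linearZ /= comp_lfunE (tau_e bP bPr) // inE (negPf ii0) (shear_e bP bPr).
Qed.

Lemma iso_rank_one : iso h.
Proof.
by apply: isometry_comp; [apply: (shear_isometry bP bPr balt dimV fr) | apply: iT].
Qed.

Lemma weil_factor_rank_one : al h = weil_unit.
Proof.
rewrite weil_factor_l; [|exact: shear_stabilizer|exact: iT].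
by rewrite weil_factor_shear weil_factor_tau cards1 expr1 mul1r.
Qed.

Lemma triple_sum_exchange g Phi : triple_sum g Phi =
  xsum (fun v => xsum (fun u => psi (2^-1 * b (g v) u) * Phi (u + g v))).
Proof. exact: xsum_exchange. Qed.

Lemma rank_one_out : i0 \notin I -> multiplicative (T I) h.
Proof.
move=> iI Phi eq.
have -> : triple_sum (T I) Phi = xcard * xsum Phi.
  rewrite triple_sum_exchange -xsum_const; apply: eq_xsum => v vx.
  have [va [vb [vax vbx vE [Ta hb _ _]]]] := rank_one_split vx.
  set s := b v (f i0) in vE.
  have b1x : va + s *: e i0 \in x by rewrite memvD ?memvZ.
  have Tb1 : T I (va + s *: e i0) = va + s *: e i0.
    by rewrite linearD linearZ /= Ta (tau_e bP bPr) // (negPf iI).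
  have -> : T I v = (va + s *: e i0) + (T I \o h)%VF vb.
    by rewrite vE addrAC linearD /= Tb1 comp_lfunE hb.
  rewrite (inner_sum eq) // comp_lfunE hb -{1}Tb1 (iT I) isox //.
  by rewrite mulr0 psi0 mul1r.
rewrite weil_factor_rank_one weil_factor_tau (tau_shear_out bP bPr) //.
rewrite weil_factor_l; [|exact: shear_stabilizer|exact: iT].
rewrite weil_factor_shear weil_factor_tau cardsU1 iI add1n exprS; ring.
Qed.

Lemma weil_unit_sqr : weil_unit ^+ 2 = leg (-1) * #|F|%:R.
Proof.
rewrite /weil_unit exprMn exprVn sqrt_card_sqr (omega1_sqr two_neq0) //.
have n1 : (-1 : F) != 0 by rewrite oppr_eq0 oner_eq0.
congr (_ * _); apply: (mulfI (legendre_neq0 R n1)).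
by rewrite divff ?legendre_neq0 // -expr2 legendre_sign.
Qed.

(** Here [e i0] lies both in [x] and in its image under the product, which forces the inner sum to
    vanish unless v has zero coordinate at i0. The missing factor q and the sign of the dilation by
    -1 are accounted for by [weil_unit_sqr]. *)
Lemma rank_one_in0 : i0 \in I -> c = 0 -> multiplicative (T I) h.
Proof.
move=> iI c0 Phi eq.
have ghE := tau_shear0_in bP bPr dimV fr iI; rewrite -{1}c0 -/h in ghE.
have q0 := card_field_neq0 R F.
have ghe : (T I \o h)%VF (- e i0) = e i0.
  rewrite ghE comp_lfunE linearN /= (tau_e bP bPr) // !inE eqxx /= linearN /=.
  by rewrite (dilation_e bP bPr) // eqxx scaleN1r opprK.
have : #|F|%:R * triple_sum (T I) Phi = xcard * xsum Phi.
  have -> : triple_sum (T I) Phi = xsum (fun v => (b v (f i0) == 0)%:R * xsum Phi).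
    rewrite triple_sum_exchange; apply: eq_xsum => v vx.
    have [va [vb [vax vbx vE [Ta hb af bf]]]] := rank_one_split vx.
    set s := b v (f i0) in vE *.
    have Tv : T I v = va + T I vb + s *: f i0.
      by rewrite vE !linearD linearZ /= Ta (tau_e bP bPr) // iI.
    have [s0|s0] := eqVneq s 0.
      rewrite Tv s0 scale0r addr0 mul1r.
      have -> : T I vb = (T I \o h)%VF vb by rewrite comp_lfunE hb.
      rewrite (inner_sum eq) // comp_lfunE hb -{1}Ta (iT I) isox //.
      by rewrite mulr0 psi0 mul1r.
    rewrite mul0r; set J := xsum _.
    have bTe : b (T I v) (e i0) = - s.
      rewrite -ghe comp_lfunE (iT I) linearN /= comp_lfunE (tau_e bP bPr) // inE eqxx.
      by rewrite (shear_f bP bPr) // eqxx c0 mul0rn scale0r addr0 (b_Nr bPr).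
    (* Shifting u by a multiple of [e i0] multiplies the sum by a character value which is not
       always 1, as s != 0; hence [J] = 0. *)
    have shiftJ t : J = psi (- s * t) * J.
      have tx : t *: e i0 \in x by rewrite memvZ.
      rewrite {1}/J -(xsum_shift _ tx) -xsumZ; apply: eq_xsum => u ux.
      rewrite addrAC -{2}ghe -linearZ /= eq ?memvZ ?memvN // linearZ /= ghe.
      rewrite !mulrA -!psiD; congr (psi _ * _).
      by rewrite !bEE bTe (isox ux (ex i0)); field.
    have [t0 t1] := psi_nontriv.
    have := shiftJ (- s^-1 * t0); rewrite mulrA mulrNN divff // mul1r => /eqP.
    rewrite -subr_eq0 -{1}[J]mul1r -mulrBl mulf_eq0 subr_eq0 eq_sym (negPf t1).
    by move/eqP.
  rewrite xsumZr mulrA (xsum_fiber i0 (fun s => (s == 0)%:R)); congr (_ * _).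
  by rewrite (bigD1 0) //= eqxx big1 ?addr0 ?mulr1 // => s /negPf ->.
move=> E; rewrite weil_factor_rank_one weil_factor_tau ghE.
have n1 : (-1 : F) != 0 by rewrite oppr_eq0 oner_eq0.
rewrite weil_factor_l; [|exact: dilation_stabilizer|exact: iT].
rewrite weil_factor_dilation // weil_factor_tau.
have := cardsD1 i0 I; rewrite iI add1n => ->; rewrite exprS.
set w := weil_unit; set n := w ^+ _; set L := leg _.
transitivity (L * n * (#|F|%:R * triple_sum (T I) Phi)); last by rewrite E; ring.
have w2 : w * w = L * #|F|%:R by rewrite -expr2 weil_unit_sqr.
have -> : w * n * w = n * (w * w) by ring.
by rewrite w2; ring.
Qed.

(** Each v contributes a phase quadratic in its coordinate at i0, and the sum over that coordinate
    is the Gauss sum for 1/c. *)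
Lemma rank_one_in : i0 \in I -> c != 0 -> multiplicative (T I) h.
Proof.
move=> iI c0 Phi eq.
have ghE := tau_shear_in bP bPr dimV fr iI c0; rewrite -/h in ghE.
have q0 := card_field_neq0 R F.
have ghe : (T I \o h)%VF (e i0) = c *: f i0 - e i0.
  rewrite !comp_lfunE (tau_e bP bPr) // inE eqxx (shear_f bP bPr) // eqxx mulr1n.
  by rewrite linearD linearZ /= (tau_f bP bPr) // (tau_e bP bPr) // iI addrC.
have : #|F|%:R * triple_sum (T I) Phi =
    xcard * (sqrt_card R F * omega psi c^-1) * xsum Phi.
  have -> : triple_sum (T I) Phi =
      xsum (fun v => psi (2^-1 * c^-1 * b v (f i0) ^+ 2) * xsum Phi).
    rewrite triple_sum_exchange; apply: eq_xsum => v vx.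
    have [va [vb [vax vbx vE [Ta hb af bf]]]] := rank_one_split vx.
    set s := b v (f i0) in vE *.
    (* The product sends (s/c) e_{i0} to s f_{i0} - (s/c) e_{i0}; adding back (s/c) e_{i0}, which is
       in [x], leaves exactly the component of T v along [f i0]. *)
    have b1x : va + (s / c) *: e i0 \in x by rewrite memvD ?memvZ.
    have b2x : vb + (s / c) *: e i0 \in x by rewrite memvD ?memvZ.
    have b2E : (T I \o h)%VF (vb + (s / c) *: e i0) =
        T I vb + s *: f i0 - (s / c) *: e i0.
      rewrite linearD linearZ /= ghe comp_lfunE hb scalerBr scalerA divfK //.
      by rewrite addrA.
    have -> : T I v = (va + (s / c) *: e i0) + (T I \o h)%VF (vb + (s / c) *: e i0).
      rewrite b2E vE !linearD linearZ /= Ta (tau_e bP bPr) // iI.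
      by rewrite -!addrA; congr (_ + _); rewrite [RHS]addrC -!addrA addNr addr0.
    rewrite (inner_sum eq) //; congr (psi _ * _); rewrite b2E.
    have aTb : b va (T I vb) = 0 by rewrite -{1}Ta (iT I) isox.
    have eTb : b (e i0) (T I vb) = 0.
      have -> : e i0 = T I (- f i0) by rewrite linearN /= (tau_f bP bPr) // iI opprK.
      by rewrite (iT I) (b_Nl bP) -b_anti.
    rewrite !bEE aTb eTb af (isox vax (ex i0)) (frame_ef fr) eqxx balt mulr1.
    by field; rewrite c0.
  rewrite xsumZr mulrA (xsum_fiber i0 (fun s => psi (2^-1 * c^-1 * s ^+ 2))).
  by rewrite /omega mulVKf // sqrt_card_neq0.
move=> E; rewrite weil_factor_rank_one weil_factor_tau ghE.
have sc : c^-1 != 0 by rewrite invr_eq0.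
rewrite weil_factor_r; [|exact: shear_stabilizer|].
  rewrite -comp_lfunA weil_factor_l; [|exact: shear_stabilizer|].
    rewrite weil_factor_l; [|exact: dilation_stabilizer|exact: iT].
    rewrite weil_factor_dilation // weil_factor_tau !weil_factor_shear.
    rewrite omegaE // in E.
    have w0 := omega1_neq0 two_neq0 psi0 psiD psi_nontriv.
    have s2 : sqrt_card R F * sqrt_card R F = #|F|%:R by rewrite -expr2 sqrt_card_sqr.
    apply: (mulfI q0).
    transitivity (weil_unit ^+ #|I| * weil_unit * (#|F|%:R * triple_sum (T I) Phi)); first by ring.
    by rewrite E {2}/weil_unit -s2; field.
  by apply: isometry_comp; [apply: dilation_isometry | apply: iT].
apply: isometry_comp; last exact: iT.
by apply: isometry_comp; [apply: shear_isometry | apply: dilation_isometry].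
Qed.

Lemma rank_one_multiplicative : multiplicative (T I) h.
Proof.
have [iI|] := boolP (i0 \in I); last exact: rank_one_out.
by have [|] := eqVneq c 0; [apply: rank_one_in0 | apply: rank_one_in].
Qed.

End Pair.
End RankOneSums.

(** Taking [y0] to be [f i0] makes the preserved hyperplane the intersection of [x] with its image
    under [tau]. In the adapted frame, g is [tau I] up to the stabilizer on the left, and h is a
    shear times a [tau] up to the stabilizer on the right. *)
Lemma multiplicative_tau1 (e f : 'I_l -> V) i0 : frame b e f -> (forall i, e i \in x) ->
  right_multiplicative (tau b e f [set i0]).
Proof.
move=> fr ex; have ih := tau_isometry bP bPr balt dimV fr [set i0].
split=> // g ig; have ig' := isometry_inv bP bPr fr0 dimV ig.
pose z := ((g^-1)%VF @: x)%VS.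
have dimz : \dim z = l.
  by rewrite (isometry_dim bP bPr dimV fr0) // (lagrangian_dim bP bPr fr0 dimV isox ex0).
have ey i : i != i0 -> b (e i) (f i0) = 0 by move=> /negPf ii0; rewrite (frame_ef fr) ii0.
have [e' [f' [fr' ex' ey' ez']]] :=
  adapted_frame bP bPr balt dimV (isotropic_img isox ig') dimz fr ex ey.
have [I [p [sp ->]]] := bruhat_left bP bPr balt dimV fr' isox ex' ig ez'.
have [c [p' sp' ->]] := rank_one_coset bP bPr balt dimV fr fr' isox ex ex' ey'.
have iI := tau_isometry bP bPr balt dimV fr' I.
have ir := iso_rank_one fr' i0 c.
apply: multiplicative_r => //; first by apply: isometry_comp => //; case: sp.
by apply: multiplicative_l => //; apply: rank_one_multiplicative.
Qed.

Lemma right_multiplicative_tau (e f : 'I_l -> V) I : frame b e f -> (forall i, e i \in x) ->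
  right_multiplicative (tau b e f I).
Proof.
move=> fr ex; have [n] := ubnP #|I|; elim: n I => // n IH I len.
have [->|/set0Pn[i iI]] := eqVneq I finset.set0.
  rewrite (tau_set0 bP bPr dimV fr).
  split=> [|g ig]; [exact: isometry_id | exact: multiplicative_stab ig stab_id].
rewrite (tau_setD1 bP bPr dimV fr iI); apply: right_multiplicative_comp.
  by apply: IH; move: len; rewrite (cardsD1 i) iI.
exact: multiplicative_tau1.
Qed.

Theorem weil_multiplicative g h : iso g -> iso h -> multiplicative g h.
Proof.
move=> ig ih.
have dimz : \dim (h @: x) = l.
  by rewrite (isometry_dim bP bPr dimV fr0) // (lagrangian_dim bP bPr fr0 dimV isox ex0).
have [e [f [fr ex ez]]] :=
  adapted_frame_pair bP bPr balt dimV (isotropic_img isox ih) dimz fr0 ex0.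
have [I [p sp ->]] := bruhat_right bP bPr balt dimV fr isox ex ih ez.
apply: multiplicative_r => //; first exact: (tau_isometry bP bPr balt dimV fr).
by have [_] := right_multiplicative_tau I fr ex; apply.
Qed.

End FiniteWeil.

Local Open Scope classical_set_scope.

(** * Square-summable families of complex numbers *)

Section SquareSummable.
Variables (R : realType) (T : choiceType) (I : set T).
Implicit Types (h : T -> R[i]).

Definition sqnorm (z : R[i]) : R := Normc.normc z ^+ 2.

Lemma sqnorm_ge0 z : 0 <= sqnorm z. Proof. exact: sqr_ge0. Qed.

Lemma sqnormM z z' : sqnorm (z * z') = sqnorm z * sqnorm z'.
Proof. by rewrite /sqnorm Normc.normcM exprMn. Qed.

Lemma sqnorm_unit z : `|z| = 1 -> sqnorm z = 1.
Proof.
move=> z1; have -> : sqnorm z = 1 ^+ 2; last by rewrite expr1n.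
by congr (_ ^+ 2); apply: complexI.
Qed.

Lemma sqnormD z z' :
  sqnorm (z + z') <= (sqnorm z + sqnorm z) + (sqnorm z' + sqnorm z').
Proof.
rewrite /sqnorm; set a := Normc.normc z; set c := Normc.normc z'.
have h : Normc.normc (z + z') <= a + c := @le_normcD R z z'.
have n0 : 0 <= Normc.normc (z + z').
  by case: (z + z') => p q; apply: sqrtr_ge0.
apply: (@le_trans _ _ ((a + c) ^+ 2)); first by rewrite lerXn2r ?nnegrE // (le_trans n0 h).
rewrite -subr_ge0 (_ : _ - _ = (a - c) ^+ 2) ?sqr_ge0 //; ring.
Qed.

Definition sq_summable h := (\esum_(c in I) (sqnorm (h c))%:E < +oo)%E.

Lemma sq_summable_le h h' : (forall c, I c -> sqnorm (h c) <= sqnorm (h' c)) ->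
  sq_summable h' -> sq_summable h.
Proof.
move=> hh; apply: le_lt_trans; apply: le_esum => c Ic.
by rewrite lee_fin hh.
Qed.

Lemma sq_summableD h h' : sq_summable h -> sq_summable h' ->
  sq_summable (fun c => h c + h' c).
Proof.
move=> sh sh'.
have n0 z : (0 <= (sqnorm z)%:E)%E by rewrite lee_fin sqnorm_ge0.
apply: (@le_lt_trans _ _ (\esum_(c in I)
  (((sqnorm (h c))%:E + (sqnorm (h c))%:E) + ((sqnorm (h' c))%:E + (sqnorm (h' c))%:E)))%E).
  by apply: le_esum => c _; rewrite -!EFinD lee_fin sqnormD.
rewrite esumD; try by move=> c _; rewrite adde_ge0.
by rewrite !esumD //; do ![apply: lte_add_pinfty].
Qed.

Lemma sq_summable0 : sq_summable (fun=> 0).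
Proof.
rewrite /sq_summable esum1 ?ltry // => c _.
by rewrite /sqnorm Normc.normc0 expr0n.
Qed.

Lemma sq_summable_sum (J : Type) (s : seq J) (P : pred J) (h : J -> T -> R[i]) :
  (forall j, P j -> sq_summable (h j)) -> sq_summable (fun c => \sum_(j <- s | P j) h j c).
Proof.
move=> sh; elim: s => [|j s IH].
  by under eq_fun do rewrite big_nil; apply: sq_summable0.
have [Pj|nPj] := boolP (P j).
  by under eq_fun do rewrite big_cons Pj; apply: sq_summableD => //; apply: sh.
by under eq_fun do rewrite big_cons (negPf nPj).
Qed.

(** The squared modulus of the scalar is bounded by a natural number, so that scaling is dominated
    by repeated addition. *)
Lemma sq_summableZ a h : sq_summable h -> sq_summable (fun c => a * h c).
Proof.
move=> sh; pose m := Num.bound (sqnorm a).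
have am : sqnorm a <= m%:R by apply/ltW/archi_boundP/sqnorm_ge0.
apply: (@le_lt_trans _ _ (\esum_(c in I) (m%:R * sqnorm (h c))%:E)).
  apply: le_esum => c _; rewrite lee_fin sqnormM.
  by rewrite ler_wpM2r // sqnorm_ge0.
elim: (m) => [|n IH].
  by rewrite esum1 ?ltry // => c _; rewrite mul0r.
have -> : \esum_(c in I) (n.+1%:R * sqnorm (h c))%:E =
  \esum_(c in I) ((n%:R * sqnorm (h c))%:E + (sqnorm (h c))%:E)%E.
  by apply: eq_esum => c _; rewrite -EFinD -natr1 mulrDl mul1r.
rewrite esumD; [exact: lte_add_pinfty| |] => c _; rewrite lee_fin ?sqnorm_ge0 //.
by rewrite mulr_ge0 ?ler0n ?sqnorm_ge0.
Qed.

End SquareSummable.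

(** * The lattice model *)

Section LocalWeil.
Variables (R : realType) (k : topFieldType) (v : k -> int) (varpi : k).
Variables (F : finFieldType) (red : k -> F) (psi : k -> R[i]) (lam : int).
Variables (W : vectType k) (beta : {biscalar W}) (r : nat).
Variables (B A : set W) (l : nat) (bs : vectType F) (pr : W -> bs).
Variables (e f : 'I_r -> W).
Hypothesis nlf : nonarchimedean_local_field v.
Hypothesis uni : uniformizer v varpi.
Hypothesis resm : residue_map v red.
Hypothesis char2 : 2%N \notin [pchar F].
Hypothesis uchar : unitary_character psi.
Hypothesis cond : conductor v psi varpi lam.
Hypothesis sform : symplectic_form beta.
Hypothesis dimW : \dim {:W} = (2 * r)%N.
Hypothesis goodB : good_lattice v varpi lam beta B.
Hypothesis selfA : selfdual_lattice v varpi lam beta A.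
Hypothesis BsubA : B `<=` A.
Hypothesis AsubBs : A `<=` dual_lattice v varpi lam beta B.
Hypothesis quot : quotient_map v varpi lam beta red B pr.
Hypothesis dimbs : \dim {:bs} = (2 * l)%N.
Hypothesis dar : darboux_basis beta (varpi ^ lam) e f.
Hypothesis BE : B = good_span v varpi l e f.
Hypothesis AE : A = good_span v varpi 0 e f.

Local Notation O := (integers v).
Local Notation Bs := (dual_lattice v varpi lam beta B).
Local Notation psib := (residue_character v psi red varpi lam).
Local Notation betabs := (beta_bs v varpi lam beta red B pr).
Local Notation lift := (pr_lift v varpi lam beta B pr).

Lemma varpi_neq0 : varpi != 0. Proof. by case: uni. Qed.

Lemma varpiX_neq0 n : varpi ^ n != 0.
Proof. by rewrite expfz_neq0 // varpi_neq0. Qed.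

Lemma varpi_lamS : varpi ^ (lam - 1) * varpi = varpi ^ lam.
Proof. by rewrite -[X in _ * X]expr1z -expfzDr ?varpi_neq0 // subrK. Qed.

Lemma varpi_lamK x : varpi ^ (1 - lam) * (varpi ^ (lam - 1) * x) = x.
Proof. by rewrite mulrA -expfzDr ?varpi_neq0 // addrA subrK subrr expr0z mul1r. Qed.

Lemma integers0 : O 0. Proof. by left. Qed.

Lemma val1 : v 1 = 0.
Proof.
have := val_mul nlf (oner_neq0 k) (oner_neq0 k); rewrite mulr1 => h.
by apply: (addrI (v 1)); rewrite -h addr0.
Qed.

Lemma integers1 : O 1. Proof. by right; rewrite val1. Qed.

Lemma valV x : x != 0 -> v x^-1 = - v x.
Proof.
move=> x0; have := val_mul nlf x0 (invr_neq0 x0); rewrite divff // val1 => h.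
by apply: (addrI (v x)); rewrite -h subrr.
Qed.

Lemma integersD x y : O x -> O y -> O (x + y).
Proof. exact: (val_add nlf). Qed.

Lemma integersM x y : O x -> O y -> O (x * y).
Proof.
have [->|x0] := eqVneq x 0; first by rewrite mul0r.
have [->|y0] := eqVneq y 0; first by rewrite mulr0.
case=> [xe|vx]; first by rewrite xe eqxx in x0.
case=> [ye|vy]; first by rewrite ye eqxx in y0.
by right; rewrite (val_mul nlf) // addr_ge0.
Qed.

Lemma integersN1 : O (-1).
Proof.
have n1 : (-1 : k) != 0 by rewrite oppr_eq0 oner_eq0.
have := val_mul nlf n1 n1; rewrite mulrNN mulr1 val1 => h; right.
have : v (-1) *+ 2 == 0 by rewrite mulr2n -h.
by rewrite mulrn_eq0 /= => /eqP ->.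
Qed.

Lemma integersN x : O x -> O (- x).
Proof. by move=> Ox; rewrite -mulN1r; apply: integersM => //; apply: integersN1. Qed.

Lemma integers_varpi : O varpi. Proof. by right; rewrite (proj2 uni). Qed.

Lemma val_ge1P x : O x -> val_ge v 1 x -> exists2 a, O a & x = varpi * a.
Proof.
move=> _ [->|vx]; first by exists 0; [apply: integers0 | rewrite mulr0].
have [->|x0] := eqVneq x 0; first by exists 0; [apply: integers0 | rewrite mulr0].
exists (varpi^-1 * x); last by rewrite mulVKf // varpi_neq0.
right; rewrite (val_mul nlf) ?invr_neq0 ?varpi_neq0 // valV ?varpi_neq0 //.
by rewrite (proj2 uni) addrC subr_ge0.
Qed.

Lemma red_0 : red 0 = 0.
Proof. by apply/(red_ker resm integers0); left. Qed.

Lemma red_N x : O x -> red (- x) = - red x.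
Proof.
move=> Ox; apply: (addIr (red x)); rewrite addNr -(red_add resm) ?addNr ?red_0 //.
exact: integersN.
Qed.

Lemma red_eqP x y : O x -> O y -> red x = red y -> exists2 a, O a & x = y + varpi * a.
Proof.
move=> Ox Oy xy; have Oxy := integersD Ox (integersN Oy).
have : red (x - y) = 0.
  by rewrite (red_add resm) ?red_N ?xy ?subrr //; apply: integersN.
move/(red_ker resm Oxy)/(val_ge1P Oxy) => [a Oa xya]; exists a => //.
by rewrite -xya addrC subrK.
Qed.

Lemma red_varpi a : O a -> red (varpi * a) = 0.
Proof.
move=> Oa; apply/(red_ker resm); first exact: integersM integers_varpi Oa.
case: Oa => [->|va]; first by left; rewrite mulr0.
have [->|a0] := eqVneq a 0; first by left; rewrite mulr0.
by right; rewrite (val_mul nlf) ?varpi_neq0 // (proj2 uni) ler_wpDr.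
Qed.

Lemma two_neq0F : (2 : F) != 0.
Proof. by move: char2; rewrite inE. Qed.

Lemma integers2 : O 2. Proof. by apply: integersD; apply: integers1. Qed.

Lemma red2 : red 2 = 2.
Proof. by rewrite (red_add resm integers1 integers1) (red_one resm). Qed.

Lemma two_neq0k : (2 : k) != 0.
Proof. by apply: contraNneq two_neq0F => k2; rewrite -red2 k2 red_0. Qed.

(** 2 is a unit: its reduction is nonzero, so its valuation is not positive. *)
Lemma integers_half : O (2^-1).
Proof.
right; rewrite valV ?two_neq0k // oppr_ge0 leNgt; apply/negP => v2.
case/eqP: two_neq0F; rewrite -red2; apply/(red_ker resm integers2); right.
by rewrite -gtz0_ge1.
Qed.

Lemma red_half : red 2^-1 = 2^-1.
Proof.
apply: (mulfI two_neq0F); rewrite divff ?two_neq0F // -[X in X * _]red2.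
rewrite -(red_mul resm) ?divff ?two_neq0k ?(red_one resm) //.
  exact: integers2.
exact: integers_half.
Qed.

Lemma psi_0 : psi 0 = 1.
Proof.
have n0 : psi 0 != 0 by rewrite -normr_eq0 (char_unit uchar) oner_eq0.
by apply: (mulfI n0); rewrite -(char_add uchar) addr0 mulr1.
Qed.

Lemma psi_D x y : psi (x + y) = psi x * psi y. Proof. exact: (char_add uchar). Qed.

Definition integral_pairing (x : k) := exists2 a, O a & x = varpi ^ lam * a.

Lemma psi_integral x : integral_pairing x -> psi (2^-1 * x) = 1.
Proof.
case=> a Oa ->; rewrite mulrCA; apply: (proj1 cond).
exact: integersM integers_half Oa.
Qed.

(** Two integral lifts differ by a multiple of varpi, and psi is trivial on varpi^lam O; the choice
    made by [xget] is therefore immaterial. *)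
Lemma psib_red x : O x -> psib (red x) = psi (varpi ^ (lam - 1) * x).
Proof.
move=> Ox; rewrite /residue_character.
case: xgetP => [y _ [Oy yx]|/(_ x)[]//].
have [a Oa ->] := red_eqP Oy Ox yx.
rewrite mulrDr psi_D mulrA varpi_lamS.
by rewrite (proj1 cond) ?mulr1.
Qed.

Lemma psib_D s t : psib (s + t) = psib s * psib t.
Proof.
have [x Ox <-] := red_surj resm s; have [y Oy <-] := red_surj resm t.
by rewrite -(red_add resm) // !psib_red ?mulrDr ?psi_D //; apply: integersD.
Qed.

Lemma psib_0 : psib 0 = 1.
Proof. by rewrite -red_0 psib_red ?mulr0 ?psi_0 //; apply: integers0. Qed.

Lemma psib_nontriv : exists t, psib t != 1.
Proof.
have [x Ox x1] := proj2 cond; exists (red x); rewrite psib_red //; exact/eqP.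
Qed.

Lemma beta_l a u w z : beta (a *: u + w) z = a * beta u z + beta w z.
Proof. by rewrite linearPl. Qed.

Lemma beta_r a u w z : beta z (a *: u + w) = a * beta z u + beta z w.
Proof. by rewrite linearPr. Qed.

Lemma beta_alt w : beta w w = 0. Proof. exact: (proj1 sform). Qed.

Local Notation bEW := (bE beta_l beta_r).
Local Notation beta_anti := (b_anti beta_l beta_r beta_alt).

(** Division by varpi^lam turns a self-dual basis into a frame, and makes membership in A and B a
    condition on integral coordinates. *)
Definition normalized_form (u w : W) := (varpi ^ lam)^-1 * beta u w.
Local Notation b' := normalized_form.

Lemma nform_l a u w z : b' (a *: u + w) z = a * b' u z + b' w z.
Proof. by rewrite /normalized_form beta_l mulrDr mulrCA. Qed.

Lemma nform_r a u w z : b' z (a *: u + w) = a * b' z u + b' z w.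
Proof. by rewrite /normalized_form beta_r mulrDr mulrCA. Qed.

Lemma nform_alt w : b' w w = 0.
Proof. by rewrite /normalized_form beta_alt mulr0. Qed.

Lemma nformK u w : varpi ^ lam * b' u w = beta u w.
Proof. by rewrite /normalized_form mulVKf // varpiX_neq0. Qed.

Lemma frameW : frame b' e f.
Proof.
case: dar => _ ee ff ef; split=> i j; rewrite /normalized_form ?ee ?ff ?mulr0 //.
by rewrite ef; case: (i == j); rewrite ?mulr0 // mulr1n mulVf // varpiX_neq0.
Qed.

Lemma isometry_nform g : isometry_group beta g <-> isometry_group b' g.
Proof.
split=> ig u w; first by rewrite /normalized_form ig.
by rewrite -!nformK ig.
Qed.

Lemma isometryWK g : isometry_group beta g -> cancel g (g^-1)%VF.
Proof. by move/isometry_nform; apply: (isometryK nform_l nform_r frameW dimW). Qed.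

Lemma isometryWVK g : isometry_group beta g -> cancel (g^-1)%VF g.
Proof. by move/isometry_nform; apply: (isometryVK nform_l nform_r frameW dimW). Qed.

Lemma isometryW_inv g : isometry_group beta g -> isometry_group beta (g^-1)%VF.
Proof. by move=> ig u w; rewrite -ig !isometryWVK. Qed.

Lemma good_spanP n w : good_span v varpi n e f w <->
  (forall i : 'I_r, if (i < n)%N then exists2 a, O a & b' w (f i) = varpi * a
     else O (b' w (f i))) /\ forall i, O (b' (e i) w).
Proof.
split=> [[x [y [xP yP ->]]]|[xP yP]]; last first.
  exists (fun i => b' w (f i)), (fun i => b' (e i) w); split=> //.
  exact: (frame_expand nform_l nform_r frameW dimW).
have cx i : b' (\sum_i (x i *: e i + y i *: f i)) (f i) = x i.
  rewrite big_split (b_Dl nform_l) (b_sum_ef nform_l frameW).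
  by rewrite (b_sum_ff nform_l frameW) addr0.
have cy i : b' (e i) (\sum_i (x i *: e i + y i *: f i)) = y i.
  rewrite big_split (b_Dr nform_r) (b_sum_fe nform_r frameW).
  by rewrite (b_sum_ee nform_r frameW) add0r.
by split=> i; [rewrite cx; exact: xP | rewrite cy; exact: yP].
Qed.

Lemma e_in_A i : A (e i).
Proof.
rewrite AE; apply/good_spanP; split=> j; rewrite ?ltn0 ?(frame_ee frameW) ?(frame_ef frameW).
  by case: (i == j); [apply: integers1 | apply: integers0].
exact: integers0.
Qed.

Lemma f_in_B i : B (f i).
Proof.
rewrite BE; apply/good_spanP; split=> j; rewrite ?(frame_ff frameW) ?(frame_ef frameW).
  by case: ifP => _; [exists 0; [apply: integers0 | rewrite mulr0] | apply: integers0].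
by case: (j == i); [apply: integers1 | apply: integers0].
Qed.

Lemma latB : lattice v B. Proof. by case: goodB. Qed.
Lemma latA : lattice v A. Proof. by case: selfA. Qed.

Lemma A_N w : A w -> A (- w).
Proof. by move=> Bw; rewrite -scaleN1r; apply: (lattice_scale latA integersN1). Qed.

Lemma A_B u w : A u -> A w -> A (u - w).
Proof. by move=> Bu /A_N; apply: (lattice_add latA). Qed.

Lemma B_in_Bs : B `<=` Bs. Proof. by case: goodB. Qed.

Lemma varpi_Bs w : Bs w -> B (varpi *: w).
Proof. by move=> Bw; case: goodB => _ h _; apply: h; exists w. Qed.

Lemma integralD x y : integral_pairing x -> integral_pairing y -> integral_pairing (x + y).
Proof.
by case=> a Oa -> [c Oc ->]; exists (a + c); [apply: integersD | rewrite mulrDr].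
Qed.

Lemma integralM a x : O a -> integral_pairing x -> integral_pairing (a * x).
Proof.
by move=> Oa [c Oc ->]; exists (a * c); [apply: integersM | rewrite mulrCA].
Qed.

Lemma Bs_pair u w : Bs u -> B w -> integral_pairing (beta u w).
Proof. by move=> Bu; apply: Bu. Qed.

Lemma Bs_D u w : Bs u -> Bs w -> Bs (u + w).
Proof.
move=> Bu Bw c Bc; rewrite (b_Dl beta_l).
by apply: integralD; apply: Bs_pair.
Qed.

Lemma Bs_Z a u : O a -> Bs u -> Bs (a *: u).
Proof. by move=> Oa Bu c Bc; rewrite (b_Zl beta_l); apply: integralM => //; apply: Bs_pair. Qed.

Lemma Bs_0 : Bs 0. Proof. by apply: B_in_Bs; apply: (lattice0 latB). Qed.

Lemma Bs_N u : Bs u -> Bs (- u).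
Proof. by move=> Bu; rewrite -scaleN1r; apply: (Bs_Z integersN1). Qed.

Lemma Bs_sum (I : finType) (h : I -> W) : (forall i, Bs (h i)) -> Bs (\sum_i h i).
Proof. by move=> Bh; apply: big_ind => //; [apply: Bs_0 | apply: Bs_D]. Qed.

Lemma A_pair u w : A u -> A w -> integral_pairing (beta u w).
Proof. by move=> Au Aw; have [_ h] := selfA; rewrite h in Au; apply: Au. Qed.

Lemma Bs_pair2 u w : Bs u -> Bs w -> exists2 a, O a & beta u w = varpi ^ (lam - 1) * a.
Proof.
move=> Bu /varpi_Bs /(Bs_pair Bu) [a Oa]; rewrite (b_Zr beta_r) => h; exists a => //.
by apply: (mulfI varpi_neq0); rewrite h mulrA [varpi * _]mulrC varpi_lamS.
Qed.

Lemma pr_D u w : Bs u -> Bs w -> pr (u + w) = pr u + pr w.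
Proof. exact: (pr_add quot). Qed.

Lemma pr_Z a u : O a -> Bs u -> pr (a *: u) = red a *: pr u.
Proof. exact: (pr_scale quot). Qed.

Lemma pr_0 : pr 0 = 0.
Proof. by apply/(pr_ker quot Bs_0); apply: (lattice0 latB). Qed.

Lemma pr_N u : Bs u -> pr (- u) = - pr u.
Proof.
move=> Bu; apply: (addIr (pr u)); rewrite addNr -pr_D ?addNr ?pr_0 //.
exact: Bs_N.
Qed.

Lemma pr_sum (I : finType) (h : I -> W) : (forall i, Bs (h i)) ->
  pr (\sum_i h i) = \sum_i pr (h i).
Proof.
move=> Bh; suff [] : Bs (\sum_i h i) /\ pr (\sum_i h i) = \sum_i pr (h i) by [].
apply: (big_ind2 (fun x y => Bs x /\ pr x = y)) => [|x y x' y' [Ox ex] [Oy ey]|i _].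
- by split; [apply: Bs_0 | apply: pr_0].
- by split; [apply: Bs_D | rewrite pr_D // ex ey].
- by [].
Qed.

Lemma pr_B w : B w -> pr w = 0.
Proof. by move=> Bw; apply/(pr_ker quot (B_in_Bs Bw)). Qed.

Lemma pr_eqP u w : Bs u -> Bs w -> (pr u = pr w <-> B (u - w)).
Proof.
move=> Bu Bw; have Bd := Bs_D Bu (Bs_N Bw).
rewrite -(pr_ker quot Bd) pr_D ?pr_N //; last exact: Bs_N.
by split=> [->|/eqP]; rewrite ?subrr // subr_eq0 => /eqP.
Qed.

Lemma lift_spec u : Bs (lift u) /\ pr (lift u) = u.
Proof.
rewrite /pr_lift; case: xgetP => [y _ []//|no].
by have [y By yu] := pr_surj quot u; case: (no y).
Qed.

Lemma lift_Bs u : Bs (lift u). Proof. by case: (lift_spec u). Qed.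
Lemma liftK u : pr (lift u) = u. Proof. by case: (lift_spec u). Qed.

(** Changing the lifts by elements of B changes the pairing by varpi^lam O, which becomes zero
    modulo varpi after multiplication by varpi^(1 - lam). *)
Lemma betabs_pr u w : Bs u -> Bs w ->
  betabs (pr u) (pr w) = red (varpi ^ (1 - lam) * beta u w).
Proof.
move=> Bu Bw; rewrite /beta_bs.
set u' := lift _; set w' := lift _.
have Bu' : Bs u' := lift_Bs _; have Bw' : Bs w' := lift_Bs _.
have du : B (u' - u) by apply/pr_eqP => //; rewrite liftK.
have dw : B (w' - w) by apply/pr_eqP => //; rewrite liftK.
have [a Oa ha] := Bs_pair Bw' du.
have [c Oc hc] := Bs_pair Bu dw.
have [d Od hd] := Bs_pair2 Bu Bw.
have hb : beta u' w' = varpi ^ (lam - 1) * (d + varpi * (c - a)).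
  have -> : beta u' w' = beta u w + beta u (w' - w) - beta w' (u' - u).
    rewrite !bEW (beta_anti w' u') (beta_anti w' u); ring.
  by rewrite ha hc hd mulrDr mulrA varpi_lamS mulrBr addrA.
rewrite hb hd !varpi_lamK (red_add resm) // ?red_varpi ?addr0 //.
- by apply: integersD => //; apply: integersN.
- by apply: integersM; [apply: integers_varpi | apply: integersD => //; apply: integersN].
Qed.

Lemma psi_pair u w : Bs u -> Bs w ->
  psi (2^-1 * beta u w) = psib (2^-1 * betabs (pr u) (pr w)).
Proof.
move=> Bu Bw; rewrite betabs_pr //; have [a Oa ->] := Bs_pair2 Bu Bw.
rewrite varpi_lamK -red_half -(red_mul resm) //; last exact: integers_half.
by rewrite psib_red 1?mulrCA //; apply: integersM => //; apply: integers_half.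
Qed.

Lemma betabs_l a u w z : betabs (a *: u + w) z = a * betabs u z + betabs w z.
Proof.
have [c Oc <-] := red_surj resm a.
rewrite -[u]liftK -[w]liftK -[z]liftK; move: (lift_Bs u) (lift_Bs w) (lift_Bs z).
move: (lift u) (lift w) (lift z) => {u w z} u w z Bu Bw Bz.
rewrite -pr_Z // -pr_D //; last exact: Bs_Z.
rewrite !betabs_pr // ?beta_l; last by apply: Bs_D => //; apply: Bs_Z.
have [d Od ->] := Bs_pair2 Bu Bz; have [d' Od' ->] := Bs_pair2 Bw Bz.
rewrite mulrDr [c * _]mulrCA !varpi_lamK (red_add resm) ?(red_mul resm) //.
exact: integersM.
Qed.

Lemma betabs_alt u : betabs u u = 0.
Proof. by rewrite -[u]liftK betabs_pr ?beta_alt ?mulr0 ?red_0 //; apply: lift_Bs. Qed.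

Lemma betabs_antisym u w : betabs u w = - betabs w u.
Proof.
rewrite -[u]liftK -[w]liftK; move: (lift_Bs u) (lift_Bs w).
move: (lift u) (lift w) => {u w} u w Bu Bw.
rewrite !betabs_pr // beta_anti mulrN red_N //.
by have [d Od ->] := Bs_pair2 Bw Bu; rewrite varpi_lamK.
Qed.

Lemma betabs_r a u w z : betabs z (a *: u + w) = a * betabs z u + betabs z w.
Proof. by rewrite betabs_antisym betabs_l (betabs_antisym u) (betabs_antisym w); ring. Qed.

Local Notation x := (lagrangian A pr).

Lemma pr_A a : A a -> pr a = \sum_i red (b' a (f i)) *: pr (e i).
Proof.
rewrite {1}AE => /good_spanP[xP yP].
have Ox i : O (b' a (f i)) by exact: (xP i).
have Bf i : Bs (b' (e i) a *: f i) by apply: Bs_Z => //; apply/B_in_Bs/f_in_B.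
have Be i : Bs (b' a (f i) *: e i) by apply: Bs_Z => //; apply/AsubBs/e_in_A.
rewrite {1}(frame_expand nform_l nform_r frameW dimW a) pr_sum => [|i]; last exact: Bs_D.
apply: eq_bigr => i _; rewrite pr_D // pr_Z //; last exact/AsubBs/e_in_A.
rewrite pr_Z //; last exact/B_in_Bs/f_in_B.
by rewrite (pr_B (f_in_B i)) scaler0 addr0.
Qed.

(** [lagrangian] is a choice, so a subspace with the right underlying set has to be exhibited: the
    span of the classes of the [e i], since the [f i] lie in B. *)
Lemma mem_lagrangianA u : u \in x <-> exists2 a, A a & pr a = u.
Proof.
pose X : {vspace bs} := <<[seq pr (e i) | i : 'I_r]>>%VS.
have BsE i : Bs (e i) by apply/AsubBs/e_in_A.
have XP : [set u | u \in X] = [set pr a | a in A].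
  apply/seteqP; split=> [u' /= /mem_span_famP[c ->]|_ /= [a Aa <-]].
    have /choice[h hP] : forall i, exists y, O y /\ red y = c i.
      move=> i; by have [y Oy yc] := red_surj resm (c i); exists y.
    exists (\sum_i h i *: e i).
      apply: big_ind => [||i _]; first exact: (lattice0 latA).
        exact: (lattice_add latA).
      by apply: (lattice_scale latA); [case: (hP i) | apply: e_in_A].
    rewrite pr_sum => [|i]; last by apply: Bs_Z => //; case: (hP i).
    by apply: eq_bigr => i _; have [Oh hc] := hP i; rewrite pr_Z // hc.
  by apply/mem_span_famP; exists (fun i => red (b' a (f i))); apply: pr_A.
rewrite /lagrangian; case: xgetP => [U _ UP|/(_ X)[]//].
rewrite /= in UP; have : [set u | u \in U] u <-> [set pr a | a in A] u by rewrite UP.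
by [].
Qed.

Lemma A_mem w : Bs w -> (pr w \in x <-> A w).
Proof.
move=> Bw; split=> [/mem_lagrangianA[a Aa aw]|Aw]; last by apply/mem_lagrangianA; exists w.
have /pr_eqP h : pr w = pr a by [].
by rewrite -(subrK a w); apply: (lattice_add latA) => //; apply/BsubA/h => //; apply: AsubBs.
Qed.

Lemma lift_A u : u \in x -> A (lift u).
Proof. by move=> ux; apply/A_mem; [apply: lift_Bs | rewrite liftK]. Qed.

(** * The reduction morphism from K_B to the finite symplectic group *)

Local Notation K := (stabilizer_lattice beta B).
Local Notation pSp := (p_Sp v varpi lam beta B pr).
Local Notation isoW := (isometry_group beta).

Lemma K_iso g : K g -> isoW g. Proof. by case. Qed.

Lemma K_img g w : K g -> B w -> B (g w).
Proof. by case=> _ gB Bw; rewrite -gB; exists w. Qed.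

Lemma K_img_inv g w : K g -> B w -> B ((g^-1)%VF w).
Proof. by case=> ig gB; rewrite -{1}gB => -[u Bu <-]; rewrite isometryWK. Qed.

Lemma stabilizer_latticeP (L : set W) g : isoW g -> (forall w, L w -> L (g w)) ->
  (forall w, L w -> L ((g^-1)%VF w)) -> stabilizer_lattice beta L g.
Proof.
move=> ig h h'; split=> //; apply/seteqP; split=> [_ [w Lw <-]|w Lw]; first exact: h.
by exists ((g^-1)%VF w); [apply: h' | rewrite isometryWVK].
Qed.

Lemma isometryW_invK g : isoW g -> ((g^-1)^-1)%VF = g.
Proof.
move=> ig; apply/lfunP => w; apply: (canLR (isometryWK (isometryW_inv ig))).
by rewrite isometryWK.
Qed.

Lemma K_inv g : K g -> K (g^-1)%VF.
Proof.
move=> Kg; have ig := K_iso Kg.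
apply: stabilizer_latticeP => [|w|w]; first exact: isometryW_inv.
  exact: K_img_inv.
by rewrite isometryW_invK //; apply: K_img.
Qed.

Lemma comp_inv_lfunE g h w : isoW g -> isoW h ->
  ((g \o h)^-1)%VF w = (h^-1)%VF ((g^-1)%VF w).
Proof.
move=> ig ih; have igh := isometry_comp ig ih.
by apply: (canLR (isometryWK igh)); rewrite comp_lfunE !isometryWVK.
Qed.

Lemma K_comp g h : K g -> K h -> K (g \o h)%VF.
Proof.
move=> Kg Kh; have ig := K_iso Kg; have ih := K_iso Kh.
apply: stabilizer_latticeP => [|w Bw|w Bw]; first exact: isometry_comp.
  by rewrite comp_lfunE; apply/K_img/K_img.
by rewrite comp_inv_lfunE //; apply/K_img_inv/K_img_inv.
Qed.

Lemma K_id : K \1%VF.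
Proof.
have ii := isometry_id beta.
apply: stabilizer_latticeP => // w Bw; first by rewrite id_lfunE.
by rewrite -{1}[w]id_lfunE isometryWK.
Qed.

Lemma K_Bs g w : K g -> Bs w -> Bs (g w).
Proof.
move=> Kg Bw c Bc; rewrite -(isometryWVK (K_iso Kg) c) (K_iso Kg).
by apply: Bw; apply: K_img_inv.
Qed.

Lemma p_SpE g w : K g -> Bs w -> pSp g (pr w) = pr (g w).
Proof.
move=> Kg Bw.
have lin u z : Bs u -> Bs z -> pr u = pr z -> pr (g u) = pr (g z).
  move=> Bu Bz /pr_eqP h; apply/pr_eqP; [exact: K_Bs|exact: K_Bs|].
  by rewrite -linearB; apply/K_img/h.
rewrite linfun_linearE; first by apply: lin => //; [apply: lift_Bs | rewrite liftK].
move=> a u z; have [c Oc <-] := red_surj resm a.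
have Bu := lift_Bs u; have Bz := lift_Bs z.
have Bcu : Bs (c *: lift u) by apply: Bs_Z.
rewrite -(pr_Z Oc) -?pr_D; try by [apply: K_Bs | apply: Bs_Z => //; apply: K_Bs].
rewrite -linearP; apply: lin; [exact: lift_Bs | exact: Bs_D |].
by rewrite liftK pr_D // pr_Z // !liftK.
Qed.

Lemma p_Sp_isometry g : K g -> isometry_group betabs (pSp g).
Proof.
move=> Kg u w; rewrite -[u]liftK -[w]liftK; move: (lift_Bs u) (lift_Bs w).
move: (lift u) (lift w) => {u w} u w Bu Bw.
rewrite !p_SpE // !betabs_pr ?(K_iso Kg) //; exact: K_Bs.
Qed.

Lemma p_Sp_comp g h : K g -> K h -> pSp (g \o h)%VF = (pSp g \o pSp h)%VF.
Proof.
move=> Kg Kh; apply/lfunP => u; rewrite -[u]liftK; have Bu := lift_Bs u.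
rewrite p_SpE //; last exact: K_comp.
by rewrite comp_lfunE comp_lfunE !p_SpE //; apply: K_Bs.
Qed.

Lemma p_Sp_id : pSp \1%VF = \1%VF.
Proof.
apply/lfunP => u; rewrite -[u]liftK p_SpE ?id_lfunE //; [exact: K_id | exact: lift_Bs].
Qed.

(** * Averages over the cosets of the intersection of A and g A, as averages over A/B *)

Section CosetSum.
Variable g : 'End(W).
Hypothesis Kg : K g.
Let C := A `&` [set g a | a in A].
Let kap (u : finvect_type bs) : set W := add_coset C (lift u).

Let B_C w : B w -> C w.
Proof.
move=> Bw; split; first exact: BsubA.
by exists ((g^-1)%VF w); [apply/BsubA/K_img_inv | rewrite (isometryWVK (K_iso Kg))].
Qed.

Let C_D u w : C u -> C w -> C (u + w).
Proof.
move=> [Au [a Aa au]] [Aw [a' Aa' aw]]; split; first exact: (lattice_add latA).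
by exists (a + a'); [apply: (lattice_add latA) | rewrite linearD /= au aw].
Qed.

Let C_N u : C u -> C (- u).
Proof.
move=> [Au [a Aa au]]; split; first exact: A_N.
by exists (- a); [apply: A_N | rewrite linearN /= au].
Qed.

Let coset_eq u w : add_coset C u = add_coset C w <-> C (w - u).
Proof.
split=> [h|Cwu].
  have : add_coset C u w by rewrite h; exists 0; [apply/B_C/(lattice0 latB) | rewrite addr0].
  by case=> c Cc <-; rewrite addrC addKr.
apply/seteqP; split=> _ [c Cc <-].
  exists (c - (w - u)); first by apply: C_D => //; apply: C_N.
  by rewrite opprB addrCA [w + _]addrC subrK addrC.
exists (w - u + c); first exact: C_D.
by rewrite addrA [u + _]addrC subrK.
Qed.

Let Q := cosets A C.

Let Q_kap u : u \in x -> Q (kap u).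
Proof. by move=> ux; exists (lift u) => //; apply: lift_A. Qed.

Let Q_img : Q = [set kap u | u in [set u : finvect_type bs | u \in x]].
Proof.
apply/seteqP; split=> [_ [a Aa <-]|_ [u ux <-]]; last exact: Q_kap.
exists (pr a); first by apply/A_mem => //; apply: AsubBs.
apply/coset_eq/B_C/pr_eqP; [exact: AsubBs | exact: lift_Bs | by rewrite liftK].
Qed.

Let Q_finite : finite_set Q.
Proof. by rewrite Q_img; apply/finite_image/finite_finset. Qed.

(** The common size of the fibers of the map [kap] from x onto the cosets. It cancels in the
    average, which is thus taken over an index set independent of g. *)
Let N : R[i] := xsum x (fun u => (`[< C (lift u) >])%:R).

Let kap_count c : Q c -> xsum x (fun u => (c == kap u)%:R) = N.
Proof.
rewrite Q_img => -[u0 u0x <-]; rewrite -(xsum_shift _ u0x); apply: eq_xsum => u ux.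
congr (_ %:R); congr nat_of_bool; apply/eqP/asboolP => [/coset_eq h|h].
  have : C (lift (u + u0) - lift u0 - (lift (u + u0) - lift u0 - lift u)).
    apply: C_D => //; apply/C_N/B_C.
    rewrite -addrA -opprD; apply/pr_eqP; [exact: lift_Bs|by apply: Bs_D; apply: lift_Bs|].
    by rewrite pr_D ?liftK 1?addrC //; apply: lift_Bs.
  by rewrite opprB addrC subrK.
apply/coset_eq; rewrite -[X in C X](subrK (lift u)) addrC; apply: C_D => //; apply: B_C.
rewrite -addrA -opprD; apply/pr_eqP; [exact: lift_Bs|by apply: Bs_D; apply: lift_Bs|].
by rewrite pr_D ?liftK 1?addrC //; apply: lift_Bs.
Qed.

Lemma coset_sum (G : W -> R[i]) : (forall a c, A a -> C c -> G (a + c) = G a) ->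
  xsum x (fun u => G (lift u)) = N * \sum_(c \in Q) G (xget 0 c).
Proof.
move=> GC; rewrite fsbig_finite // mulr_sumr.
transitivity (\sum_(c <- fset_set Q) xsum x (fun u => (c == kap u)%:R * G (lift u))).
  rewrite /xsum exchange_big; apply: eq_bigr => u ux.
  have uQ : kap u \in fset_set Q by rewrite in_fset_set // inE; apply: Q_kap.
  rewrite (bigD1_seq (kap u)) ?fset_uniq // eqxx mul1r big1 /= ?addr0 // => c.
  by move/negPf => ->; rewrite mul0r.
rewrite big_seq [RHS]big_seq; apply: eq_bigr => c.
rewrite in_fset_set // inE => Qc; rewrite -(kap_count Qc) -xsumZr.
apply: eq_xsum => u ux; case: eqP => [cu|_]; last by rewrite !mul0r.
rewrite !mul1r; have : c (xget 0 c).
  by apply: (@xgetPex _ 0 c); rewrite cu; exists (lift u), 0; [apply/B_C/(lattice0 latB)|rewrite addr0].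
rewrite {1}cu => -[c' Cc' <-]; rewrite GC //; exact: lift_A.
Qed.

Lemma coset_average (G : W -> R[i]) : (forall a c, A a -> C c -> G (a + c) = G a) ->
  (#|` fset_set Q|%:R)^-1 * \sum_(c \in Q) G (xget 0 c) =
  (xcard R x)^-1 * xsum x (fun u => G (lift u)).
Proof.
move=> GC; have cE : xcard R x = N * #|` fset_set Q|%:R.
  rewrite {1}/xcard (@coset_sum (fun=> 1)) // fsbig_finite //.
  by rewrite big_const_seq count_predT iter_addr_0.
have := xcard_neq0 R x; rewrite cE mulf_eq0 negb_or => /andP[N0 c0].
by rewrite coset_sum // invfM mulrACA mulVf // mul1r.
Qed.

End CosetSum.

Definition equivariantA (ph : W -> R[i]) :=
  forall a w, A a -> ph (a + w) = psi (2^-1 * beta w a) * ph w.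

Definition translate_term (g : 'End(W)) (ph : W -> R[i]) (w y : W) :=
  psi (2^-1 * beta y w) * ph ((g^-1)%VF (y + w)).

Lemma translate_termD g ph w y c : isoW g -> equivariantA ph -> A ((g^-1)%VF c) ->
  translate_term g ph w (y + c) = psi (2^-1 * beta y c) * translate_term g ph w y.
Proof.
move=> ig eq Ac; rewrite /translate_term.
have -> : y + c + w = c + (y + w) by rewrite addrAC addrC.
rewrite linearD /= eq //.
rewrite -[beta _ ((g^-1)%VF c)]ig !isometryWVK // !mulrA -!psi_D.
congr (psi _ * _); rewrite !bEW (beta_anti w c); ring.
Qed.

Lemma translate_term_inv g ph w y c : isoW g -> equivariantA ph ->
  A ((g^-1)%VF c) -> integral_pairing (beta y c) ->
  translate_term g ph w (y + c) = translate_term g ph w y.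
Proof.
by move=> ig eq Ac yc; rewrite translate_termD // psi_integral // mul1r.
Qed.

Lemma M_opE g ph w : K g -> equivariantA ph ->
  M_op beta psi A g ph w =
  (xcard R x)^-1 * xsum x (fun u => translate_term g ph w (lift u)).
Proof.
move=> Kg eq; rewrite -(coset_average Kg) // => a c Aa [Ac [d Ad dc]].
apply: translate_term_inv => //; first exact: K_iso.
  by rewrite -dc isometryWK //; apply: K_iso.
exact: A_pair.
Qed.

(** B lies in A, in g A and in the dual of [Bs], so the term descends to a function on the finite
    quotient. *)
Lemma translate_term_pr g ph w y y' : K g -> equivariantA ph -> Bs y -> Bs y' ->
  pr y = pr y' -> translate_term g ph w y = translate_term g ph w y'.
Proof.
move=> Kg eq By By' /pr_eqP h; have Byy := h By By'.
rewrite -(subrK y' y) addrC; apply: translate_term_inv => //; first exact: K_iso.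
  exact/BsubA/K_img_inv.
exact: Bs_pair.
Qed.

Lemma M_op_equivariant g ph : K g -> equivariantA ph -> equivariantA (M_op beta psi A g ph).
Proof.
move=> Kg eq a w Aa; rewrite !M_opE // [RHS]mulrCA; congr (_ * _).
rewrite -xsumZ.
have Ba := AsubBs Aa.
have nax : - pr a \in x by rewrite memvN; apply/A_mem.
rewrite -(xsum_shift _ nax); apply: eq_xsum => u ux.
rewrite (@translate_term_pr _ _ _ _ (lift u - a)) //; last first.
- by rewrite pr_D ?pr_N ?liftK //; [apply: lift_Bs | apply: Bs_N].
- by apply: Bs_D; [apply: lift_Bs | apply: Bs_N].
- exact: lift_Bs.
rewrite /translate_term addrA subrK mulrA -psi_D; congr (_ * _).
have -> : 2^-1 * beta (lift u - a) (a + w) =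
  2^-1 * beta (lift u) a + (2^-1 * beta w a + 2^-1 * beta (lift u) w).
  rewrite !bEW beta_alt (beta_anti w a); ring.
by rewrite [LHS]psi_D (psi_integral (A_pair (lift_A ux) Aa)) mul1r.
Qed.

(** * Square integrability of the image functions *)

Local Notation H := (hilbert_space beta psi A).
Local Notation QA := (cosets [set: W] A).

Lemma cosetA_eq u w : add_coset A u = add_coset A w <-> A (w - u).
Proof.
split=> [h|Awu].
  have : add_coset A u w by rewrite h; exists 0; [apply: (lattice0 latA) | rewrite addr0].
  by case=> c Ac <-; rewrite addrC addKr.
apply/seteqP; split=> _ [c Ac <-].
  exists (c - (w - u)); first exact: A_B.
  by rewrite opprB addrCA [w + _]addrC subrK addrC.
exists (w - u + c); first exact: (lattice_add latA).
by rewrite addrA [u + _]addrC subrK.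
Qed.

Lemma xget_coset c : QA c -> c = add_coset A (xget 0 c).
Proof.
case=> w _ <-; set c' := add_coset A w.
have : c' (xget 0 c').
  by apply: (@xgetPex _ 0 c'); exists w, 0; [apply: (lattice0 latA) | rewrite addr0].
by case=> a Aa wE; apply/cosetA_eq; rewrite -wE addrC addKr.
Qed.

Lemma sqnorm_psi t : sqnorm (psi t) = 1.
Proof. by apply: sqnorm_unit; apply: (char_unit uchar). Qed.

Lemma sqnorm_equivariant ph u w : equivariantA ph -> A (u - w) ->
  sqnorm (ph u) = sqnorm (ph w).
Proof. by move=> eq Auw; rewrite -(subrK w u) eq // sqnormM sqnorm_psi mul1r. Qed.

(* The coset of [g^-1 (y + w)] together with the class in [B^*/B] of its
   representative determines [w] modulo [A]: the fibers are finite. *)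
Lemma translated_summable g ph y : K g -> H ph ->
  sq_summable QA (fun c => ph ((g^-1)%VF (y + xget 0 c))).
Proof.
move=> Kg [eq sq]; pose z c := (g^-1)%VF (y + xget 0 c).
pose c1 c := add_coset A (z c); pose t c := pr (z c - xget 0 (c1 c)).
have Qc1 c : QA (c1 c) by exists (z c).
have Ad c : A (z c - xget 0 (c1 c)) by apply/cosetA_eq/esym/(xget_coset (Qc1 c)).
(* The sum is cut according to the class [t c], which takes finitely many values; each piece is
   bounded separately. *)
apply: (@sq_summable_le _ _ _ _ (fun c => \sum_(s : finvect_type bs)
    (if t c == s then ph (z c) else 0))) => [c _|].
  by rewrite -big_mkcond (big_pred1 (t c : finvect_type bs)) // => s; rewrite eq_sym.
apply: sq_summable_sum => s _.
pose Ds := [set c | t c == s].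
apply: (@le_lt_trans _ _ (\esum_(c in QA `&` Ds) (sqnorm (ph (xget 0 (c1 c))))%:E)).
  rewrite esum_mkcondr; apply: le_esum => c _.
  case: ifP => tc; last first.
    by rewrite /sqnorm Normc.normc0 expr0n /=; case: ifP => _; rewrite lee_fin ?sqr_ge0.
  by rewrite mem_set // lee_fin (sqnorm_equivariant eq (Ad c)).
(* On [Ds] the map [c1] is injective: equal targets and equal classes put the difference of the two
   arguments in B, and g maps it back into B, inside A. The piece is thus dominated by the norm of
   [ph]. *)
rewrite -(@esum_image _ _ _ (QA `&` Ds) c1 (fun c => (sqnorm (ph (xget 0 c)))%:E)); last first.
  move=> a c; rewrite !inE => -[Qa /eqP ta] [Qc /eqP tc] e1.
  rewrite (xget_coset Qa) (xget_coset Qc); apply/cosetA_eq.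
  have : B (z c - xget 0 (c1 c) - (z a - xget 0 (c1 a))).
    by apply/pr_eqP; [exact: AsubBs | exact: AsubBs | rewrite -/(t c) -/(t a) ta tc].
  rewrite e1 opprB addrA subrK -linearB /= => /(K_img Kg).
  by rewrite (isometryWVK (K_iso Kg)) opprD addrACA subrr add0r => /BsubA.
rewrite [X in \esum_(_ in X) _](_ : _ = QA `&` [set c1 c | c in QA `&` Ds]); last first.
  by apply/seteqP; split=> [c cc|c []//]; split=> //; case: cc => a _ <-.
rewrite esum_mkcondr; apply: le_lt_trans sq; apply: le_esum => c _.
by case: ifP => _; rewrite lee_fin ?sqnorm_ge0 //; apply: lexx.
Qed.

Lemma M_op_stable g ph a : K g -> H ph -> H (fun w => a * M_op beta psi A g ph w).
Proof.
move=> Kg Hph; have eq : equivariantA ph by case: Hph.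
split=> [c w Ac|].
  by rewrite (M_op_equivariant Kg eq) // mulrCA.
apply: (@sq_summableZ _ _ _ a).
under eq_fun => c do rewrite M_opE //.
apply: sq_summableZ; apply: sq_summable_sum => u _.
apply: sq_summable_le (translated_summable (lift u) Kg Hph) => c _.
by rewrite /translate_term sqnormM sqnorm_psi mul1r.
Qed.

(** * The operators S and their multiplicativity *)

Variables (varsigma : 'End(W)) (eps phi : 'I_l -> bs) (theta : 'End(bs) -> F).
Hypothesis vsig : is_varsigma varpi l e f varsigma.
Hypothesis dareps : darboux_basis betabs 1 eps phi.
Hypothesis spaneps : <<[seq eps i | i : 'I_l]>>%VS = x.
Hypothesis thf : theta_function betabs x eps phi theta.

Local Notation stab := (stabilizer_space betabs x).
Local Notation isob := (isometry_group betabs).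

Lemma frame_eps : frame betabs eps phi.
Proof. by case: dareps => _ ee ff ef; split. Qed.

Lemma isotropic_x : isotropic betabs x.
Proof.
move=> _ _ /mem_lagrangianA[a Aa <-] /mem_lagrangianA[c Ac <-].
rewrite betabs_pr; try exact: AsubBs.
have [d Od ->] := A_pair Aa Ac.
by rewrite -varpi_lamS -mulrA varpi_lamK red_varpi.
Qed.

Lemma eps_x i : eps i \in x.
Proof. by rewrite -spaneps memv_span // codom_f. Qed.

Definition theta_sign (g : 'End(bs)) : R[i] := legendre R (theta g).
Local Notation chi := theta_sign.
Local Notation al := (weil_factor l x psib chi).

Lemma theta_sign_det p : stab p -> chi p = legendre R (det_on x p).
Proof. by move=> sp; apply/eq_mod_squares_legendre/(theta_stab thf). Qed.

Lemma stab1 : stab \1%VF.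
Proof. exact: (stabilizer_id betabs_l betabs_r dimbs _ frame_eps). Qed.

Lemma theta_sign_id : chi \1%VF = 1.
Proof.
rewrite (theta_sign_det stab1) (det_on_diag (c := fun=> 1)
  (lagrangian_basis betabs_l betabs_r frame_eps dimbs isotropic_x eps_x)).
  by rewrite prodr_const expr1n legendre1.
by move=> i; rewrite id_lfunE scale1r.
Qed.

Lemma theta_sign_l p g : stab p -> isob g -> chi (p \o g)%VF = chi p * chi g.
Proof.
move=> sp ig; have := eq_mod_squares_legendre R (theta_mul thf sp ig stab1).
by rewrite comp_lfun1r !legendreM /chi => ->; rewrite [X in _ * X]theta_sign_id mulr1.
Qed.

Lemma theta_sign_r p g : stab p -> isob g -> chi (g \o p)%VF = chi g * chi p.
Proof.
move=> sp ig; have := eq_mod_squares_legendre R (theta_mul thf stab1 ig sp).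
by rewrite comp_lfun1l !legendreM /chi => ->; rewrite [X in X * _ * _]theta_sign_id mul1r.
Qed.

Lemma theta_sign_tau I : chi (tau betabs eps phi I) = 1.
Proof.
rewrite -(legendre1 R F); apply/eq_mod_squares_legendre.
apply: (theta_tau thf (I := I)) => i.
rewrite (tau_e betabs_l betabs_r frame_eps) (tau_f betabs_l betabs_r frame_eps).
by case: (i \in I); split.
Qed.

Local Notation S := (S_op v varpi lam beta psi red B A pr l theta).

Lemma omega_psib_neq0 : omega psib 1 != 0.
Proof. exact: (omega1_neq0 two_neq0F psib_0 psib_D psib_nontriv). Qed.

Lemma S_opE g ph w : K g -> S g ph w = al (pSp g) * M_op beta psi A g ph w.
Proof.
move=> Kg; rewrite /S_op /m_factor /weil_factor /weil_unit; congr (_ * _).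
have t0 : theta (pSp g) != 0 by apply: (theta_neq0 thf); apply: p_Sp_isometry.
have w0 := omega_psib_neq0.
rewrite (omegaE two_neq0F psib_D psib_nontriv t0) -/(chi _).
have c2 : chi (pSp g) ^+ 2 = 1 by apply: legendre_sign.
have c0 : chi (pSp g) != 0 by apply: legendre_neq0.
rewrite expfzDr // expr1z exprMn -exprnN exprVn.
rewrite -[codim_index l x (pSp g)]/(j_index A pr l (pSp g)).
have cV : (chi (pSp g))^-1 = chi (pSp g).
  by apply: (mulfI c0); rewrite divff // -expr2 c2.
rewrite invfM cV; set X := (_ ^+ _)^-1; set Y := sqrt_card _ _ ^+ _.
by field.
Qed.

Lemma S_stable g ph : K g -> H ph -> H (S g ph).
Proof.
move=> Kg Hph; have -> : S g ph = (fun w => al (pSp g) * M_op beta psi A g ph w).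
  by apply: funext => w; rewrite S_opE.
exact: M_op_stable.
Qed.

Lemma S_linear g a ph ph' : K g -> H ph -> H ph' ->
  S g (fun w => a * ph w + ph' w) = (fun w => a * S g ph w + S g ph' w).
Proof.
move=> Kg [eq _] [eq' _]; apply: funext => w.
have eq2 : equivariantA (fun w => a * ph w + ph' w).
  by move=> c u Ac; rewrite eq // eq' // mulrDr mulrCA.
rewrite !S_opE // !M_opE //.
have -> : xsum x (fun u => translate_term g (fun w0 => a * ph w0 + ph' w0) w (lift u)) =
  a * xsum x (fun u => translate_term g ph w (lift u)) +
  xsum x (fun u => translate_term g ph' w (lift u)).
  rewrite -xsumZ /xsum -big_split; apply: eq_bigr => u _ /=.
  by rewrite /translate_term mulrDr; congr (_ + _); rewrite mulrCA.
ring.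
Qed.

Lemma S_one ph : H ph -> S \1%VF ph = ph.
Proof.
move=> [eq _]; apply: funext => w; have K1 := K_id.
rewrite S_opE // M_opE // p_Sp_id.
rewrite (weil_factor_stab betabs_l betabs_r dimbs frame_eps isotropic_x eps_x _ _ stab1).
rewrite theta_sign_id mul1r.
have -> : xsum x (fun u => translate_term \1%VF ph w (lift u)) = xcard R x * ph w.
  rewrite -xsum_const; apply: eq_xsum => u ux; rewrite /translate_term.
  have -> : (\1^-1)%VF (lift u + w) = lift u + w.
    by apply: (canLR (isometryWK (K_iso K1))); rewrite id_lfunE.
  rewrite eq; last exact: lift_A.
  by rewrite mulrA -psi_D -mulrDr (beta_anti w) subrr mulr0 psi_0 mul1r.
by rewrite mulKf ?xcard_neq0.
Qed.

(** At a fixed w, the summand of M(g h) descends to B^*/B, where it is equivariant under the image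
    of x; the identity is then the finite multiplicativity applied to it. *)
Lemma S_mul g h ph : K g -> K h -> H ph -> S (g \o h)%VF ph = S g (S h ph).
Proof.
move=> Kg Kh Hph; apply: funext => w; have Kgh := K_comp Kg Kh.
have eq : equivariantA ph by case: Hph.
have eqS : equivariantA (S h ph) by case: (S_stable Kh Hph).
have ig := K_iso Kg; have ih := K_iso Kh; have igh := K_iso Kgh.
pose Phi t := translate_term (g \o h)%VF ph w (lift t).
have ePhi : equivariant betabs x psib (pSp g \o pSp h)%VF Phi.
  move=> t c cx; rewrite -p_Sp_comp //.
  have Bgc : Bs ((g \o h)%VF (lift c)) by apply/K_Bs/lift_Bs.
  have pgc : pSp (g \o h)%VF c = pr ((g \o h)%VF (lift c)).
    by rewrite -p_SpE ?liftK //; apply: lift_Bs.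
  rewrite /Phi (@translate_term_pr _ _ _ _ (lift t + (g \o h)%VF (lift c))) //.
  - rewrite translate_termD //; last by rewrite isometryWK //; apply: lift_A.
    by rewrite psi_pair ?liftK -?pgc //; apply: lift_Bs.
  - exact: lift_Bs.
  - by apply: Bs_D => //; apply: lift_Bs.
  - by rewrite pr_D ?liftK -?pgc //; apply: lift_Bs.
have m := weil_multiplicative two_neq0F betabs_l betabs_r betabs_alt dimbs frame_eps
  isotropic_x eps_x psib_0 psib_D psib_nontriv theta_sign_l theta_sign_r theta_sign_det
  theta_sign_tau (p_Sp_isometry Kg) (p_Sp_isometry Kh) ePhi.
rewrite !S_opE // !M_opE // p_Sp_comp //.
have cx0 := xcard_neq0 R x.
have -> : xsum x (fun u => translate_term (g \o h)%VF ph w (lift u)) = xsum x Phi by [].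
have -> : xsum x (fun u => translate_term g (S h ph) w (lift u)) =
  al (pSp h) / xcard R x * triple_sum betabs x psib (pSp g) Phi.
  rewrite -xsumZ; apply: eq_xsum => u ux; rewrite /translate_term S_opE // M_opE //.
  rewrite mulrCA -mulrA; congr (_ * _); rewrite mulrCA; congr (_ * _).
  rewrite -xsumZ; apply: eq_xsum => t tx.
  have Bgt : Bs (g (lift t)) by apply/K_Bs/lift_Bs.
  have pgt : pSp g t = pr (g (lift t)) by rewrite -p_SpE ?liftK //; apply: lift_Bs.
  have Bu := lift_Bs u.
  rewrite /Phi (@translate_term_pr (g \o h)%VF ph w (lift (u + pSp g t)) (lift u + g (lift t))) //;
    last first.
  - by rewrite pr_D // !liftK pgt.
  - exact: Bs_D.
  - exact: lift_Bs.
  have -> : psib (2^-1 * betabs (pSp g t) u) = psi (2^-1 * beta (g (lift t)) (lift u)).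
    by rewrite psi_pair // liftK pgt.
  rewrite /translate_term comp_inv_lfunE // !mulrA -!psi_D.
  rewrite -[beta (lift t) _]ig isometryWVK //.
  rewrite !linearD /= isometryWK //; congr (psi _ * ph _).
    rewrite !bEW; ring.
  by rewrite addrCA addrA.
apply: (mulfI cx0); apply: (mulfI cx0).
transitivity (xcard R x * al (pSp g \o pSp h)%VF * xsum x Phi); first by field.
by rewrite -m; field.
Qed.

Lemma P_stab p : P_group beta B A p -> K p /\ stab (pSp p).
Proof.
case=> [[ip pA]] Kp; split=> //.
apply: (stabilizerP betabs_l betabs_r dimbs frame_eps); first exact: p_Sp_isometry.
move=> _ /mem_lagrangianA[a Aa <-]; apply/mem_lagrangianA; exists (p a).
  by rewrite -pA; exists a.
by rewrite p_SpE //; apply: AsubBs.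
Qed.

Lemma p_Sp_inv g : K g -> pSp (g^-1)%VF = ((pSp g)^-1)%VF.
Proof.
move=> Kg; apply/lfunP => u.
apply: (canRL (isometryK betabs_l betabs_r frame_eps dimbs (p_Sp_isometry Kg))).
have Kg' := K_inv Kg; rewrite -[u in LHS]liftK p_SpE //; last exact: lift_Bs.
rewrite p_SpE //; last exact/K_Bs/lift_Bs.
by rewrite (isometryWVK (K_iso Kg)) liftK.
Qed.

(** A is the full preimage of x in [Bs], so an element of K_B whose reduction preserves x preserves
    A. *)
Lemma stab_P p : K p -> stab (pSp p) -> P_group beta B A p.
Proof.
move=> Kp sp; split=> //.
have half q w : K q -> stab (pSp q) -> A w -> A (q w).
  move=> Kq sq Aw; have Bw := AsubBs Aw; apply/A_mem; first exact: K_Bs.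
  by rewrite -p_SpE //; apply: stabilizer_mem sq _; apply/A_mem.
apply: stabilizer_latticeP => [|w|w]; first exact: K_iso.
  exact: half.
apply: half; first exact: K_inv.
rewrite p_Sp_inv //; exact: (stabilizer_inv betabs_l betabs_r dimbs frame_eps).
Qed.

Lemma S_parabolic p ph : P_group beta B A p -> H ph ->
  S p ph = (fun w => zeta v varpi lam beta R B A pr p * M_op beta psi A p ph w).
Proof.
move=> /P_stab[Kp sp] Hph; apply: funext => w; rewrite S_opE //.
by rewrite (weil_factor_stab betabs_l betabs_r dimbs frame_eps isotropic_x eps_x _ _ sp)
  theta_sign_det.
Qed.

Lemma l_le_r : (l <= r)%N.
Proof.
rewrite -{1}(lagrangian_dim betabs_l betabs_r frame_eps dimbs isotropic_x eps_x).
have sub : (x <= <<[seq pr (e i) | i : 'I_r]>>)%VS.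
  apply/subvP => _ /mem_lagrangianA[a Aa <-]; apply/mem_span_famP.
  by exists (fun i => red (b' a (f i))); apply: pr_A.
by apply: leq_trans (dimvS sub) (leq_trans (dim_span _) _); rewrite size_image card_ord.
Qed.

Definition widen_index (i : 'I_l) : 'I_r := widen_ord l_le_r i.
Local Notation wd := widen_index.

Lemma widen_index_lt i : (wd i < l)%N. Proof. exact: (ltn_ord i). Qed.

Lemma widen_index_eq i j : (wd i == wd j) = (i == j).
Proof. by []. Qed.

Definition e_bar i := pr (e (wd i)).
(** For i < l, elements of B pair with [f i] into varpi^(lam + 1) O, so varpi^-1 f_i is in the dual
    lattice. With [e_bar] it forms a second frame of the quotient, on which varsigma acts simply;
    theta is normalized on the frame [eps], [phi]. *)
Definition f_bar i := pr (varpi^-1 *: f (wd i)).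

Lemma Bs_e i : Bs (e i). Proof. exact/AsubBs/e_in_A. Qed.

Lemma Bs_f i : Bs (varpi^-1 *: f (wd i)).
Proof.
move=> c; rewrite {1}BE => /good_spanP[cP _].
have := cP (wd i); rewrite widen_index_lt => -[a Oa ca].
exists (- a); first exact: integersN.
rewrite (b_Zl beta_l) beta_anti -nformK ca.
by rewrite -mulrN mulrCA -mulrN mulKf // varpi_neq0.
Qed.

Lemma frame_bar : frame betabs e_bar f_bar.
Proof.
have V0 := varpi_neq0.
split=> i j; rewrite betabs_pr; try by [apply: Bs_e | apply: Bs_f].
- by rewrite -nformK (frame_ee frameW) !mulr0 red_0.
- by rewrite (b_Zl beta_l) (b_Zr beta_r) -nformK (frame_ff frameW) !mulr0 red_0.
rewrite (b_Zr beta_r) -nformK (frame_ef frameW) widen_index_eq -varpi_lamS.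
have -> : varpi^-1 * (varpi ^ (lam - 1) * varpi * (i == j)%:R) =
  varpi ^ (lam - 1) * (i == j)%:R by rewrite -mulrA mulrCA mulKf.
by rewrite varpi_lamK; case: (i == j); rewrite ?(red_one resm) ?red_0.
Qed.

Lemma e_bar_x i : e_bar i \in x.
Proof. by apply/A_mem; [apply: Bs_e | apply: e_in_A]. Qed.

Lemma vsig_lt (i : 'I_r) : (i < l)%N ->
  varsigma (e i) = - (varpi^-1 *: f i) /\ varsigma (f i) = varpi *: e i.
Proof. by move=> il; have := vsig i; rewrite il. Qed.

Lemma vsig_ge (i : 'I_r) : (i < l)%N = false ->
  varsigma (e i) = e i /\ varsigma (f i) = f i.
Proof. by move=> il; have := vsig i; rewrite il. Qed.

Lemma vsig_isometry : isoW varsigma.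
Proof.
apply/isometry_nform; apply: (frame_isometry nform_l nform_r nform_alt frameW dimW).
have bE' := (bE nform_l nform_r, frame_ee frameW, frame_ff frameW, frame_ef frameW,
  frame_fe nform_l nform_r nform_alt frameW).
have V0 := varpi_neq0.
split=> i j; case il: (i < l)%N; case jl: (j < l)%N;
  rewrite ?(proj1 (vsig_lt il)) ?(proj2 (vsig_lt il)) ?(proj1 (vsig_ge il)) ?(proj2 (vsig_ge il))
    ?(proj1 (vsig_lt jl)) ?(proj2 (vsig_lt jl)) ?(proj1 (vsig_ge jl)) ?(proj2 (vsig_ge jl))
    !bE' ?mulr0 ?oppr0 //.
all: have [ij|_] := eqVneq i j; rewrite ?mulr0 ?oppr0 ?mulr0 //; try by rewrite ij jl in il.
all: rewrite ?mulrN ?mulKf // ?opprK ?oppr0 //.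
Qed.

Lemma vsig_nform u w : b' (varsigma u) (varsigma w) = b' u w.
Proof. exact: (proj1 (isometry_nform _) vsig_isometry). Qed.

Lemma vsigV_nform u w : b' ((varsigma^-1)%VF u) w = b' u (varsigma w).
Proof. by rewrite -vsig_nform (isometryWVK vsig_isometry). Qed.

Lemma vsigV_nform_r u w : b' u ((varsigma^-1)%VF w) = b' (varsigma u) w.
Proof. by rewrite -vsig_nform (isometryWVK vsig_isometry). Qed.

Lemma vsig_K : K varsigma.
Proof.
have V0 := varpi_neq0.
have nE := (bE nform_l nform_r); have nN := b_anti nform_l nform_r nform_alt.
apply: stabilizer_latticeP; first exact: vsig_isometry.
  move=> w; rewrite {1}BE => /good_spanP[xP yP]; rewrite BE; apply/good_spanP.
  split=> i; have := xP i; have Oy := yP i; case il: (i < l)%N.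
  - move=> _; exists (b' (e i) w) => //.
    have -> : f i = varsigma (- (varpi *: e i)).
      by rewrite linearN linearZ /= (proj1 (vsig_lt il)) scalerN opprK scalerA divff // scale1r.
    by rewrite vsig_nform !nE (nN w) mulrN opprK.
  - by rewrite -{2}(proj2 (vsig_ge il)) vsig_nform.
  - case=> a Oa wf; have -> : e i = varsigma (varpi^-1 *: f i).
      by rewrite linearZ /= (proj2 (vsig_lt il)) scalerA mulVf // scale1r.
    by rewrite vsig_nform !nE (nN (f i)) wf mulrN mulKf //; apply: integersN.
  - by rewrite -{1}(proj1 (vsig_ge il)) vsig_nform.
move=> w; rewrite {1}BE => /good_spanP[xP yP]; rewrite BE; apply/good_spanP.
split=> i; have := xP i; have Oy := yP i; rewrite ?vsigV_nform ?vsigV_nform_r;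
  case il: (i < l)%N.
- move=> _; exists (- b' (e i) w); first exact: integersN.
  by rewrite (proj2 (vsig_lt il)) !nE (nN w).
- by rewrite (proj2 (vsig_ge il)).
- by case=> a Oa wf; rewrite (proj1 (vsig_lt il)) !nE (nN (f i)) wf mulrN opprK mulKf.
- by rewrite (proj1 (vsig_ge il)).
Qed.

Lemma vsig_bar_e i : pSp varsigma (e_bar i) = - f_bar i.
Proof.
rewrite p_SpE; [|exact: vsig_K|exact: Bs_e].
by rewrite (proj1 (vsig_lt (widen_index_lt i))) pr_N //; apply: Bs_f.
Qed.

Lemma vsig_bar_f i : pSp varsigma (f_bar i) = e_bar i.
Proof.
rewrite p_SpE; [|exact: vsig_K|exact: Bs_f].
rewrite linearZ /= (proj2 (vsig_lt (widen_index_lt i))) scalerA mulVf ?varpi_neq0 //.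
by rewrite scale1r.
Qed.

(** Because of the sign in varsigma(e_i) = - varpi^-1 f_i, the reduction is minus the full [tau].
    The scalar -1 stabilizes x with determinant (-1)^l, whence the Legendre factor; the full [tau]
    gives the l-th power of [weil_unit]. *)
Lemma S_varsigma ph : H ph -> S varsigma ph = (fun w =>
  legendre R (-1 : F) ^+ l * omega psib 1 ^- l * sqrt_card R F ^+ l *
  M_op beta psi A varsigma ph w).
Proof.
move=> Hph; apply: funext => w; rewrite S_opE; last exact: vsig_K.
congr (_ * _).
have sm : stab (- \1)%VF.
  apply: (stabilizerP betabs_l betabs_r dimbs frame_eps) => [u u'|u ux].
    rewrite !opp_lfunE !id_lfunE (b_Nl betabs_l) (b_Nr betabs_r) opprK //.
  by rewrite opp_lfunE id_lfunE memvN.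
have -> : pSp varsigma = (- \1 \o tau betabs e_bar f_bar [set: 'I_l]%SET)%VF.
  apply: (frame_lfun_eq betabs_l betabs_r frame_bar dimbs) => i;
    rewrite comp_lfunE opp_lfunE id_lfunE.
    by rewrite vsig_bar_e (tau_e betabs_l betabs_r frame_bar) inE.
  by rewrite vsig_bar_f (tau_f betabs_l betabs_r frame_bar) inE opprK.
rewrite (weil_factor_l betabs_l betabs_r dimbs frame_eps isotropic_x eps_x _ theta_sign_l) //;
  last exact: (tau_isometry betabs_l betabs_r betabs_alt dimbs frame_bar).
rewrite (weil_factor_stab betabs_l betabs_r dimbs frame_eps isotropic_x eps_x _ _ sm).
rewrite (weil_factor_tau betabs_l betabs_r betabs_alt dimbs frame_eps isotropic_x eps_x _
  theta_sign_l theta_sign_r theta_sign_det theta_sign_tau frame_bar e_bar_x).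
rewrite theta_sign_det // (det_on_diag (c := fun=> -1)
  (lagrangian_basis betabs_l betabs_r frame_eps dimbs isotropic_x eps_x)).
  rewrite prodr_const cardsT card_ord legendreX /weil_unit exprMn exprVn.
  by rewrite mulrA.
by move=> i; rewrite opp_lfunE id_lfunE scaleN1r.
Qed.

Lemma B_sum (I : finType) (h : I -> W) : (forall i, B (h i)) -> B (\sum_i h i).
Proof.
by move=> Bh; apply: big_ind => //; [apply: (lattice0 latB) | apply: (lattice_add latB)].
Qed.

(** * Lifting unipotent elements, and generation of K_B *)

Section LatticeShear.
Variable s : 'I_l -> 'I_l -> k.

(** The factor varpi offsets the varpi^-1 in [f_bar], so that the reduction adds exactly the reduced
    matrix [s]. *)
Definition lattice_shear : 'End(W) := linfun (fun w =>
  w + \sum_i \sum_j (varpi * s i j * b' (e (wd i)) w) *: e (wd j)).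

Lemma lattice_shearE w : lattice_shear w =
  w + \sum_i \sum_j (varpi * s i j * b' (e (wd i)) w) *: e (wd j).
Proof.
rewrite linfun_linearE // => a u u'; rewrite scalerDr addrACA; congr (_ + _).
rewrite scaler_sumr -big_split; apply: eq_bigr => i _ /=.
rewrite scaler_sumr -big_split; apply: eq_bigr => j _ /=.
by rewrite nform_r scalerA -scalerDl; congr (_ *: _); ring.
Qed.

Lemma lattice_shear_e i w : b' (e i) (lattice_shear w) = b' (e i) w.
Proof.
rewrite lattice_shearE (b_Dr nform_r) (b_sumr nform_r) big1 ?addr0 // => t _.
by rewrite (b_sumr nform_r) big1 // => j _; rewrite (b_Zr nform_r) (frame_ee frameW) mulr0.
Qed.

Hypothesis sym : forall i j, s i j = s j i.

(** The added term is in the span of the [e i], whose pairings are left unchanged by the shear; the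
    cross terms cancel by symmetry of [s]. *)
Lemma lattice_shear_isometry : isoW lattice_shear.
Proof.
apply/isometry_nform => u w.
have nN := b_anti nform_l nform_r nform_alt.
rewrite {1}lattice_shearE (b_Dl nform_l) [X in X + _]nN lattice_shearE.
rewrite (b_Dl nform_l) opprD -nN -addrA.
rewrite [X in _ + X](_ : _ = 0) ?addr0 //.
rewrite (b_suml nform_l) (b_suml nform_l) addrC; apply/eqP; rewrite subr_eq0; apply/eqP.
under eq_bigr => i _ do rewrite (b_suml nform_l).
under [RHS]eq_bigr => i _ do rewrite (b_suml nform_l).
rewrite exchange_big; apply: eq_bigr => i _; apply: eq_bigr => j _.
rewrite !(b_Zl nform_l) -lattice_shearE lattice_shear_e (sym j i); ring.
Qed.

End LatticeShear.

Lemma lattice_shearN s w : lattice_shear (fun i j => - s i j) (lattice_shear s w) = w.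
Proof.
rewrite lattice_shearE; under eq_bigr => i _.
  under eq_bigr => j _ do rewrite lattice_shear_e mulrN mulNr scaleNr.
  rewrite sumrN; over.
by rewrite sumrN lattice_shearE addrK.
Qed.

(** On A the added term has integral coefficients on the vectors varpi e_j, which are in B; so A and
    B are both preserved, also by the inverse. *)
Lemma lattice_shear_P s : (forall i j, s i j = s j i) -> (forall i j, O (s i j)) ->
  P_group beta B A (lattice_shear s).
Proof.
move=> sym Os; have is_ := lattice_shear_isometry sym.
have inv w : ((lattice_shear s)^-1)%VF w = lattice_shear (fun i j => - s i j) w.
  apply: (canLR (isometryWK is_)).
  rewrite -{1}(lattice_shearN (fun i j => - s i j) w).
  by congr (_ _); congr lattice_shear; apply/funext => i; apply/funext => j; rewrite opprK.
have ON i j : O (- s i j) by apply: integersN.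
have add t w : (forall i j, O (t i j)) -> A w ->
    B (\sum_i \sum_j (varpi * t i j * b' (e (wd i)) w) *: e (wd j)).
  move=> Ot; rewrite {1}AE => /good_spanP[_ yP].
  apply: B_sum => i; apply: B_sum => j; rewrite -mulrA mulrC -scalerA.
  apply: (lattice_scale latB); first exact: integersM.
  exact/varpi_Bs/Bs_e.
split; apply: stabilizer_latticeP => // w Lw; rewrite ?inv lattice_shearE.
- by apply: (lattice_add latA) => //; apply/BsubA/add.
- by apply: (lattice_add latA) => //; apply/BsubA/add.
- by apply: (lattice_add latB) => //; apply/add => //; apply: BsubA.
- by apply: (lattice_add latB) => //; apply/add => //; apply: BsubA.
Qed.

Lemma lattice_shear_bar s i : (forall i j, s i j = s j i) -> (forall i j, O (s i j)) ->
  pSp (lattice_shear s) (f_bar i) = f_bar i + \sum_j red (s i j) *: e_bar j.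
Proof.
move=> sym Os; have [Ks _] := P_stab (lattice_shear_P sym Os).
rewrite p_SpE //; last exact: Bs_f.
have Bse j : Bs (s i j *: e (wd j)) by apply: Bs_Z => //; apply: Bs_e.
have -> : lattice_shear s (varpi^-1 *: f (wd i)) =
    varpi^-1 *: f (wd i) + \sum_j s i j *: e (wd j).
  rewrite lattice_shearE; congr (_ + _); rewrite (bigD1 i) //= [X in _ + X]big1 ?addr0.
    apply: eq_bigr => j _; rewrite (b_Zr nform_r) (frame_ef frameW) eqxx mulr1.
    by rewrite mulrAC divff ?varpi_neq0 // mul1r.
  move=> t ti; apply: big1 => j _.
  by rewrite (b_Zr nform_r) (frame_ef frameW) widen_index_eq (negPf ti) !mulr0 scale0r.
rewrite pr_D ?pr_sum //; [|exact: Bs_f|exact: Bs_sum].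
by congr (_ + _); apply: eq_bigr => j _; rewrite pr_Z //; apply: Bs_e.
Qed.

Lemma shear_lift (s : 'I_l -> 'I_l -> F) : (forall i j, s i j = s j i) ->
  exists n, P_group beta B A n /\
    forall i, pSp (n \o varsigma)%VF (e_bar i) = - (f_bar i + \sum_j s i j *: e_bar j).
Proof.
(* The lift depends only on the value of [s i j], so the lifted matrix remains symmetric. *)
move=> sym; pose t i j := xget 0 [set y | O y /\ red y = s i j].
have tP i j : O (t i j) /\ red (t i j) = s i j.
  rewrite /t; case: xgetP => // no.
  by have [y Oy ys] := red_surj resm (s i j); case: (no y).
have tsym i j : t i j = t j i by rewrite /t sym.
have Ot i j : O (t i j) by case: (tP i j).
have Pn := lattice_shear_P tsym Ot; have [Kn _] := P_stab Pn.
exists (lattice_shear t); split=> // i.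
rewrite p_Sp_comp //; last exact: vsig_K.
rewrite comp_lfunE vsig_bar_e linearN /= lattice_shear_bar //.
by congr (- (_ + _)); apply: eq_bigr => j _; have [_ ->] := tP i j.
Qed.

Lemma K_decomposition g : K g -> exists n n' p,
  [/\ P_group beta B A n, P_group beta B A n', P_group beta B A p &
      g = ((n \o varsigma) \o ((n' \o varsigma) \o p))%VF].
Proof.
move=> Kg; have Kv := vsig_K.
have [s ssym sP] := two_transversals betabs_l betabs_r betabs_alt dimbs frame_bar
  isotropic_x e_bar_x (p_Sp_isometry Kg).
have [n [Pn nE]] := shear_lift ssym; have [Kn _] := P_stab Pn.
have Knv := K_comp Kn Kv.
have [s' s'sym s'P] := sP _ (p_Sp_isometry Knv) nE.
have [n' [Pn' n'E]] := shear_lift s'sym; have [Kn' _] := P_stab Pn'.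
have Knv' := K_comp Kn' Kv.
pose g1 := ((n \o varsigma)^-1 \o g)%VF; have Kg1 : K g1 := K_comp (K_inv Knv) Kg.
have pg1 : pSp g1 = ((pSp (n \o varsigma))^-1 \o pSp g)%VF.
  by rewrite (p_Sp_comp (K_inv Knv) Kg) (p_Sp_inv Knv).
(* The reductions of n' varsigma and of [g1] send x to the same Lagrangian, so they differ by an
   element of its stabilizer; hence [g2] is in P_B. *)
have [|q sq qE] := lagrangian_coset betabs_l betabs_r dimbs frame_bar isotropic_x e_bar_x
  (p_Sp_isometry Knv') (p_Sp_isometry Kg1).
  by move=> i; rewrite n'E memvN pg1.
pose g2 := ((n' \o varsigma)^-1 \o g1)%VF; have Kg2 : K g2 := K_comp (K_inv Knv') Kg1.
exists n, n', g2; split=> //.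
  apply: stab_P => //; rewrite (p_Sp_comp (K_inv Knv') Kg1) (p_Sp_inv Knv').
  rewrite qE lker0_compKf //.
  exact: (isometry_lker0 betabs_l betabs_r frame_eps dimbs (p_Sp_isometry Knv')).
apply/lfunP => w; rewrite [in RHS]comp_lfunE [X in (n \o varsigma)%VF X]comp_lfunE.
rewrite [g2 w]comp_lfunE (isometryWVK (K_iso Knv')) [g1 w]comp_lfunE.
by rewrite (isometryWVK (K_iso Knv)).
Qed.

Local Notation relations := (weil_relations v varpi lam beta psi red B A pr l varsigma).

Lemma S_representation : representation K H S.
Proof.
split=> [g ph Kg Hph|g a ph ph' Kg Hph Hph'|ph Hph|g h ph Kg Kh Hph].
- exact: S_stable.
- exact: S_linear.
- exact: S_one.
- exact: S_mul.
Qed.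

Lemma S_relations : relations S.
Proof. by split=> [p ph|ph]; [apply: S_parabolic | apply: S_varsigma]. Qed.

Lemma S_unique T : representation K H T -> relations T ->
  forall g xi, K g -> H xi -> T g xi = S g xi.
Proof.
move=> repT relT g xi Kg Hxi.
pose agree g := K g /\ forall xi, H xi -> T g xi = S g xi.
have agP p : P_group beta B A p -> agree p.
  move=> Pp; have [Kp _] := P_stab Pp; split=> // ph Hph.
  by rewrite (rel_parabolic relT) // (rel_parabolic S_relations).
have agV : agree varsigma.
  split=> [|ph Hph]; first exact: vsig_K.
  by rewrite (rel_varsigma relT) // (rel_varsigma S_relations).
(* After T c is replaced by S c, agreement at a is applied to S c ph, which has to remain in the
   Hilbert space. *)
have agM a c : agree a -> agree c -> agree (a \o c)%VF.
  move=> [Ka ha] [Kc hc]; split=> [|ph Hph]; first exact: K_comp.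
  rewrite (rep_mul repT) // hc // ha; last exact: S_stable.
  by rewrite S_mul.
have [n [n' [p [Pn Pn' Pp ->]]]] := K_decomposition Kg.
have [_] := agM _ _ (agM _ _ (agP _ Pn) agV) (agM _ _ (agM _ _ (agP _ Pn') agV) (agP _ Pp)).
exact.
Qed.

End LocalWeil.

Theorem mainTheorem4 (R : realType)
  (k : topFieldType) (v : k -> int) (varpi : k)
  (F : finFieldType) (red : k -> F)
  (psi : k -> R[i]) (lam : int)
  (W : vectType k) (beta : {biscalar W}) (r : nat)
  (B A : set W) (l : nat) (bs : vectType F) (pr : W -> bs)
  (e f : 'I_r -> W) (varsigma : 'End(W))
  (eps phi : 'I_l -> bs) (theta : 'End(bs) -> F) :
  nonarchimedean_local_field v ->
  [pchar k] =i pred0 ->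
  uniformizer v varpi ->
  residue_map v red ->
  2%N \notin [pchar F] ->
  unitary_character psi ->
  (exists x, psi x <> 1) ->
  conductor v psi varpi lam ->
  symplectic_form beta ->
  \dim {:W} = (2 * r)%N -> (0 < r)%N ->
  good_lattice v varpi lam beta B ->
  selfdual_lattice v varpi lam beta A ->
  B `<=` A -> A `<=` dual_lattice v varpi lam beta B ->
  quotient_map v varpi lam beta red B pr ->
  \dim {:bs} = (2 * l)%N ->
  darboux_basis beta (varpi ^ lam) e f ->
  B = good_span v varpi l e f ->
  A = good_span v varpi 0 e f ->
  is_varsigma varpi l e f varsigma ->
  let betabs := beta_bs v varpi lam beta red B pr in
  let x := lagrangian A pr in
  darboux_basis betabs 1 eps phi ->
  (<<[seq eps i | i : 'I_l]>>)%VS = x ->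
  theta_function betabs x eps phi theta ->
  let K := stabilizer_lattice beta B in
  let H := hilbert_space beta psi A in
  let S := S_op v varpi lam beta psi red B A pr l theta in
  let relations := weil_relations v varpi lam beta psi red B A pr l varsigma in
  [/\ representation K H S,
      relations S
    & forall T, representation K H T -> relations T ->
        forall g xi, K g -> H xi -> T g xi = S g xi].
Proof.
move=> nlf _ uni resm char2 uchar _ cond sform dimW _ goodB selfA BsubA AsubBs quot dimbs.
move=> dar BE AE vsig betabs x dareps spaneps thf K H S relations.
split.
- exact: (S_representation nlf uni resm char2 uchar cond sform dimW goodB selfA BsubA AsubBs
    quot dimbs dar BE AE dareps spaneps thf).
- exact: (S_relations nlf uni resm char2 uchar cond sform dimW goodB selfA BsubA AsubBs
    quot dimbs dar BE AE vsig dareps spaneps thf).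
- exact: (S_unique nlf uni resm char2 uchar cond sform dimW goodB selfA BsubA AsubBs
    quot dimbs dar BE AE vsig dareps spaneps thf).
Qed.
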